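(* Consider the discrete-time Rayleigh fading MIMO channel (no channel state information) with $N_T$ transmit and $N_R$ receive antennas described in the context. For every $\rho>0$ and $\beta\ge 1$, $$C_{mimo-s}(\rho,\beta)\le U_{mimo-s}(\rho,\beta),$$ where $$U_{mimo-s}(\rho,\beta)=\max_{\underline{a}\in\mathcal{A}(\beta)}\ \sum_{l=0}^{N_R-1}\left\{\log\Big(1+\rho\sum_{k=0}^{N_T-1}R_{k,l}(0)\,a_k\Big)-\sum_{k=0}^{N_T-1}a_k I_{k,l}(\rho)\right\}$$ and $$\mathcal{A}(\beta)=\Big\{(a_0,\dots,a_{N_T-1}): a_k\ge 0\ \forall k,\ \sum_{k=0}^{N_T-1}a_k\le \tfrac1\beta\Big\}.$$
   Context: Channel model. For $n\in\mathbb{N}$ the input is $\sqrt{\rho}\,\underline{Z}(n)$ with $\underline{Z}(n)=(Z_0(n),\dots,Z_{N_T-1}(n))\in\mathbb{C}^{N_T}$, and the output $\underline{Y}(n)\in\mathbb{C}^{N_R}$ is $$Y_l(n)=\sqrt{\rho}\sum_{k=0}^{N_T-1}H_{k,l}(n)Z_k(n)+W_l(n),\qquad 0\le l\le N_R-1 .$$ The fading processes $H_{k,l}=(H_{k,l}(n):n\in\mathbb{Z})$ are zero-mean, stationary and ergodic, jointly proper complex normal (i.e. jointly circularly symmetric complex Gaussian), and mutually independent for distinct pairs $(k,l)$. $H_{k,l}$ has autocorrelation function $R_{k,l}(n)=E[H_{k,l}(n)H_{k,l}^*(0)]$ and spectral density $S_{k,l}(\omega)$, with $R_{k,l}(n)=\int_{-\pi}^{\pi}S_{k,l}(\omega)e^{jn\omega}\frac{d\omega}{2\pi}$.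 It is assumed that $\phi_{k,l}=\sum_{n=1}^\infty|R_{k,l}(n)|^2<\infty$ for all $k,l$. The $W_l(n)$ are iid (over $l$ and $n$) proper complex normal with zero mean and unit variance. Fading, additive noise and input are mutually independent (neither transmitter nor receiver observes the fading). Logarithms are natural. Define $I_{k,l}(\rho)=\int_{-\pi}^{\pi}\log(1+\rho S_{k,l}(\omega))\frac{d\omega}{2\pi}$. Sum power constraints: $\|\underline{Z}(n)\|_2^2\le 1$ for all $n$ and $E[\|\underline{Z}(n)\|_2^2]\le 1/\beta$ for all $n$. $C_{mimo-s}(\rho,\beta)$ denotes the information theoretic capacity under these constraints, i.e. $\lim_{N\to\infty}\frac1N\sup I(\underline{Z}(1),\dots,\underline{Z}(N);\underline{Y}(1),\dots,\underline{Y}(N))$, the supremum being over joint distributions of $(\underline{Z}(1),\dots,\underline{Z}(N))$ satisfying the constraints for $1\le n\le N$. *)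

(* Defs.v *)
From HB Require Import structures.
From mathcomp Require Import all_boot all_order all_algebra.
From mathcomp Require Import all_classical all_reals all_analysis.
From mathcomp Require Import measurable_realfun complex.

Set Implicit Arguments.
Unset Strict Implicit.
Unset Printing Implicit Defensive.

Import Order.TTheory GRing.Theory Num.Theory.
Import numFieldNormedType.Exports.

Local Open Scope classical_set_scope.
Local Open Scope ring_scope.

(* R[i] is identified with R * R and carries the Borel sigma-algebra of the
   plane, i.e. the preimages of the measurable subsets of R * R. *)

Section complex_measurable.
Context {R : realType}.

Definition complex_pair (z : R[i]) : R * R := (complex.Re z, complex.Im z).

HB.instance Definition _ := isPointed.Build R[i] (0 : R[i]).

Let complex_measurable : set (set R[i]) :=
  g_sigma_algebra_preimage complex_pair.

Let complex_set0 : complex_measurable set0.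
Proof. exact: (@measurable0 _ (g_sigma_algebra_preimageType complex_pair)). Qed.

Let complex_setC A : complex_measurable A -> complex_measurable (~` A).
Proof. exact: (@measurableC _ (g_sigma_algebra_preimageType complex_pair)). Qed.

Let complex_bigcup (F : (set R[i])^nat) :
  (forall i, complex_measurable (F i)) -> complex_measurable (\bigcup_i F i).
Proof.
exact: (@bigcupT_measurable _ (g_sigma_algebra_preimageType complex_pair)).
Qed.

HB.instance Definition _ :=
  @isMeasurable.Build (preimage_display complex_pair) R[i]
    complex_measurable complex_set0 complex_setC complex_bigcup.

Lemma measurable_complex_pair : measurable_fun setT complex_pair.
Proof. by move=> _ A mA; exists A. Qed.

Lemma measurable_funRe : measurable_fun setT (@complex.Re R).
Proof. exact: (measurableT_comp measurable_fst measurable_complex_pair). Qed.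

Lemma measurable_funIm : measurable_fun setT (@complex.Im R).
Proof. exact: (measurableT_comp measurable_snd measurable_complex_pair). Qed.

Lemma measurable_fun_complexP d (T : measurableType d) (f : T -> R[i]) :
  measurable_fun setT f <->
  measurable_fun setT (@complex.Re R \o f) /\ measurable_fun setT (@complex.Im R \o f).
Proof.
split=> [mf|[mRe mIm]].
  by split; [exact: (measurableT_comp measurable_funRe mf)
            |exact: (measurableT_comp measurable_funIm mf)].
move=> _ _ [B mB <-]; rewrite (setTI (complex_pair @^-1` B)) -comp_preimage.
by have := measurable_fun_pair mRe mIm measurableT mB.
Qed.

Lemma measurable_funDc d (T : measurableType d) (f g : T -> R[i]) :
  measurable_fun setT f -> measurable_fun setT g ->
  measurable_fun setT (fun x => f x + g x).
Proof.
move=> /measurable_fun_complexP[fr fi] /measurable_fun_complexP[gr gi].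
apply/measurable_fun_complexP; split.
  rewrite [X in measurable_fun _ X](_ : _ =
    (@complex.Re R \o f) \+ (@complex.Re R \o g)); first exact: measurable_funD.
  by apply/funext => x /=; case: (f x) (g x) => [a b] [].
rewrite [X in measurable_fun _ X](_ : _ =
  (@complex.Im R \o f) \+ (@complex.Im R \o g)); first exact: measurable_funD.
by apply/funext => x /=; case: (f x) (g x) => [a b] [].
Qed.

Lemma measurable_funMc d (T : measurableType d) (f g : T -> R[i]) :
  measurable_fun setT f -> measurable_fun setT g ->
  measurable_fun setT (fun x => f x * g x).
Proof.
move=> /measurable_fun_complexP[fr fi] /measurable_fun_complexP[gr gi].
apply/measurable_fun_complexP; split.
  rewrite [X in measurable_fun _ X](_ : _ =
    (((@complex.Re R \o f) \* (@complex.Re R \o g)) \-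
     ((@complex.Im R \o f) \* (@complex.Im R \o g)))); last first.
    by apply/funext => x /=; case: (f x) (g x) => [a b] [].
  by apply: measurable_funB; exact: measurable_funM.
rewrite [X in measurable_fun _ X](_ : _ =
  (((@complex.Re R \o f) \* (@complex.Im R \o g)) \+
   ((@complex.Im R \o f) \* (@complex.Re R \o g)))); last first.
  by apply/funext => x /=; case: (f x) (g x) => [a b] [].
by apply: measurable_funD; exact: measurable_funM.
Qed.

Lemma measurable_fun_sumc d (T : measurableType d) n (f : 'I_n -> T -> R[i]) :
  (forall i, measurable_fun setT (f i)) ->
  measurable_fun setT (fun x => \sum_(i < n) f i x).
Proof.
elim: n f => [|n IHn] f mf.
  by under eq_fun do rewrite big_ord0; exact: measurable_cst.
under eq_fun do rewrite big_ord_recr /=.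
by apply: measurable_funDc => //; apply: IHn => i; exact: mf.
Qed.

End complex_measurable.

Definition integralC d (T : measurableType d) (R : realType)
    (mu : {measure set T -> \bar R}) (D : set T) (f : T -> R[i]) : R[i] :=
  Complex (\int[mu]_(x in D) complex.Re (f x)) (\int[mu]_(x in D) complex.Im (f x)).

Definition meanC d (T : measurableType d) (R : realType)
    (P : probability T R) (X : T -> R[i]) : R[i] := integralC P setT X.

Definition expi (R : realType) (t : R) : R[i] := Complex (cos t) (sin t).

Section random_elements.
Context d (Omega : measurableType d) (R : realType) (P : probability Omega R).

(* [normal_prob m 0] is by convention the uniform law on [0, 1], whence the
   separate clause for the degenerate normal laws. *)
Definition normal_variable (X : Omega -> R) : Prop :=
  exists m s : R, forall A : set R, measurable A ->
    P (X @^-1` A) = if s == 0 then \d_m A else normal_prob m s A.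

(* Joint normality of the real and imaginary parts (every real linear
   combination is normal), plus vanishing pseudo-covariances. *)
Definition jointly_proper_normal (I : Type) (X : I -> Omega -> R[i]) : Prop :=
  (forall (n : nat) (i : 'I_n -> I) (a b : 'I_n -> R),
     normal_variable (fun w => \sum_(j < n)
       (a j * complex.Re (X (i j) w) + b j * complex.Im (X (i j) w)))) /\
  (forall i j : I,
     meanC P (fun w => (X i w - meanC P (X i)) * (X j w - meanC P (X j))) = 0).

Definition proper_normal (X : Omega -> R[i]) : Prop :=
  jointly_proper_normal (fun _ : unit => X).

(* [F] is the sigma-algebra of the common state space. *)
Definition mutually_independent (J : eqType) (T : Type) (F : set (set T))
    (X : J -> Omega -> T) : Prop :=
  forall (s : seq J) (B : J -> set T), uniq s -> (forall j, F (B j)) ->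
    P (\bigcap_(j in [set` s]) (X j @^-1` B j)) =
    (\prod_(j <- s) P (X j @^-1` B j))%E.

Definition independent_pair (T1 T2 : Type) (F1 : set (set T1)) (F2 : set (set T2))
    (X1 : Omega -> T1) (X2 : Omega -> T2) : Prop :=
  forall B1 B2, F1 B1 -> F2 B2 ->
    P (X1 @^-1` B1 `&` X2 @^-1` B2) = (P (X1 @^-1` B1) * P (X2 @^-1` B2))%E.

End random_elements.

(* The product sigma-algebra on families [I -> T]. *)
Definition path_measurable (I : Type) d (T : measurableType d) : set (set (I -> T)) :=
  <<s \bigcup_(i in [set: I]) preimage_set_system setT (fun x : I -> T => x i) measurable >>.
Arguments path_measurable I {d} T.

Definition path (Omega I T : Type) (X : I -> Omega -> T) : Omega -> I -> T :=
  fun w i => X i w.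

Definition shift (T : Type) (x : int -> T) : int -> T := fun n => x (n + 1).

Section processes.
Context d (Omega : measurableType d) (R : realType) (P : probability Omega R).
Variable X : int -> Omega -> R[i].

Definition stationary : Prop :=
  forall B, path_measurable int R[i] B ->
    P (path X @^-1` (@shift R[i] @^-1` B)) = P (path X @^-1` B).

(* Every shift-invariant event of the path space has probability 0 or 1. *)
Definition ergodic : Prop :=
  forall B, path_measurable int R[i] B -> @shift R[i] @^-1` B = B ->
    P (path X @^-1` B) = 0%E \/ P (path X @^-1` B) = 1%E.

Definition autocorrelation (n : int) : R[i] :=
  meanC P (fun w => X n w * conjc (X 0 w)).

End processes.

Section spectrum.
Context {R : realType}.
Notation leb := (@lebesgue_measure R).

Record spectral_density (Rf : int -> R[i]) (S : R -> R) : Prop := {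
  spectral_ge0 : forall t, t \in `[- pi, pi] -> 0 <= S t;
  spectral_integrable : leb.-integrable `[- pi, pi] (EFin \o S);
  spectral_autocorrelation : forall n : int, Rf n =
    integralC leb `[- pi, pi]
      (fun t => (S t / (2 * pi))%:C%C * expi (n%:~R * t)) }.

Definition info_rate (rho : R) (S : R -> R) : R :=
  \int[leb]_(t in `[- pi, pi]) (ln (1 + rho * S t) / (2 * pi)).

End spectrum.

(* [H k l n] is the fading coefficient from transmit antenna
   [k] to receive antenna [l] at time [n], [W l n] the additive noise, and
   [S k l] the spectral density of [H k l].  Independence of the input is built
   into [channel_information] below. *)
Record mimo_channel d (Omega : measurableType d) (R : realType)
    (P : probability Omega R) (NT NR : nat)
    (H : 'I_NT -> 'I_NR -> int -> {RV P >-> R[i]})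
    (W : 'I_NR -> nat -> {RV P >-> R[i]})
    (S : 'I_NT -> 'I_NR -> R -> R) : Prop := {
  fading_zero_mean : forall k l n, meanC P (H k l n) = 0;
  fading_stationary : forall k l, stationary P (H k l);
  fading_ergodic : forall k l, ergodic P (H k l);
  fading_proper_normal : jointly_proper_normal P
    (fun p : 'I_NT * 'I_NR * int => H p.1.1 p.1.2 p.2 : Omega -> R[i]);
  fading_independent : mutually_independent P (path_measurable int R[i])
    (fun (p : 'I_NT * 'I_NR) => path (H p.1 p.2));
  fading_spectral_density : forall k l,
    spectral_density (autocorrelation P (H k l)) (S k l);
  fading_summable : forall k l,
    (\sum_(1 <= n <oo)
       (Normc.normc (autocorrelation P (H k l) n%:Z) ^+ 2)%:E < +oo)%E;
  noise_proper_normal : forall l n, proper_normal P (W l n);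
  noise_zero_mean : forall l n, meanC P (W l n) = 0;
  noise_unit_variance : forall l n,
    ('E_P[fun w => (Normc.normc (W l n w) ^+ 2)%R] = 1)%E;
  noise_independent : mutually_independent P (@measurable _ R[i])
    (fun (p : 'I_NR * nat) => W p.1 p.2 : Omega -> R[i]);
  fading_noise_independent : independent_pair P
    (path_measurable ('I_NT * 'I_NR * int)%type R[i])
    (path_measurable ('I_NR * nat)%type R[i])
    (path (fun p : 'I_NT * 'I_NR * int => H p.1.1 p.1.2 p.2))
    (path (fun p : 'I_NR * nat => W p.1 p.2)) }.

Section mutual_information.
Local Open Scope ereal_scope.
Local Open Scope charge_scope.

(* Kullback-Leibler divergence, in nats.  [ln] is 0 on nonpositive reals, but
   the density is positive [mu]-almost everywhere. *)
Definition KL d (T : measurableType d) (R : realType) (mu nu : probability T R)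
    : \bar R :=
  if `[< mu `<< nu >] then
    \int[mu]_x (ln (fine (('d (charge_of_finite_measure mu) '/d nu) x)))%:E
  else +oo.

Context d (T : measurableType d) (R : realType) (P : probability T R).
Context d1 (T1 : measurableType d1) d2 (T2 : measurableType d2).

Definition pairing (X : {RV P >-> T1}) (Y : {RV P >-> T2}) : T -> T1 * T2 :=
  fun w => (X w, Y w).

HB.instance Definition _ (X : {RV P >-> T1}) (Y : {RV P >-> T2}) :=
  isMeasurableFun.Build _ _ _ _ (pairing X Y)
    (measurable_fun_pair (measurable_funP X) (measurable_funP Y)).

Definition mutual_information (X : {RV P >-> T1}) (Y : {RV P >-> T2}) : \bar R :=
  KL (distribution P (pairing X Y)) (distribution P X \x distribution P Y).

End mutual_information.

Section capacity.
Context d (Omega : measurableType d) (R : realType) (P : probability Omega R).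
Variables (NT NR : nat).
Variable H : 'I_NT -> 'I_NR -> int -> {RV P >-> R[i]}.
Variable W : 'I_NR -> nat -> {RV P >-> R[i]}.
Variables (rho beta : R).

(* Blocks of [N] vectors of [M] complex symbols; entry [i : 'I_N] is the
   vector sent or received at time [i + 1]. *)
Notation block N M := (N.-tuple (M.-tuple R[i])).

Section block_length.
Variable N : nat.

Definition channel_input (zw : block N NT * Omega) : block N NT := zw.1.

Definition channel_output (zw : block N NT * Omega) : block N NR :=
  [tuple [tuple (Num.sqrt rho)%:C%C *
                  (\sum_(k < NT) H k l i.+1%:Z zw.2 * tnth (tnth zw.1 i) k)
                + W l i.+1 zw.2 | l < NR] | i < N].

Lemma measurable_channel_input : measurable_fun setT channel_input.
Proof. exact: measurable_fst. Qed.

Lemma measurable_channel_output : measurable_fun setT channel_output.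
Proof.
apply/measurable_fun_tnthP => i; apply/measurable_fun_tnthP => l.
rewrite [X in measurable_fun _ X](_ : _ = fun zw : block N NT * Omega =>
    (Num.sqrt rho)%:C%C *
      (\sum_(k < NT) H k l i.+1%:Z zw.2 * tnth (tnth zw.1 i) k)
    + W l i.+1 zw.2); last by apply/funext => zw /=; rewrite !tnth_mktuple.
apply: measurable_funDc; last exact: measurableT_comp.
apply: measurable_funMc; first exact: measurable_cst.
apply: measurable_fun_sumc => k; apply: measurable_funMc.
  exact: measurableT_comp.
apply: (measurableT_comp (measurable_tnth k)).
exact: (measurableT_comp (measurable_tnth i)).
Qed.

HB.instance Definition _ := isMeasurableFun.Build _ _ _ _
  channel_input measurable_channel_input.
HB.instance Definition _ := isMeasurableFun.Build _ _ _ _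
  channel_output measurable_channel_output.

(* I(Z(1), ..., Z(N); Y(1), ..., Y(N)) when the input block has law [mu];
   under [mu \x P] the input is independent of fading and noise. *)
Definition channel_information (mu : probability (block N NT) R) : \bar R :=
  @mutual_information _ _ _ (mu \x P)%E _ _ _ _ channel_input channel_output.

Definition sqnorm (z : NT.-tuple R[i]) : R :=
  \sum_(k < NT) Normc.normc (tnth z k) ^+ 2.

Definition sum_power_constraint (mu : probability (block N NT) R) : Prop :=
  {ae mu, forall z, forall i : 'I_N, sqnorm (tnth z i) <= 1} /\
  (forall i : 'I_N, ('E_mu[fun z => sqnorm (tnth z i)] <= (beta^-1)%:E)%E).

End block_length.

(* The suprema over block lengths form a superadditive sequence, so that the
   limit exists. *)
Definition capacity_mimo_s : \bar R :=
  limn (fun N => ((N%:R^-1)%:E *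
    ereal_sup [set channel_information mu | mu in @sum_power_constraint N])%E).

End capacity.

Section upper_bound.
Context d (Omega : measurableType d) (R : realType) (P : probability Omega R).
Variables (NT NR : nat).
Variable H : 'I_NT -> 'I_NR -> int -> {RV P >-> R[i]}.
Variable S : 'I_NT -> 'I_NR -> R -> R.
Variables (rho beta : R).

Definition power_region : set 'rV[R]_NT :=
  [set a | (forall k, 0 <= a ord0 k) /\ \sum_(k < NT) a ord0 k <= beta^-1].

(* R_{k,l}(0) = E|H_{k,l}(0)|^2 is real. *)
Definition bound_objective (a : 'rV[R]_NT) : R :=
  \sum_(l < NR)
    (ln (1 + rho * \sum_(k < NT) complex.Re (autocorrelation P (H k l) 0) * a ord0 k)
     - \sum_(k < NT) a ord0 k * info_rate rho (S k l)).

End upper_bound.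

Definition is_maximum (R : realType) (A : set R) (m : R) : Prop :=
  A m /\ ubound A m.

(* Main.v *)
(* Given the input block [z], the outputs at antenna [l] are a proper complex normal vector
   with covariance [A_l(z) = I + rho * sum_k D_k R_{k,l} D_k^*], where [D_k] is diagonal with
   entries [z_{i,k}] and [R_{k,l}] is the Toeplitz matrix of the fading, so the output has an
   explicit density with respect to the noise.  Replacing the true output law, in the mutual
   information, by a product of centred normal laws of the same variances only increases the
   divergence, and gives
   [I(Z;Y) <= sum_l (sum_i ln (1 + rho * sum_k R_{k,l}(0) E|Z_{i,k}|^2) - E ln det A_l(Z))].
   Each eigenvalue of [A_l(z)], for a unit eigenvector [u], is an average of
   [1 + rho S_{k,l}] over the weights [|sum_i u_i z_{i,k} e^{j i t}|^2], completed by the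
   constant 1 since these weights have total mass at most 1 under the peak constraint.
   Jensen's inequality for [ln], summed over an orthonormal eigenbasis, yields
   [ln det A_l(z) >= sum_k (sum_i |z_{i,k}|^2) I_{k,l}(rho)].  The bound is therefore a sum over
   [i] of the objective at [a_k = E|Z_{i,k}|^2], which lies in the power region. *)

From HB Require Import structures.
Require Import Defs.
From mathcomp Require Import all_boot all_order all_algebra.
From mathcomp Require Import all_classical all_reals all_analysis.
From mathcomp Require Import measurable_realfun complex ring lra.

Set Implicit Arguments.
Unset Strict Implicit.
Unset Printing Implicit Defensive.

Import Order.TTheory GRing.Theory Num.Theory.
Import numFieldNormedType.Exports.

Local Open Scope classical_set_scope.
Local Open Scope ring_scope.

(** * Uniqueness of laws from cosine transforms *)

(** No density with respect to Lebesgue measure on blocks appears: every output law is compared with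
    the law of the noise block. Given the input, the output is distributed as noise scaled entrywise
    by square roots of eigenvalues, then rotated by the eigenbasis. The scaling has an explicit
    likelihood ratio, which independence splits into scalar ratios, and the rotation preserves the
    noise law. Laws are identified by integrals of [cos (l + a)] over real linear forms [l] and
    phases [a], a real substitute for characteristic functions; the free phase replaces the sine
    part and makes the formula stable under independent sums. The comparison with the product of
    normal laws must not presuppose that the logarithm of the true output density [q] is integrable.
    Hence the pointwise [ln (p / q) <= p / q - 1], whose right side has mean zero under the joint
    law, replaces a subtraction of divergences. The reference variances are the mean output powers,
    so the quadratic term contributes one per received symbol and cancels the mean of the inverse
    form. *)

Section bounded_measurable.
Context d (T : measurableType d) (R : realType).

Definition bounded_mfun (h : T -> R) : Prop :=
  measurable_fun setT h /\ exists M, forall x, `|h x| <= M.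

Lemma bounded_mfunD f g : bounded_mfun f -> bounded_mfun g ->
  bounded_mfun (fun x => f x + g x).
Proof.
move=> [mf [M fM]] [mg [K gK]]; split; first exact: measurable_funD.
by exists (M + K) => x; rewrite (le_trans (ler_normD _ _)) ?lerD.
Qed.

Lemma bounded_mfunM f g : bounded_mfun f -> bounded_mfun g ->
  bounded_mfun (fun x => f x * g x).
Proof.
move=> [mf [M fM]] [mg [K gK]]; split; first exact: measurable_funM.
by exists (M * K) => x; rewrite normrM ler_pM.
Qed.

Lemma bounded_mfun_cst c : bounded_mfun (cst c).
Proof. by split; [exact: measurable_cst|exists `|c|]. Qed.

Lemma bounded_mfun_cos f : measurable_fun setT f ->
  bounded_mfun (fun x => cos (f x)).
Proof.
move=> mf; split; last by exists 1 => x; rewrite ler_norml cos_geN1 cos_le1.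
by apply: measurableT_comp mf; apply: continuous_measurable_fun; exact: continuous_cos.
Qed.

Lemma bounded_mfun_integrable (P : probability T R) h : bounded_mfun h ->
  P.-integrable setT (EFin \o h).
Proof.
move=> [mh [M hM]]; apply: (@le_integrable _ _ _ P setT measurableT _ (EFin \o cst M)) => //.
- exact/measurable_EFinP.
- by move=> x _ /=; rewrite lee_fin (le_trans (hM x))// ler_norm.
- exact: finite_measure_integrable_cst.
Qed.

Lemma bounded_cvg_Rintegral (P : probability T R) (h_ : nat -> T -> R) (h : T -> R) (M : R) :
  (forall n, measurable_fun setT (h_ n)) -> (forall n x, `|h_ n x| <= M) ->
  (forall x, h_ ^~ x @ \oo --> h x) ->
  bounded_mfun h /\
  (\int[P]_x h_ n x) @[n --> \oo] --> \int[P]_x h x.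
Proof.
move=> mh_ hM hh.
have mh : measurable_fun setT h.
  by apply: (measurable_fun_cvg mh_) => x _; exact: hh.
have bh : bounded_mfun h.
  split => //; exists M => x.
  apply: (ler_cvg_to (cvg_norm (hh x)) (@cvg_cst _ M _ _ _)).
  by apply: nearW => n; exact: hM.
split => //.
have := @dominated_convergence _ _ _ P setT measurableT
  (fun n => EFin \o h_ n) (EFin \o h) (cst M%:E)
  (fun n => (measurable_EFinP _ _).2 (mh_ n)) ((measurable_EFinP _ _).2 mh) (aeW _ _) (finite_measure_integrable_cst _ _ _) (aeW _ _).
case=> [x _|//|x n _|_ _ c] /=.
- by apply: cvg_EFin; [exact: nearW|exact: hh].
- by rewrite lee_fin.
apply: fine_cvg.
rewrite fineK; last by apply: integrable_fin_num => //; exact: bounded_mfun_integrable.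
exact: c.
Qed.

End bounded_measurable.

Section exp_limits.
Context {R : realType}.
Implicit Types x y M : R.

(** A bound uniform in the truncation order, so that the exponential of a bounded function is a
    bounded limit of polynomials in it. *)
Lemma normr_series_exp_coeff_le x M n : `|x| <= M ->
  `|series (exp_coeff x) n| <= expR M.
Proof.
move=> xM; have M0 : 0 <= M by exact: le_trans xM.
apply: (@le_trans _ _ (series (exp_coeff M) n)).
  rewrite /series /= (le_trans (ler_norm_sum _ _ _))//; apply: ler_sum => i _.
  rewrite /exp_coeff /= normrM normrX normfV [`|i`!%:R|]ger0_norm//.
  by rewrite ler_wpM2r ?invr_ge0// lerXn2r ?nnegrE.
apply: nondecreasing_cvgn_le; last exact: is_cvg_series_exp_coeff.
by apply: nondecreasing_series => k _ _; exact: exp_coeff_ge0.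
Qed.

(** The limit is the derivative of [sin (t * x)] at [t = 0]. It recovers an unbounded linear form
    from sines, hence from phase-shifted cosines. *)
Lemma cvg_scaled_sin x : (n.+1%:R * sin (n.+1%:R^-1 * x)) @[n --> \oo] --> x.
Proof.
have d : is_derive (0 : R) 1 (fun t => sin (t * x)) x.
  have := @is_derive1_comp _ sin (fun t => t * x) 0 _ x (is_derive_sin _) _.
  rewrite mul0r cos0 mul1r; apply.
  by apply: is_derive_eq; rewrite scaler0 add0r /GRing.scale /= mulr1.
have [/cvg_ex[l dl] xE] := d.
have lE : l = x by rewrite -xE; apply/esym/cvg_lim.
move: dl; rewrite lE => /cvgr_dnbhsP /(_ (fun n => n.+1%:R^-1)) => H.
have {}H := H (conj (fun n => invr_neq0 (lt0r_neq0 (ltr0Sn _ _))) (@cvg_harmonic R)).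
apply: cvg_trans H; apply: near_eq_cvg; apply: nearW => n /=.
by rewrite invrK /GRing.scale /= mulr1 !addr0 mul0r sin0 subr0.
Qed.

(** A route from [x] to the indicator of [0 < x] that uses only exponentials and stays in [[0, 1]].
    For [x > 0] the outer exponent tends to 0; for [x <= 0] it is at most [- k.+1], so the limit is
    0 at [x = 0] as well. *)
Lemma cvg_double_exp x :
  expR (- k.+1%:R * expR (- k.+1%:R * x)) @[k --> \oo] --> (if 0 < x then 1 else 0 : R).
Proof.
have [x0|x0|<-] := ltgtP 0 x.
- have c0 : (k.+1%:R * expR (- k.+1%:R * x) : R) @[k --> \oo] --> (0 : R).
    apply: (@squeeze_cvgr _ _ _ _ (cst 0) (fun k => 4 / x ^+ 2 * k.+1%:R^-1)).
    - apply: nearW => k /=; rewrite mulr_ge0 ?expR_ge0//=.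
      set y : R := k.+1%:R; have y0 : 0 < y by rewrite ltr0Sn.
      (* This is [u <= exp u] at [u = y * x / 2], squared; it yields the squeezing bound
         [y * exp (- y * x) <= 4 / x ^ 2 / y]. *)
      have h : (y * x / 2) ^+ 2 <= expR (y * x).
        rewrite [in leRHS](_ : y * x = y * x / 2 + y * x / 2); last by field.
        have yx0 : 0 <= y * x / 2 by rewrite divr_ge0// mulr_ge0// ltW.
        have yxe : y * x / 2 <= expR (y * x / 2).
          by rewrite (le_trans _ (expR_ge1Dx _))// lerDr.
        by rewrite expRD expr2 ler_pM.
      rewrite mulNr expRN ler_pdivrMr ?expR_gt0//.
      apply: (@le_trans _ _ (4 / x ^+ 2 * y^-1 * (y * x / 2) ^+ 2)).
        rewrite le_eqVlt; apply/orP; left; apply/eqP; field.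
        by rewrite !gt_eqF.
      by rewrite ler_wpM2l// !mulr_ge0 ?invr_ge0 ?exprn_ge0// ltW.
    - exact: cvg_cst.
    - rewrite -[X in _ --> X](mulr0 (4 / x ^+ 2)).
      by apply: cvgMr; exact: cvg_harmonic.
  rewrite -[X in _ --> X]expR0; apply: (cvg_comp _ expR); last exact: continuous_expR.
  under eq_fun do rewrite mulNr.
  have := @cvgN _ R^o _ _ _ _ _ c0; rewrite oppr0; exact.
- apply: (@squeeze_cvgr _ _ _ _ (cst 0) (fun k => k.+1%:R^-1)); last 2 first.
    exact: cvg_cst.
    exact: cvg_harmonic.
  apply: nearW => k /=; rewrite expR_ge0/= mulNr expRN lef_pV2 ?posrE ?expR_gt0//.
  rewrite (le_trans _ (expR_ge1Dx _))//.
  apply: (@le_trans _ _ (k.+1%:R * expR (- k.+1%:R * x))); last by rewrite lerDr.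
  by rewrite ler_peMr// -expR0 ler_expR mulNr oppr_ge0 mulr_ge0_le0 ?ltW.
- apply: (@squeeze_cvgr _ _ _ _ (cst 0) (fun k => k.+1%:R^-1)); last 2 first.
    exact: cvg_cst.
    exact: cvg_harmonic.
  apply: nearW => k /=; rewrite expR_ge0/= mulr0 expR0 mulr1 expRN lef_pV2 ?posrE ?expR_gt0//.
  by rewrite (le_trans _ (expR_ge1Dx _))// lerDr.
Qed.

End exp_limits.

Section cos_transform_uniqueness.
Context d (T : measurableType d) (R : realType) (mu nu : probability T R).
Variable L : set (T -> R).
Hypothesis L_meas : forall l, L l -> measurable_fun setT l.
Hypothesis L0 : L (cst 0).
Hypothesis LD : forall l l', L l -> L l' -> L (fun x => l x + l' x).
Hypothesis Laff : forall c a l, L l -> L (fun x => c * l x + a).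
Hypothesis cosE : forall l, L l -> \int[mu]_x cos (l x) = \int[nu]_x cos (l x).

Let same_int (h : T -> R) := \int[mu]_x h x = \int[nu]_x h x.

(** Functions that cannot separate the two laws even after multiplication by a cosine from [L]. *)
Let H1 (h : T -> R) := bounded_mfun h /\
  forall l, L l -> same_int (fun x => h x * cos (l x)).

(** Multipliers of [H1]. Unlike [H1], this class is closed under products by construction, hence is
    an algebra closed under bounded pointwise limits. That is what lets exponentials, and then
    indicators, be built from cosines. *)
Let H2 (h : T -> R) := bounded_mfun h /\
  forall g, H1 g -> H1 (fun x => h x * g x).

Let bcos l : L l -> bounded_mfun (fun x => cos (l x)).
Proof. by move=> /L_meas; exact: bounded_mfun_cos. Qed.

Let same_intD f g : bounded_mfun f -> bounded_mfun g ->
  same_int f -> same_int g -> same_int (fun x => f x + g x).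
Proof.
move=> bf bg ef eg; rewrite /same_int !RintegralD//;
  try exact: bounded_mfun_integrable.
by rewrite ef eg.
Qed.

Let same_intZ c f : bounded_mfun f -> same_int f -> same_int (fun x => c * f x).
Proof.
move=> bf ef; rewrite /same_int !RintegralZl//; try exact: bounded_mfun_integrable.
by rewrite ef.
Qed.

Let H1_lim (h_ : nat -> T -> R) (h : T -> R) (M : R) : (forall n, H1 (h_ n)) ->
  (forall n x, `|h_ n x| <= M) -> (forall x, h_ ^~ x @ \oo --> h x) -> H1 h.
Proof.
move=> Hh hM hc.
have [bh _] := bounded_cvg_Rintegral mu (fun n => (Hh n).1.1) hM hc.
split => // l Ll.
have c (P : probability T R) : (\int[P]_x (h_ n x * cos (l x))) @[n --> \oo] -->
    \int[P]_x (h x * cos (l x)).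
  apply: (@bounded_cvg_Rintegral _ _ _ _ (fun n x => h_ n x * cos (l x)) _ M _ _ _).2.
  - by move=> n; apply: measurable_funM; [exact: (Hh n).1.1|exact: (bcos Ll).1].
  - move=> n x; rewrite normrM -[M]mulr1 ler_pM// ler_norml cos_geN1 cos_le1//.
  - by move=> x; apply: cvgMl; exact: hc.
apply/esym; apply: cvg_unique (c mu) => //.
rewrite (_ : (fun n => _) = fun n => \int[nu]_x (h_ n x * cos (l x))).
  exact: c.
by apply/funext => n; exact: (Hh n).2.
Qed.

Let H1_1 : H1 (cst 1).
Proof.
split; first exact: bounded_mfun_cst.
by move=> l Ll; rewrite /same_int; under eq_Rintegral do rewrite mul1r;
  under [RHS]eq_Rintegral do rewrite mul1r; exact: cosE.
Qed.

Let H1_int h : H1 h -> same_int h.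
Proof.
move=> [bh /(_ _ L0)]; rewrite /same_int /=.
by under eq_Rintegral do rewrite cos0 mulr1;
  under [RHS]eq_Rintegral do rewrite cos0 mulr1.
Qed.

Let H1D f g : H1 f -> H1 g -> H1 (fun x => f x + g x).
Proof.
move=> [bf Hf] [bg Hg]; split; first exact: bounded_mfunD.
move=> l Ll; rewrite /same_int.
under eq_Rintegral do rewrite mulrDl; under [RHS]eq_Rintegral do rewrite mulrDl.
by apply: same_intD; [exact: bounded_mfunM (bcos Ll)|exact: bounded_mfunM (bcos Ll)
  |exact: Hf|exact: Hg].
Qed.

Let H1Z c f : H1 f -> H1 (fun x => c * f x).
Proof.
move=> [bf Hf]; split; first exact: bounded_mfunM (bounded_mfun_cst _ _) bf.
move=> l Ll; rewrite /same_int.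
under eq_Rintegral do rewrite -mulrA; under [RHS]eq_Rintegral do rewrite -mulrA.
by apply: same_intZ; [exact: bounded_mfunM (bcos Ll)|exact: Hf].
Qed.

Let H2_1 : H2 (cst 1).
Proof.
split; first exact: bounded_mfun_cst.
by move=> g; under eq_fun do rewrite mul1r.
Qed.

Let H2D f g : H2 f -> H2 g -> H2 (fun x => f x + g x).
Proof.
move=> [bf Hf] [bg Hg]; split; first exact: bounded_mfunD.
move=> h Hh; under eq_fun do rewrite mulrDl.
by apply: H1D; [exact: Hf|exact: Hg].
Qed.

Let H2M f g : H2 f -> H2 g -> H2 (fun x => f x * g x).
Proof.
move=> [bf Hf] [bg Hg]; split; first exact: bounded_mfunM.
move=> h Hh; under eq_fun do rewrite -mulrA.
by apply: Hf; exact: Hg.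
Qed.

Let H2Z c f : H2 f -> H2 (fun x => c * f x).
Proof.
move=> [bf Hf]; split; first exact: bounded_mfunM (bounded_mfun_cst _ _) bf.
by move=> h Hh; under eq_fun do rewrite -mulrA; exact/H1Z/Hf.
Qed.

Let H2cst c : H2 (cst c).
Proof. by have := H2Z c H2_1; under eq_fun do rewrite mulr1. Qed.

Let H2_lim (h_ : nat -> T -> R) (h : T -> R) (M : R) : (forall n, H2 (h_ n)) ->
  (forall n x, `|h_ n x| <= M) -> (forall x, h_ ^~ x @ \oo --> h x) -> H2 h.
Proof.
move=> Hh hM hc.
have [bh _] := bounded_cvg_Rintegral mu (fun n => (Hh n).1.1) hM hc.
split => // g Hg; have [_ [K gK]] := Hg.1.
apply: (@H1_lim (fun n x => h_ n x * g x) _ (M * K)).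
- by move=> n; exact: (Hh n).2.
- by move=> n x; rewrite normrM ler_pM.
- by move=> x; apply: cvgMl; exact: hc.
Qed.

(* [cos a * cos b = (cos (a + b) + cos (a - b)) / 2] keeps [L] stable *)
Let H2cos l : L l -> H2 (fun x => cos (l x)).
Proof.
move=> Ll; split; first exact: bcos.
move=> g [bg Hg]; split; first exact: bounded_mfunM (bcos Ll) bg.
move=> l' Ll'.
have Lp : L (fun x => l x + l' x) by exact: LD.
have Lm : L (fun x => l x + (- 1 * l' x + 0)) by apply: LD => //; exact: Laff.
have := same_intZ 2^-1 _ (same_intD _ _ (Hg _ Lp) (Hg _ Lm)).
have bgp := bounded_mfunM bg (bcos Lp).
have bgm := bounded_mfunM bg (bcos Lm).
move=> /(_ (bounded_mfunD bgp bgm) bgp bgm).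
rewrite /same_int (_ : (fun x => 2^-1 * _) = fun x => cos (l x) * g x * cos (l' x))//.
apply/funext => x; rewrite addr0 mulN1r cosD cosB.
by field.
Qed.

Let H2X f n : H2 f -> H2 (fun x => f x ^+ n).
Proof.
move=> Hf; elim: n => [|n IHn]; first by under eq_fun do rewrite expr0; exact: H2_1.
by under eq_fun do rewrite exprS; exact: H2M.
Qed.

Let H2exp f : H2 f -> H2 (fun x => expR (f x)).
Proof.
move=> Hf; have [_ [M fM]] := Hf.1.
apply: (@H2_lim (fun n x => series (exp_coeff (f x)) n) _ (expR M)).
- elim=> [|n IHn].
    rewrite /series /=; under eq_fun do rewrite big_nat_cond big_pred0_eq.
    exact: H2cst.
  rewrite /series /=; under eq_fun do rewrite big_nat_recr//=.
  apply: H2D => //; rewrite /exp_coeff /=.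
  by under eq_fun do rewrite mulrC; exact/H2Z/H2X.
- by move=> n x; exact: normr_series_exp_coeff_le.
- by move=> x; exact: is_cvg_series_exp_coeff.
Qed.

Let H2_gt l : L l -> H2 (fun x => if 0 < l x then 1 else 0).
Proof.
move=> Ll.
have hk k : H2 (fun x => expR (- k.+1%:R * expR (- k.+1%:R * l x))).
  (* The shift by [- (pi / 2)] turns the cosine into a sine, so the innermost term tends to [l x].
     The outer exponential has a negative exponent, which supplies the uniform bound 1 although [l]
     is unbounded. *)
  apply: (@H2_lim (fun n x => expR (- k.+1%:R * expR (- k.+1%:R *
    (n.+1%:R * cos (n.+1%:R^-1 * l x + - (pi / 2)))))) _ 1).
  - move=> n; apply/H2exp/H2Z/H2exp/H2Z/H2Z.
    by apply: H2cos; exact: Laff.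
  - by move=> n x; rewrite ger0_norm ?expR_ge0.
  - move=> x; apply: (cvg_comp _ expR); last exact: continuous_expR.
    apply: cvgMr; apply: (cvg_comp _ expR); last exact: continuous_expR.
    apply: cvgMr; under eq_fun do rewrite cosB cos_pihalf mulr0 add0r sin_pihalf mulr1.
    exact: cvg_scaled_sin.
apply: (@H2_lim (fun k x => expR (- k.+1%:R * expR (- k.+1%:R * l x))) _ 1) => //.
- by move=> k x; rewrite ger0_norm ?expR_ge0.
- by move=> x; exact: cvg_double_exp.
Qed.

Let S : set (set T) := [set A | H2 (\1_A : T -> R)].

Let sigmaS : sigma_algebra setT S.
Proof.
split.
- by rewrite /S /= indic0; exact: H2cst.
- move=> A HA; rewrite /S /= (_ : \1__ = fun x => 1 + (-1) * \1_A x).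
    by apply: H2D; [exact: H2_1|exact: H2Z].
  apply/funext => x; rewrite !indicE setTD in_setC; case: (x \in A) => /=; lra.
- move=> F HF.
  (* Complements of partial unions are finite intersections, whose indicators are products and so
     remain in [H2]; at each point the sequence of these indicators is eventually constant. *)
  pose G n := \bigcup_(i < n) F i.
  have HG n : H2 (\1_(~` G n) : T -> R).
    elim: n => [|n IHn].
      rewrite /G bigcup_mkord big_ord0 setC0 (_ : \1__ = cst 1) ?indicT//; exact: H2_1.
    rewrite /G bigcup_mkord big_ord_recr/= -bigcup_mkord setCU indicI.
    apply: H2M => //.
    rewrite (_ : \1__ = fun x => 1 + (-1) * \1_(F n) x).
      by apply: H2D; [exact: H2_1|exact/H2Z/HF].
    by apply/funext => x; rewrite !indicE in_setC; case: (x \in F n) => /=; lra.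
  apply: (@H2_lim (fun n x => 1 + (-1) * \1_(~` G n) x) _ 1).
  - by move=> n; apply: H2D; [exact: H2_1|exact: H2Z].
  - by move=> n x; rewrite indicE; case: (_ \in _) => /=; rewrite ler_norml; lra.
  - move=> x; have [/= [n _ Fnx]|nx] := pselect ((\bigcup_n F n) x).
      apply: cvg_near_cst; exists n.+1 => // m /= nm.
      rewrite !indicE [in RHS]mem_set; last by exists n.
      rewrite memNset /=; first lra.
      by apply; exists n.
    apply: cvg_near_cst; apply: nearW => m.
    rewrite !indicE [in RHS]memNset// mem_set /=; first lra.
    by move=> [i _ Fi]; apply: nx; exists i.
Qed.

(** The sets with indicator in [H2] form a sigma-algebra containing every half-space [0 < l x]. For
    such a set, applying the multiplier to the constant 1 and pairing with [cos 0] compares the two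
    measures. *)
Lemma cos_transform_unique :
  @measurable d T `<=` <<s [set B | exists2 l, L l & B = [set x | 0 < l x]] >> ->
  forall A, measurable A -> mu A = nu A.
Proof.
move=> gen A mA.
have SA : S A.
  apply: (smallest_sub sigmaS _ (gen _ mA)) => _ [l Ll ->].
  rewrite /S /= (_ : \1__ = fun x => if 0 < l x then 1 else 0); first exact: H2_gt.
  apply/funext => x; rewrite indicE; case: ifPn => lx.
    by rewrite mem_set.
  by rewrite memNset//; exact/negP.
have := H1_int (SA.2 _ H1_1).
rewrite /same_int; under eq_Rintegral do rewrite mulr1.
under [RHS]eq_Rintegral do rewrite mulr1.
rewrite /Rintegral !integral_indic// !setIT => muE.
by rewrite -(fineK (fin_num_measure mu _ mA)) muE fineK// fin_num_measure.
Qed.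

End cos_transform_uniqueness.

(** * Normal laws *)

Import HBNNSimple.

Section density_integral.
Local Open Scope ereal_scope.
Context d (T : measurableType d) (R : realType).
Variables (mu nu : {measure set T -> \bar R}) (h : T -> R).
Hypothesis mh : measurable_fun setT h.
Hypothesis h0 : forall x, (0 <= h x)%R.
Hypothesis nuE : forall A, measurable A -> nu A = \int[mu]_(x in A) (h x)%:E.

Let density_sfun (f : {nnsfun T >-> R}) :
  \int[nu]_x (f x)%:E = \int[mu]_x ((f x)%:E * (h x)%:E).
Proof.
under [LHS]eq_integral do rewrite fimfunE -fsumEFin//.
rewrite [LHS]ge0_integral_fsum//; last 2 first.
  - by move=> r; exact/measurable_EFinP/measurableT_comp.
  - by move=> n x _; rewrite EFinM nnfun_muleindic_ge0.
under [RHS]eq_integral.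
  move=> x xD; rewrite fimfunE -fsumEFin// ge0_mule_fsuml; last first.
    by move=> r; rewrite EFinM nnfun_muleindic_ge0.
  over.
rewrite [RHS]ge0_integral_fsum//; last 2 first.
  - move=> r; rewrite -[X in measurable_fun _ X]/(EFin \o _).
    by apply/measurable_EFinP; apply: measurable_funM => //;
      apply: measurable_funM => //; exact: measurable_indic.
  - by move=> n x _; rewrite mule_ge0 ?lee_fin//; rewrite -lee_fin EFinM nnfun_muleindic_ge0.
apply: eq_fsbigr => r _; rewrite integralZl_indic_nnsfun//= integral_indic// setIT nuE//.
have [/[!inE] -[x _ <-]|rf] := boolP (r \in range f); last first.
  rewrite (_ : f @^-1` [set r] = set0); last first.
    apply/seteqP; split => // x /= fxr; move/negP : rf; apply.
    by rewrite inE; exists x.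
  rewrite integral_set0 mule0; apply/esym.
  by apply: integral0_eq => x _; rewrite indicE in_set0 mulr0 mul0e.
under [RHS]eq_integral do rewrite EFinM -muleA.
rewrite ge0_integralZl ?lee_fin//; last 2 first.
  - by apply: emeasurable_funM; apply/measurable_EFinP => //; exact: measurable_indic.
  - by move=> y _; rewrite mule_ge0// lee_fin.
rewrite integral_mkcond; congr *%E; apply: eq_integral => y _.
by rewrite epatch_indic muleC.
Qed.

Let density_ge0 (f : T -> \bar R) : measurable_fun setT f -> (forall x, 0 <= f x) ->
  \int[nu]_x f x = \int[mu]_x (f x * (h x)%:E).
Proof.
move=> mf f0.
pose f_ := nnsfun_approx measurableT mf.
transitivity (lim (\int[nu]_x (f_ n x)%:E @[n --> \oo])).
  rewrite -monotone_convergence//=.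
  - apply: eq_integral => ? /[!inE] xD; apply/esym/cvg_lim => //=.
    exact: cvg_nnsfun_approx.
  - by move=> n; exact/measurable_EFinP/measurable_funTS.
  - by move=> n ? _; rewrite lee_fin.
  - by move=> ? _ ? ? mn; rewrite lee_fin; exact/lefP/nd_nnsfun_approx.
under eq_fun do rewrite density_sfun.
rewrite -monotone_convergence//=.
- apply: eq_integral => x _; apply/cvg_lim => //=.
  by apply: cvgeZr => //; exact: cvg_nnsfun_approx.
- move=> n; apply: emeasurable_funM; last exact/measurable_EFinP.
  exact/measurable_EFinP/measurable_funTS.
- by move=> n ? _; rewrite mule_ge0 ?lee_fin.
- move=> x _ m n mn; rewrite lee_wpmul2r ?lee_fin//.
  exact/lefP/nd_nnsfun_approx.
Qed.

(** Monotone approximation by simple functions settles nonnegative [f]. As [h] is nonnegative,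
    taking positive and negative parts commutes with multiplication by [h], so the identity holds
    even where the integral is infinite. *)
Lemma integral_density (f : T -> \bar R) : measurable_fun setT f ->
  \int[nu]_x f x = \int[mu]_x (f x * (h x)%:E).
Proof.
move=> mf; rewrite integralE [RHS]integralE.
rewrite !density_ge0//; try exact: measurable_funepos; try exact: measurable_funeneg.
congr (_ - _); apply: eq_integral => x _.
- by rewrite !funeposE muleC [(f x * _)]muleC maxe_pMr ?lee_fin// mule0.
- by rewrite !funenegE muleC [(f x * _)]muleC -muleN maxe_pMr ?lee_fin// mule0.
Qed.

End density_integral.

Section pushforward_integral.
Context d d' (T : measurableType d) (T' : measurableType d') (R : realType).
Variables (mu : {measure set T -> \bar R}) (nu : {measure set T' -> \bar R}).
Variable X : T -> T'.
Hypothesis mX : measurable_fun setT X.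
Hypothesis nuE : forall A, measurable A -> nu A = mu (X @^-1` A).

Lemma integral_image_law (f : T' -> \bar R) : measurable_fun setT f ->
  (\int[nu]_y f y = \int[mu]_x f (X x))%E.
Proof.
move=> mf; rewrite integralE [RHS]integralE.
have E (g : T' -> \bar R) : measurable_fun setT g -> (forall y, 0 <= g y)%E ->
    (\int[nu]_y g y = \int[mu]_x g (X x))%E.
  move=> mg g0; have := ge0_integral_pushforward mX mu measurableT mg (fun y _ => g0 y).
  rewrite preimage_setT => <-; apply: eq_measure_integral => A mA _.
  by rewrite nuE.
rewrite (E _ (measurable_funepos mf) (funepos_ge0 f)).
rewrite (E _ (measurable_funeneg mf) (funeneg_ge0 f)).
by congr (_ - _)%E; apply: eq_integral => x _; rewrite ?funeposE ?funenegE.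
Qed.

End pushforward_integral.

Section normal_integrals.
Context {R : realType}.
Notation leb := (@lebesgue_measure R).

Lemma integral_derivativeT (F f : R -> R) :
  (forall x : R, is_derive (x : R) (1 : R) F (f x)) -> continuous f ->
  leb.-integrable setT (EFin \o f) ->
  F n.+1%:R @[n --> \oo] --> (0 : R) ->
  F (- n.+1%:R) @[n --> \oo] --> (0 : R) ->
  (\int[leb]_x (f x)%:E = 0)%E.
Proof.
move=> dF cf intf Fp Fn.
pose D n := `[- n.+1%:R, n.+1%:R]%classic : set R.
have mD n : measurable (D n) by exact: measurable_itv.
have mf : measurable_fun setT f by exact: continuous_measurable_fun.
have := @dominated_convergence _ _ _ leb setT measurableT
  (fun n => (EFin \o f) \_ (D n)) (EFin \o f) (fun x => `|(EFin \o f) x|%E).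
case.
- move=> n; apply/(measurable_restrictT _ (mD n)); apply: measurable_funTS.
  exact/measurable_EFinP.
- exact/measurable_EFinP.
- apply: aeW => x _; apply: cvg_near_cst.
  exists (Num.truncn `|x|) => // n /= xn.
  rewrite patchE mem_set// /D /= in_itv /= -ler_norml ltW//.
  by rewrite (lt_le_trans (truncnS_gt _))// ler_nat.
- exact: integrable_abse.
- by apply: aeW => x n _; rewrite patchE; case: ifP => // _; rewrite abse0.
move=> _ _ c.
have E n : (\int[leb]_x ((EFin \o f) \_ (D n)) x = (F n.+1%:R - F (- n.+1%:R))%:E)%E.
  rewrite -integral_mkcond (@continuous_FTC2 _ f F) ?EFinB//.
  - by rewrite (@lt_trans _ _ 0)// ?oppr_lt0 ltr0Sn.
  - exact: continuous_subspaceT.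
  - split => [x _||].
    + by have [] := dF x.
    + by apply: cvg_at_right_filter; apply: differentiable_continuous; apply/derivable1_diffP; have [] := dF (- n.+1%:R).
    + by apply: cvg_at_left_filter; apply: differentiable_continuous; apply/derivable1_diffP; have [] := dF n.+1%:R.
  - by move=> x _; rewrite derive1E derive_val.
apply: cvg_unique c _ => //.
rewrite /=; under eq_fun do rewrite E.
apply: cvg_EFin; first exact: nearW.
rewrite /comp /= -[X in _ --> X](subr0 0).
exact: (@cvgB _ R^o).
Qed.

End normal_integrals.

(** * Stein's identity, moments and cosine transform of the real normal law *)

Section stein.
Context {R : realType}.
Variables (m s : R).
Hypothesis s0 : s != 0.
Notation leb := (@lebesgue_measure R).
Notation p := (normal_pdf m s).

Let s2 : 0 < s ^+ 2. Proof. by rewrite exprn_even_gt0. Qed.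

Let pE x : p x = normal_peak s * expR (- (x - m) ^+ 2 / (s ^+ 2 *+ 2)).
Proof. by rewrite normal_pdfE. Qed.

Lemma is_derive_normal_pdf (x : R) :
  is_derive (x : R) (1 : R) p (- ((x - m) / s ^+ 2) * p x).
Proof.
rewrite normal_pdfE//; set q := fun y : R => - (y - m) ^+ 2 / (s ^+ 2 *+ 2).
have dq : is_derive (x : R) (1 : R) q (- ((x - m) / s ^+ 2)).
  rewrite /q; apply: is_derive_eq.
  rewrite /GRing.scale /= !(mulr0, add0r, addr0, subr0, mulr1, expr1).
  by rewrite -mulr_natr; field; rewrite s0.
have := is_deriveZ (normal_peak s) (is_derive1_comp (is_derive_expR (q x)) dq).
move=> /(@is_derive_eq _ _ _ _ _ _ _ _); apply.
rewrite -[LHS]/(normal_peak s * (expR (q x) * - ((x - m) / s ^+ 2))).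
rewrite -[normal_fun m s x]/(expR (q x)); ring.
Qed.

(** Constant for dominating a quadratic times the density by the density of deviation [s * sqrt 2].
    With [u = (x - m) ^ 2 / (4 * s ^ 2)] the two exponentials are [exp (- 2 * u)] and [exp (- u)],
    and [u * exp (- u) <= 1] absorbs the quadratic at the cost of [4 * s ^ 2 + 1] times the ratio of
    the peaks. *)
Let K := 4 * s ^+ 2 * normal_peak s / normal_peak (s * Num.sqrt 2) + normal_peak s / normal_peak (s * Num.sqrt 2).

Let s2' : s * Num.sqrt 2 != 0.
Proof. by rewrite mulf_neq0// gt_eqF// sqrtr_gt0. Qed.

Let p_bound x : (1 + (x - m) ^+ 2) * p x <= K * normal_pdf m (s * Num.sqrt 2) x.
Proof.
rewrite pE (normal_pdfE m s2') /normal_fun exprMn sqr_sqrtr// -!(mulr_natr (_ ^+ 2)) -(mulr_natr (_ * _)).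
set y2 := (x - m) ^+ 2; have y20 : 0 <= y2 by exact: sqr_ge0.
set P := normal_peak _; set P' := normal_peak _.
have P0 : 0 < P by exact: normal_peak_gt0.
have P'0 : 0 < P' by exact: normal_peak_gt0.
set u := y2 / (4 * s ^+ 2).
have u0 : 0 <= u by rewrite divr_ge0// mulr_ge0// ltW.
have -> : - y2 / (s ^+ 2 * 2) = - u + - u by rewrite /u; field; rewrite s0.
have -> : - y2 / (s ^+ 2 * 2 * 2) = - u by rewrite /u; field; rewrite s0.
rewrite expRD; set e := expR (- u).
have e0 : 0 < e by exact: expR_gt0.
have e1 : e <= 1 by rewrite -expR0 ler_expR oppr_le0.
have ue : u * e <= 1.
  rewrite /e expRN ler_pdivrMr ?expR_gt0// mul1r.
  by rewrite (le_trans _ (expR_ge1Dx _))// lerDr.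
have -> : K * (P' * e) = (4 * s ^+ 2 + 1) * (P * e) by rewrite /K -/P -/P'; field; rewrite gt_eqF.
have -> : y2 = u * (4 * s ^+ 2) by rewrite /u; field; rewrite s0.
have -> : (1 + u * (4 * s ^+ 2)) * (P * (e * e)) = (e + u * e * (4 * s ^+ 2)) * (P * e) by ring.
apply: ler_wpM2r; first by rewrite mulr_ge0 ?ltW.
by rewrite addrC lerD// ler_piMl// mulr_ge0// ltW.
Qed.

Lemma integrable_mul_normal_pdf (g : R -> R) (c : R) : measurable_fun setT g ->
  (forall x, `|g x| <= c * (1 + (x - m) ^+ 2)) ->
  leb.-integrable setT (fun x => (g x * p x)%:E).
Proof.
move=> mg gc.
have c0 : 0 <= c.
  by rewrite -(@pmulr_lge0 _ (1 + (0 - m) ^+ 2)) ?(le_trans _ (gc 0))// ltr_pwDl// sqr_ge0.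
apply: (@le_integrable _ _ _ leb setT measurableT _
  (fun x => (c * K)%:E * (normal_pdf m (s * Num.sqrt 2) x)%:E)%E) => //.
- by apply/measurable_EFinP; apply: measurable_funM => //; exact: measurable_normal_pdf.
- move=> x _; rewrite -EFinM !abse_EFin lee_fin !normrM.
  rewrite [`|p x|]ger0_norm ?normal_pdf_ge0// [`|normal_pdf _ _ _|]ger0_norm ?normal_pdf_ge0//.
  apply: (@le_trans _ _ (c * (K * normal_pdf m (s * Num.sqrt 2) x))).
    apply: (le_trans _ (ler_wpM2l c0 (p_bound x))).
    by rewrite mulrA ler_wpM2r// normal_pdf_ge0.
  by rewrite mulrA -normrM ler_wpM2r ?normal_pdf_ge0// ler_norm.
- by apply: integrableZl => //; exact: integrable_normal_pdf.
Qed.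

(** Integration by parts: [s ^ 2 * q * p] has derivative [s ^ 2 * q' * p - q * (x - m) * p] and
    vanishes at infinity when [q] grows at most linearly. Mean, variance and cosine transform come
    from choices of [q]. *)
Lemma stein_identity (q q' : R -> R) (c : R) :
  (forall x : R, is_derive (x : R) (1 : R) q (q' x)) -> continuous q' ->
  (forall x, `|q x| <= c * (1 + `|x - m|)) -> (forall x, `|q' x| <= c) ->
  (\int[leb]_x (q x * (x - m) * p x)%:E = (s ^+ 2)%:E * \int[leb]_x (q' x * p x)%:E)%E.
Proof.
move=> dq cq' qc q'c.
have c0 : 0 <= c by exact: le_trans (q'c 0).
have cq : continuous q.
  by move=> x; apply: differentiable_continuous; apply/derivable1_diffP; have [] := dq x.
have sq (x : R) : (1 + `|x - m|) ^+ 2 <= 2 * (1 + (x - m) ^+ 2).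
  have := sqr_ge0 (1 - `|x - m|); rewrite -(real_normK (num_real (x - m))).
  by set a := `|_|; nra.
have y1 (x : R) : `|x - m| <= 1 + `|x - m| by rewrite lerDr.
have cqm : continuous (fun x => q x * (x - m)).
  move=> x; apply: cvgM; [exact: cq|apply: cvgB; [exact: cvg_id|exact: cvg_cst]].
have int1 : leb.-integrable setT (fun x => (q x * (x - m) * p x)%:E).
  apply: (@integrable_mul_normal_pdf _ (c * 2)); first exact: continuous_measurable_fun.
  move=> x; rewrite normrM -mulrA (le_trans _ (ler_wpM2l c0 (sq x)))// expr2 mulrA.
  by rewrite ler_pM.
have int2 : leb.-integrable setT (fun x => (q' x * p x)%:E).
  apply: (@integrable_mul_normal_pdf _ c); first exact: continuous_measurable_fun.
  by move=> x; rewrite (le_trans (q'c x))// ler_peMr// lerDl sqr_ge0.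
suff : (\int[leb]_x (s ^+ 2 * (q' x * p x) - q x * (x - m) * p x)%:E = 0)%E.
  under eq_integral do rewrite EFinB.
  rewrite integralB//=; last by under eq_fun do rewrite EFinM; exact: integrableZl.
  under eq_integral do rewrite EFinM.
  rewrite integralZl// => /eqP; rewrite sube_eq ?add0e; first by move=> /eqP ->.
    by rewrite fin_numM//; exact: integrable_fin_num.
  by rewrite fin_num_adde_defl//; exact: integrable_fin_num.
have cp : continuous p by exact: continuous_normal_pdf.
have lim0 (b : R) : `|b| = 1 -> (s ^+ 2 * (q (b * n.+1%:R) * p (b * n.+1%:R))) @[n --> \oo] --> (0 : R).
  move=> b1; rewrite -(mulr0 (s ^+ 2)); apply: cvgMl_tmp.
  apply/norm_cvg0P.
  (* Each factor pays for one estimate: [c] for the growth of [q], [1 + |m|] for trading [|x|]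
     against [1 + |x - m|], 2 for the square of that sum, and [K] times a peak for the density.
     Hence [|q * p|] at distance [n.+1] is at most [C / n.+1]. *)
  pose C := c * ((1 + `|m|) * 2 * (K * normal_peak (s * Num.sqrt 2))).
  apply: (@squeeze_cvgr _ _ _ _ (cst 0) (fun n => C * n.+1%:R^-1)).
  - apply: nearW => n; rewrite normr_ge0/= ler_pdivlMr ?ltr0Sn//.
    set x := b * _.
    have nx : n.+1%:R <= (1 + `|x - m|) * (1 + `|m|).
      have -> : n.+1%:R = `|x| by rewrite normrM b1 mul1r ger0_norm.
      have : `|x| <= `|x - m| + `|m| by rewrite -{1}(subrK m x) ler_normD.
      have := mulr_ge0 (normr_ge0 (x - m)) (normr_ge0 m).
      have := normr_ge0 m; have := normr_ge0 (x - m).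
      by set a := `|x - m|; set d := `|m|; set e := `|x|; move=> *; nra.
    rewrite normrM [`|p x|]ger0_norm ?normal_pdf_ge0//.
    apply: (@le_trans _ _ (c * (1 + `|x - m|) * p x * ((1 + `|x - m|) * (1 + `|m|)))).
      apply: ler_pM => //; first by rewrite mulr_ge0// normal_pdf_ge0.
      by rewrite ler_wpM2r ?normal_pdf_ge0.
    rewrite (_ : _ * _ * _ * _ = c * ((1 + `|m|) * ((1 + `|x - m|) ^+ 2 * p x))); last by ring.
    rewrite /C ler_wpM2l// -mulrA ler_wpM2l ?addr_ge0//.
    apply: (le_trans (ler_wpM2r (normal_pdf_ge0 m s x) (sq x))).
    rewrite -mulrA ler_wpM2l// (le_trans (p_bound x))// ler_wpM2l ?normal_pdf_ub//.
    rewrite /K; have := ltW s2; set a := s ^+ 2 => a0.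
    have i0 : 0 <= (normal_peak (s * Num.sqrt 2))^-1 by rewrite invr_ge0 normal_peak_ge0.
    have j0 := normal_peak_ge0 s.
    by apply: addr_ge0; [apply: mulr_ge0 => //; apply: mulr_ge0 => //; exact: mulr_ge0|exact: mulr_ge0].
  - exact: cvg_cst.
  - by rewrite -(mulr0 C); apply: cvgMl_tmp; exact: cvg_harmonic.
pose F x := s ^+ 2 * (q x * p x).
pose F' x := s ^+ 2 * (q' x * p x) - q x * (x - m) * p x.
have dF (x : R) : is_derive (x : R) (1 : R) F (F' x).
  have := is_deriveZ (s ^+ 2) (is_deriveM (dq x) (is_derive_normal_pdf x)).
  move=> /(@is_derive_eq _ _ _ _ _ _ _ _); apply.
  by rewrite /F' /GRing.scale /=; field; rewrite s0.
have cF' : continuous F'.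
  have c1 : continuous (fun x => s ^+ 2 * (q' x * p x)).
    by move=> x; apply: cvgMl_tmp; exact: cvgM (cq' x) (cp x).
  have c2 : continuous (fun x => q x * (x - m) * p x).
    by move=> x; exact: cvgM (cqm x) (cp x).
  by move=> x; exact: (@cvgB _ R^o _ _ _ _ _ _ _ (c1 x) (c2 x)).
have iF' : leb.-integrable setT (EFin \o F').
  rewrite /comp /F'; under eq_fun do rewrite EFinB.
  by apply: integrableB => //; under eq_fun do rewrite EFinM; exact: integrableZl.
apply: (integral_derivativeT dF cF' iF').
- by have := lim0 1; rewrite normr1 => /(_ erefl); under eq_fun do rewrite mul1r.
- by have := lim0 (-1); rewrite normrN1 => /(_ erefl); under eq_fun do rewrite mulN1r.
Qed.

End stein.

Section normal_moments.
Local Open Scope ereal_scope.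
Context {R : realType}.
Variables (m s : R).
Hypothesis s0 : s != 0%R.
Notation leb := (@lebesgue_measure R).
Notation p := (normal_pdf m s).

Let mlin : measurable_fun setT (fun x : R => (x - m)%R).
Proof. exact: measurable_funB. Qed.

Lemma integral_normal_prob (f : R -> R) : measurable_fun setT f ->
  \int[normal_prob m s]_x (f x)%:E = \int[leb]_x (f x * p x)%:E.
Proof.
move=> mf; rewrite (@integral_density _ _ _ leb (normal_prob m s) p)//.
- exact: measurable_normal_pdf.
- exact: normal_pdf_ge0.
- exact/measurable_EFinP.
Qed.

Lemma integrable_normal_prob (f : R -> R) (c : R) : measurable_fun setT f ->
  (forall x, `|f x| <= c * (1 + (x - m) ^+ 2))%R ->
  (normal_prob m s).-integrable setT (EFin \o f).
Proof.
move=> mf fc; apply/integrableP; split; first exact/measurable_EFinP.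
under eq_integral do rewrite /=.
rewrite (integral_normal_prob (f := fun x => `|f x|%R)); last exact: measurableT_comp.
have /integrableP[_] := integrable_mul_normal_pdf s0 mf fc.
by under eq_integral do rewrite /= normrM [`|p _|%R]ger0_norm ?normal_pdf_ge0//.
Qed.

Lemma normal_mean : \int[normal_prob m s]_x (x - m)%:E = 0.
Proof.
rewrite integral_normal_prob//.
under eq_integral do rewrite -[(_ - m)%R]mul1r.
rewrite (@stein_identity _ m s s0 (fun=> 1%R) (fun=> 0%R) 1%R).
- by rewrite integral0_eq ?mule0// => x _; rewrite mul0r.
- exact: cst_continuous.
- by move=> x; rewrite normr1 mul1r lerDl.
- by move=> x; rewrite normr0.
Qed.

Lemma normal_variance : \int[normal_prob m s]_x ((x - m) ^+ 2)%:E = (s ^+ 2)%:E.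
Proof.
rewrite integral_normal_prob; last exact: measurable_funX.
under eq_integral do rewrite expr2.
have dq (x : R) : is_derive (x : R) (1%R : R) (fun x => x - m)%R 1%R.
  by apply: is_derive_eq; rewrite subr0.
rewrite (@stein_identity _ m s s0 (fun x => x - m)%R (fun=> 1%R) 1%R dq).
- under eq_integral do rewrite mul1r.
  by rewrite integral_normal_pdf mule1.
- exact: cst_continuous.
- by move=> x; rewrite mul1r lerDr.
- by move=> x; rewrite normr1.
Qed.

End normal_moments.

Section normal_cos.
Context {R : realType}.
Variable s : R.
Hypothesis s0 : s != 0.
Notation leb := (@lebesgue_measure R).
Notation p := (normal_pdf 0 s).

Variable a : R.
Let f (t x : R) := cos (t * x + a) * p x.
Let F t := \int[leb]_x f t x.

Let mcos t : measurable_fun setT (fun x : R => cos (t * x + a)).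
Proof.
apply: measurableT_comp; first by apply: continuous_measurable_fun; exact: continuous_cos.
by apply: measurable_funD => //; exact: measurable_funM.
Qed.

Let cos1 (x : R) : `|cos x| <= 1. Proof. by rewrite ler_norml cos_geN1 cos_le1. Qed.
Let sin1 (x : R) : `|sin x| <= 1. Proof. by rewrite ler_norml sin_geN1 sin_le1. Qed.

Let sqr1 (x : R) : 1 <= 1 * (1 + (x - 0) ^+ 2).
Proof. by rewrite mul1r lerDl sqr_ge0. Qed.

Let intf t : leb.-integrable setT (EFin \o f t).
Proof.
apply: (@integrable_mul_normal_pdf _ 0 s s0 _ 1) => // x.
exact: le_trans (sqr1 _).
Qed.

Let df (t x : R) : is_derive (t : R) (1 : R) (f ^~ x) (- x * sin (t * x + a) * p x).
Proof.
have dl : is_derive (t : R) (1 : R) (fun t => t * x + a) x.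
  by apply: is_derive_eq; rewrite /GRing.scale /= !(mulr1, mulr0, add0r, addr0).
have := is_deriveM (@is_derive1_comp _ cos (fun t => t * x + a) t _ _ (is_derive_cos _) dl) (is_derive_cst (p x) t 1).
move=> /(@is_derive_eq _ _ _ _ _ _ _ _); apply.
rewrite -[LHS]/(cos (t * x + a) * 0 + p x * (- sin (t * x + a) * x)); ring.
Qed.

(** Differentiating under the integral brings down [- x * sin (t * x + a)], and Stein's identity
    with [q = - sin (t * x + a)] trades the factor [x] for [s ^ 2] and a derivative of [q]. The
    outcome is a first-order linear equation for [F]. *)
Let dF (t : R) : is_derive (t : R) (1 : R) F (- s ^+ 2 * t * F t).
Proof.
have tI : `]t - 1, t + 1[%classic t by rewrite /= in_itv/= ltrBlDr ltrDl ltr01.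
pose G x := (1 + x ^+ 2) * p x.
have G0 x : 0 <= G x by rewrite mulr_ge0 ?normal_pdf_ge0// addr_ge0// sqr_ge0.
have intG : leb.-integrable setT (EFin \o G).
  apply: (@integrable_mul_normal_pdf _ 0 s s0 _ 1).
    by apply: measurable_funD => //; exact: measurable_funX.
  by move=> x; rewrite mul1r subr0 ger0_norm// addr_ge0// sqr_ge0.
have d1 t' x : partial1of2 f t' x = - x * sin (t' * x + a) * p x.
  by rewrite /partial1of2 derive1E; have [_ ->] := df t' x.
have xG (x : R) : `|x| <= 1 + x ^+ 2.
  have := sqr_ge0 (1 - `|x|); have := normr_ge0 x; rewrite -(real_normK (num_real x)).
  by set b := `|x|; nra.
have GE t' x : `]t - 1, t + 1[%classic t' -> setT x -> `|partial1of2 f t' x| <= G x.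
  move=> _ _; rewrite d1 !normrM normrN [`|p x|]ger0_norm ?normal_pdf_ge0//.
  rewrite ler_wpM2r ?normal_pdf_ge0// -[leRHS]mulr1 ler_pM//.
have der t' x : `]t - 1, t + 1[%classic t' -> setT x -> derivable (f ^~ x) t' 1.
  by move=> _ _; have [] := df t' x.
have Fd := derivable_under_integral measurableT tI (fun t' _ => intf t') der G0 intG GE.
apply: DeriveDef => //.
rewrite -derive1E (differentiation_under_integral measurableT tI (fun t' _ => intf t') der G0 intG GE).
under eq_Rintegral do rewrite d1.
have dq (x : R) : is_derive (x : R) (1 : R) (fun x => - sin (t * x + a)) (- (t * cos (t * x + a))).
  have dl : is_derive (x : R) (1 : R) (fun x => t * x + a) t.
    by apply: is_derive_eq; rewrite /GRing.scale /= !(mulr1, mulr0, add0r, addr0).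
  have := is_deriveN (@is_derive1_comp _ sin (fun x => t * x + a) x _ _ (is_derive_sin _) dl).
  by move=> /(@is_derive_eq _ _ _ _ _ _ _ _); apply; rewrite mulrC.
have := @stein_identity _ 0 s s0 _ _ (1 + `|t|) dq.
under eq_integral do rewrite subr0 mulNr [_ * _ in X in - X]mulrC -mulNr.
move=> E; rewrite /Rintegral E.
- under eq_integral do rewrite -mulNr -mulrA.
  under eq_integral do rewrite EFinM.
  rewrite integralZl//; last exact: intf.
  rewrite !fineM//; last 2 first.
  - by apply: integrable_fin_num => //; exact: intf.
  - by rewrite fin_numM//; apply: integrable_fin_num => //; exact: intf.
  by rewrite /= mulrA mulrN !mulNr.
- move=> x; apply: (@cvgN _ R^o); apply: cvgMl_tmp.
  apply: (cvg_comp _ cos); last exact: continuous_cos.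
  by apply: cvgD; [apply: cvgMl_tmp; exact: cvg_id|exact: cvg_cst].
- move=> x; rewrite normrN (le_trans (sin1 _))// -[leLHS]mulr1 ler_pM// lerDl//.
- move=> x; rewrite normrN normrM -[leRHS]mulr1 ler_pM// lerDr//.
Qed.

(** By the differential equation, [F t * exp (s ^ 2 / 2 * t ^ 2)] has zero derivative, and its value
    at 0 is [cos a]. *)
Lemma normal_cos_scale (t : R) :
  \int[normal_prob 0 s]_x cos (t * x + a) = cos a * expR (- (s ^+ 2 / 2 * t ^+ 2)).
Proof.
have F0 : F 0 = cos a.
  rewrite /F /Rintegral /f; under eq_integral do rewrite mul0r add0r EFinM.
  rewrite integralZl//; last exact: integrable_normal_pdf.
  by rewrite integral_normal_pdf mule1.
have -> : \int[normal_prob 0 s]_x cos (t * x + a) = F t.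
  by rewrite /Rintegral integral_normal_prob.
pose E t := F t * expR (s ^+ 2 / 2 * t ^+ 2).
have : E t = E 0.
  apply: is_derive_0_is_cst => {}t.
  have dq : is_derive (t : R) (1 : R) (fun t => s ^+ 2 / 2 * t ^+ 2) (s ^+ 2 * t).
    by apply: is_derive_eq; rewrite /GRing.scale /=; field.
  have := is_deriveM (dF t) (@is_derive1_comp _ expR (fun t => s ^+ 2 / 2 * t ^+ 2) t _ _ (is_derive_expR _) dq).
  move=> /(@is_derive_eq _ _ _ _ _ _ _ _); apply.
  rewrite /GRing.scale /=; ring.
rewrite /E expr0n mulr0 expR0 mulr1 F0 => <-.
by rewrite -[RHS]mulrA -expRD subrr expR0 mulr1.
Qed.

Lemma normal_cos : \int[normal_prob 0 s]_x cos (x + a) = cos a * expR (- (s ^+ 2 / 2)).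
Proof.
have := normal_cos_scale 1; rewrite expr1n mulr1 => <-.
by apply: eq_Rintegral => x _; rewrite mul1r.
Qed.

End normal_cos.

(** * Normal variables and independence *)

Section normal_variables.
Context d (Omega : measurableType d) (R : realType) (P : probability Omega R).
Variable X : Omega -> R.
Hypothesis mX : measurable_fun setT X.
Hypothesis nX : normal_variable P X.

Let law_cases : (exists m : R, forall f : R -> R, measurable_fun setT f ->
    (\int[P]_w (f (X w))%:E = (f m)%:E)%E) \/
  (exists m s : R, s != 0 /\ forall f : R -> R, measurable_fun setT f ->
    (\int[P]_w (f (X w))%:E = \int[normal_prob m s]_x (f x)%:E)%E).
Proof.
have [m [s law]] := nX; have [s0|s0] := eqVneq s 0.
  left; exists m => f mf; rewrite -(@integral_image_law _ _ _ _ _ P \d_m X mX _ (EFin \o f)).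
  - rewrite integral_dirac//; last exact/measurable_EFinP.
    by rewrite diracT mul1e.
  - by move=> A mA; have := law A mA; rewrite s0 eqxx; exact: esym.
  - exact/measurable_EFinP.
right; exists m, s; split=> // f mf.
rewrite -(@integral_image_law _ _ _ _ _ P (normal_prob m s) X mX _ (EFin \o f))//.
- by move=> A mA; have := law A mA; rewrite (negbTE s0); exact: esym.
- exact/measurable_EFinP.
Qed.

Lemma normal_variable_integrable : P.-integrable setT (EFin \o X).
Proof.
apply/integrableP; split; first exact/measurable_EFinP.
have mn : measurable_fun setT (fun x : R => `|x|) by exact: measurableT_comp.
under eq_integral do rewrite /=.
have [[m E]|[m [s [s0 E]]]] := law_cases; rewrite (E (fun x => `|x|))// ?ltry//.
have := @integrable_normal_prob _ m s s0 id (1 + `|m|) (@measurable_id _ _ _) _.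
move=> /(_ _)/integrableP[|_]//.
move=> x; have := ler_normD (x - m) m; rewrite subrK.
have := normr_ge0 m; have := normr_ge0 (x - m).
rewrite -(real_normK (num_real (x - m))).
set y := `|x - m|; set n := `|m|; set z := `|x| => y0 n0 zyn.
have := sqr_ge0 (y - 1); have := mulr_ge0 n0 (sqr_ge0 y); nra.
Qed.

Lemma normal_variable_sqr_integrable : P.-integrable setT (fun w => (X w ^+ 2)%:E).
Proof.
apply/integrableP; split; first by apply/measurable_EFinP; exact: measurable_funX.
have mn : measurable_fun setT (fun x : R => `|x ^+ 2|).
  by apply: measurableT_comp => //; exact: measurable_funX.
under eq_integral do rewrite /=.
have [[m E]|[m [s [s0 E]]]] := law_cases; rewrite (E (fun x => `|x ^+ 2|))// ?ltry//.
have ms : measurable_fun setT (fun x : R => x ^+ 2) by exact: measurable_funX.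
have H x : `|x ^+ 2| <= 2 * (1 + m ^+ 2) * (1 + (x - m) ^+ 2).
  rewrite ger0_norm ?sqr_ge0//.
  have := sqr_ge0 (x - m - m); have := sqr_ge0 m; have := sqr_ge0 (x - m).
  set y := x - m => *; have -> : x = y + m by rewrite /y subrK.
  have : 0 <= m ^+ 2 * y ^+ 2 by rewrite mulr_ge0// sqr_ge0.
  by move=> *; nra.
have := @integrable_normal_prob _ m s s0 (fun x => x ^+ 2) (2 * (1 + m ^+ 2)).
move=> /(_ ms H)/integrableP[_]//.
Qed.

(** The variance is written as a second moment so that one formula serves both clauses of
    [normal_variable]: a centred degenerate law sits at 0, and both sides are then [cos a]. *)
Lemma normal_variable_cos (a : R) : \int[P]_w X w = 0 ->
  \int[P]_w cos (X w + a) = cos a * expR (- (\int[P]_w (X w ^+ 2)) / 2).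
Proof.
have mc : measurable_fun setT (fun x : R => cos (x + a)).
  apply: measurableT_comp; first by apply: continuous_measurable_fun; exact: continuous_cos.
  exact: measurable_funD.
have ms : measurable_fun setT (fun x : R => x ^+ 2) by exact: measurable_funX.
rewrite /Rintegral.
have [[m E]|[m [s [s0 E]]]] := law_cases;
  rewrite (E id)// (E (fun x => cos (x + a)))// (E (fun x => x ^+ 2))//.
  by move=> /= ->; rewrite add0r expr0n oppr0 mul0r expR0 mulr1.
move=> m0; have {}m0 : m = 0.
  have := normal_mean m s0; under eq_integral do rewrite EFinB.
  have iid : (normal_prob m s).-integrable setT (EFin \o id).
    apply: (@integrable_normal_prob _ m s s0 id (1 + `|m|) (@measurable_id _ _ _)).
    move=> x; have := ler_normD (x - m) m; rewrite subrK.
    have := normr_ge0 m; have := normr_ge0 (x - m).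
    rewrite -(real_normK (num_real (x - m))).
    set y := `|x - m|; set n := `|m|; set z := `|x| => y0 n0 zyn.
have := sqr_ge0 (y - 1); have := mulr_ge0 n0 (sqr_ge0 y); nra.
  rewrite integralB//=; last exact: finite_measure_integrable_cst.
  rewrite (_ : \int[_]__ m%:E = m%:E)%E; last first.
    rewrite integral_cst//; rewrite [X in (_ * X)%E](_ : _ = 1%E) ?mule1//.
    exact: probability_setT.
  have fi : (\int[normal_prob m s]_x x%:E)%E \is a fin_num by exact: integrable_fin_num iid.
  rewrite -(fineK fi) m0 -EFinB => -[]; lra.
move: E; rewrite m0 => _.
have := normal_variance 0 s0; under eq_integral do rewrite subr0; move=> ->.
by rewrite -[LHS]/(\int[normal_prob 0 s]_x cos (x + a)) normal_cos// mulNr.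
Qed.

End normal_variables.

Section independence.
Context d (Omega : measurableType d) (R : realType) (P : probability Omega R).
Context d1 (T1 : measurableType d1) d2 (T2 : measurableType d2).
Variables (X : Omega -> T1) (Y : Omega -> T2).
Hypothesis mX : measurable_fun setT X.
Hypothesis mY : measurable_fun setT Y.
Hypothesis iXY : independent_pair P measurable measurable X Y.

Let Xpack : {mfun Omega >-> T1} := HB.pack X (isMeasurableFun.Build _ _ _ _ _ mX).
Let Ypack : {mfun Omega >-> T2} := HB.pack Y (isMeasurableFun.Build _ _ _ _ _ mY).

(** Independence makes the joint law the product of the marginal laws, by uniqueness on rectangles;
    Tonelli's theorem is applied to that product. *)
Lemma independent_integral (f : T1 * T2 -> \bar R) :
  measurable_fun setT f -> (forall x, 0 <= f x)%E ->
  (\int[P]_w f (X w, Y w) = \int[P]_w \int[P]_w' f (X w, Y w'))%E.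
Proof.
move=> mf f0.
pose lX := distribution P Xpack; pose lY := distribution P Ypack.
have mXY : measurable_fun setT (fun w => (X w, Y w)) by exact: measurable_fun_pair.
rewrite -(@integral_image_law _ _ _ _ _ P (lX \x lY)%E _ mXY _ f mf); last first.
  move=> A mA; pose XY : {mfun Omega >-> (T1 * T2)%type} :=
    HB.pack (fun w => (X w, Y w)) (isMeasurableFun.Build _ _ _ _ _ mXY).
  apply: (@product_measure_unique _ _ _ _ _ lX lY (distribution P XY)) => //.
rewrite fubini_tonelli1// /fubini_F.
rewrite (@integral_image_law _ _ _ _ _ P lX X mX); last 2 first.
- by [].
- exact: measurable_fun_fubini_tonelli_F.
apply: eq_integral => w _.
rewrite (@integral_image_law _ _ _ _ _ P lY Y mY)//.
exact: measurableT_comp mf (measurable_fun_pair _ _).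
Qed.

End independence.

Section independent_reals.
Context d (Omega : measurableType d) (R : realType) (P : probability Omega R).
Variables (X Y : Omega -> R).
Hypothesis mX : measurable_fun setT X.
Hypothesis mY : measurable_fun setT Y.
Hypothesis iXY : independent_pair P measurable measurable X Y.

Lemma independent_ge0_integralM : (forall w, 0 <= X w) -> (forall w, 0 <= Y w) ->
  (\int[P]_w (X w * Y w)%:E = (\int[P]_w (X w)%:E) * (\int[P]_w (Y w)%:E))%E.
Proof.
move=> X0 Y0.
have := @independent_integral _ _ _ P _ _ _ _ X Y mX mY iXY
  (fun z => (`|z.1| * `|z.2|)%:E) _ _.
rewrite (_ : (fun w => (`|(X w, Y w).1| * `|(X w, Y w).2|)%:E) = fun w => (X w * Y w)%:E); last first.
  by apply/funext => w /=; rewrite !ger0_norm.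
move=> -> //; last first.
- by apply/measurable_EFinP; apply: measurable_funM; apply: measurableT_comp.
transitivity (\int[P]_w ((X w)%:E * \int[P]_w' (Y w')%:E))%E.
  apply: eq_integral => w _ /=; rewrite -ge0_integralZl//; last 3 first.
  - exact/measurable_EFinP.
  - by move=> w' _; rewrite lee_fin.
  - by rewrite lee_fin.
  by apply: eq_integral => w' _; rewrite -EFinM !ger0_norm.
rewrite ge0_integralZr//.
- exact/measurable_EFinP.
- by move=> w _; rewrite lee_fin.
- by apply: integral_ge0 => w _; rewrite lee_fin.
Qed.

(* Only [1 + cos] is integrated, so that Tonelli's theorem suffices. *)
Lemma independent_cosD (A B : R) :
  (forall a, \int[P]_w cos (X w + a) = cos a * A) ->
  (forall a, \int[P]_w cos (Y w + a) = cos a * B) ->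
  forall a, \int[P]_w cos (X w + Y w + a) = cos a * (A * B).
Proof.
move=> EX EY a.
have mcosD (f : Omega -> R) b : measurable_fun setT f ->
    bounded_mfun (fun w => cos (f w + b)).
  by move=> mf; apply: bounded_mfun_cos; exact: measurable_funD.
have shift (f : Omega -> R) c : bounded_mfun f ->
    (\int[P]_w (1 + f w * c)%:E = (1 + \int[P]_w f w * c)%:E)%E.
  move=> bf; have ifc : P.-integrable setT (fun w => (f w * c)%:E).
    by apply: bounded_mfun_integrable; exact: bounded_mfunM (bounded_mfun_cst _ c).
  under eq_integral do rewrite EFinD.
  rewrite integralD//; last exact: finite_measure_integrable_cst.
  rewrite (_ : \int[P]__ 1 = 1)%E; last by rewrite integral_cst// mul1e; exact: probability_setT.
  rewrite EFinD; congr (_ + _)%E; rewrite EFinM /Rintegral fineK; last by apply: integrable_fin_num => //; exact: bounded_mfun_integrable.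
  by under eq_integral do rewrite EFinM; rewrite integralZr//; exact: bounded_mfun_integrable.
have := @independent_integral _ _ _ P _ _ _ _ X Y mX mY iXY
  (fun z => (1 + cos (z.1 + z.2 + a))%:E) _ _.
rewrite /= => E.
have mc : measurable_fun setT (fun z : R * R => cos (z.1 + z.2 + a)).
  apply: measurableT_comp; first by apply: continuous_measurable_fun; exact: continuous_cos.
  by apply: measurable_funD => //; exact: measurable_funD.
have {}E : (\int[P]_w (1 + cos (X w + Y w + a))%:E =
    \int[P]_w \int[P]_w' (1 + cos (X w + Y w' + a))%:E)%E.
  apply: E; first by apply/measurable_EFinP; exact: measurable_funD.
  by move=> z; rewrite lee_fin -lerBlDl sub0r cos_geN1.
have bXY := mcosD _ a (measurable_funD mX mY).
have := shift _ 1 bXY; under eq_integral do rewrite mulr1.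
rewrite E mulr1.
have -> : (\int[P]_w \int[P]_w' (1 + cos (X w + Y w' + a))%:E =
    \int[P]_w (1 + cos (X w + a) * B)%:E)%E.
  apply: eq_integral => w _.
  have := shift _ 1 (mcosD Y (X w + a) mY); under eq_integral do rewrite mulr1.
  rewrite mulr1 EY => <-.
  by apply: eq_integral => w' _; rewrite (addrC (X w)) -addrA.
rewrite (shift _ B (mcosD X a mX)) EX => -[] /addrI <-.
by rewrite mulrA.
Qed.

End independent_reals.

Section normal_covariance.
Context d (Omega : measurableType d) (R : realType) (P : probability Omega R).
Variables (X Y : Omega -> R).
Hypothesis mX : measurable_fun setT X.
Hypothesis mY : measurable_fun setT Y.
Hypothesis nX : normal_variable P X.
Hypothesis nY : normal_variable P Y.

Lemma normal_variable_mul_integrable : P.-integrable setT (fun w => (X w * Y w)%:E).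
Proof.
apply: (@le_integrable _ _ _ P setT measurableT _
  (fun w => (X w ^+ 2)%:E + (Y w ^+ 2)%:E)%E) => //.
- by apply/measurable_EFinP; exact: measurable_funM.
- move=> w _; rewrite -EFinD !abse_EFin lee_fin normrM [leRHS]ger0_norm ?addr_ge0 ?sqr_ge0//.
  rewrite -(real_normK (num_real (X w))) -(real_normK (num_real (Y w))).
  have := sqr_ge0 (`|X w| - `|Y w|); have := normr_ge0 (X w); have := normr_ge0 (Y w).
  by set x := `|X w|; set y := `|Y w| => *; nra.
- by apply: integrableD => //; exact: normal_variable_sqr_integrable.
Qed.

Hypothesis nXY : normal_variable P (fun w => X w + Y w).
Hypothesis X0 : \int[P]_w X w = 0.
Hypothesis Y0 : \int[P]_w Y w = 0.
Hypothesis iXY : independent_pair P measurable measurable X Y.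

(* Compare [E cos (X + Y)] computed from independence and from normality. *)
Lemma independent_normal_uncorrelated : \int[P]_w (X w * Y w) = 0.
Proof.
have iX := normal_variable_integrable mX nX; have iY := normal_variable_integrable mY nY.
have iX2 := normal_variable_sqr_integrable mX nX; have iY2 := normal_variable_sqr_integrable mY nY.
have mXY : measurable_fun setT (fun w => X w + Y w) by exact: measurable_funD.
have XY0 : \int[P]_w (X w + Y w) = 0 by rewrite RintegralD// X0 Y0 addr0.
have := independent_cosD mX mY iXY
  (fun a => normal_variable_cos mX nX a X0) (fun a => normal_variable_cos mY nY a Y0) 0.
rewrite (normal_variable_cos mXY nXY 0 XY0) cos0 !mul1r -expRD => /expR_inj.
have -> : \int[P]_w ((X w + Y w) ^+ 2) =
    \int[P]_w (X w ^+ 2) + 2 * \int[P]_w (X w * Y w) + \int[P]_w (Y w ^+ 2).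
  have iM := normal_variable_mul_integrable.
  have iM2 : P.-integrable setT (fun w => (2 * (X w * Y w))%:E).
    by under eq_fun do rewrite EFinM; exact: integrableZl.
  have iD : P.-integrable setT (fun w => (X w ^+ 2 + 2 * (X w * Y w))%:E).
    by under eq_fun do rewrite EFinD; exact: integrableD.
  rewrite -RintegralZl// -RintegralD// -RintegralD//.
  by apply: eq_Rintegral => w _; ring.
lra.
Qed.

End normal_covariance.

Section mutual_independence.
Context d (Omega : measurableType d) (R : realType) (P : probability Omega R).
Context (J : eqType) d1 (T : measurableType d1) (X : J -> Omega -> T).
Hypothesis mX : forall j, measurable_fun setT (X j).
Hypothesis iX : mutually_independent P measurable X.

(** A family stable under intersection that generates the sigma-algebra of the variables indexed by
    [s]; mutual independence speaks of exactly these events. *)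
Definition box_sets (s : seq J) : set (set Omega) :=
  [set \bigcap_(j in [set` s]) (X j @^-1` B j) | B in [set B | forall j, measurable (B j)]].

Let preim_measurable j B : measurable B -> measurable (X j @^-1` B).
Proof. by move=> mB; rewrite -[X in measurable X]setTI; exact: mX. Qed.

Let box_measurable s : box_sets s `<=` measurable.
Proof.
move=> _ [B mB <-]; apply: fin_bigcap_measurable => // j _; exact: preim_measurable.
Qed.

Let box_setI s : setI_closed (box_sets s).
Proof.
move=> _ _ [B mB <-] [C mC <-]; exists (fun j => B j `&` C j).
  by move=> j; exact: measurableI.
apply/seteqP; split=> w /= => [h|[h1 h2] k ks].
  by split=> k ks; have [] := h k ks.
by split; [exact: h1|exact: h2].
Qed.

(** For fixed [B] both sides are finite measures of [A]: a restriction of [P] and a multiple of [P].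
    They agree on boxes by mutual independence over [j :: s], hence on the generated
    sigma-algebra. *)
Lemma independent_box_sets (j : J) (s : seq J) (B : set T) (A : set Omega) :
  uniq s -> j \notin s -> measurable B -> <<s box_sets s >> A ->
  P (X j @^-1` B `&` A) = (P (X j @^-1` B) * P A)%E.
Proof.
move=> us js mB sA.
have mXB := preim_measurable j mB.
pose c : {nonneg R} := NngNum (fine_ge0 (measure_ge0 P (X j @^-1` B))).
have cE : (c%:num%:E = P (X j @^-1` B))%E by rewrite /= fineK// fin_num_measure.
suff E : mrestr P mXB A = mscale c P A by move: E; rewrite /mrestr /mscale setIC cE.
apply: (@g_sigma_algebra_measure_unique _ R _ (box_sets s) (@box_measurable s)
  (fun=> setT) _ _ (mrestr P mXB) (mscale c P) (@box_setI s) _ _ A sA).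
- by move=> i; exists (fun=> setT) => //; apply/seteqP; split.
- by rewrite bigcup_const.
- move=> _ [C mC <-]; set G := bigcap _ _.
  rewrite -[LHS]/(P (G `&` X j @^-1` B)) -[RHS]/(c%:num%:E * P G)%E setIC cE {}/G.
  pose D k := if k == j then B else C k.
  have mD k : measurable (D k) by rewrite /D; case: ifP.
  have ujs : uniq (j :: s) by rewrite /= js us.
  have := iX ujs mD.
  have Dj : D j = B by rewrite /D eqxx.
  rewrite big_cons Dj (eq_big_seq (fun k => P (X k @^-1` C k))); last first.
    by move=> k ks; rewrite /D; case: eqP => // kj; rewrite -kj ks in js.
  rewrite -(iX us mC) => <-; congr (P _).
  apply/seteqP; split=> w /=.
    move=> [h1 h2] k /=; rewrite in_cons => /predU1P[->|ks]; rewrite ?Dj// /D.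
    by case: eqP => [->//|_]; exact: h2.
  move=> h; split; first by have := h j; rewrite Dj; apply; rewrite /= in_cons eqxx.
  move=> k ks; have := h k; rewrite /D; case: eqP => [kj|_].
    by rewrite -kj ks in js.
  by apply; rewrite /= in_cons; apply/orP; right.
- move=> _; rewrite -/(mrestr _ _ _).
  by rewrite (le_lt_trans (probability_le1 _ _)) ?ltry//; apply: measurableI.
Qed.

Lemma box_sets_measurable_fun (s : seq J) (j : J) : j \in s ->
  measurable_fun (setT : set (g_sigma_algebraType (box_sets s))) (X j).
Proof.
move=> js _ B mB; rewrite setTI; apply: sub_sigma_algebra.
exists (fun k => if k == j then B else setT); first by move=> k; case: ifP.
apply/seteqP; split=> w /=.
  by move=> /(_ j); rewrite eqxx; exact.
by move=> XB k _; case: eqP => [->|].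
Qed.

Lemma independent_tail (j : J) (s : seq J) (f : T -> R) (g : Omega -> R) :
  uniq s -> j \notin s -> measurable_fun setT f ->
  measurable_fun (setT : set (g_sigma_algebraType (box_sets s))) g ->
  independent_pair P measurable measurable (f \o X j) g.
Proof.
move=> us js mf mg B C mB mC.
rewrite comp_preimage (independent_box_sets us js)//.
- by rewrite -[X in measurable X]setTI; exact: mf.
- by have := mg measurableT C mC; rewrite setTI.
Qed.

Lemma mutually_independent_integral_prod (s : seq J) (h : J -> T -> R) :
  uniq s -> (forall j, measurable_fun setT (h j)) -> (forall j x, 0 <= h j x) ->
  (\int[P]_w (\prod_(j <- s) h j (X j w))%:E =
   \prod_(j <- s) \int[P]_w (h j (X j w))%:E)%E.
Proof.
move=> + mh h0; elim: s => [_|j s IHs /=/andP[js us]].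
  by under eq_integral do rewrite big_nil; rewrite big_nil integral_cst// mul1e; exact: probability_setT.
rewrite big_cons -IHs//; under eq_integral do rewrite big_cons.
have mp : measurable_fun (setT : set (g_sigma_algebraType (box_sets s)))
    (fun w => \prod_(k <- s) h k (X k w)).
  apply: measurable_prod => k ks.
  by apply: measurableT_comp => //; exact: box_sets_measurable_fun.
apply: (@independent_ge0_integralM _ _ _ P (h j \o X j) (fun w => \prod_(k <- s) h k (X k w))).
- exact: measurableT_comp.
- by apply: measurable_prod => k _; exact: measurableT_comp.
- exact: (independent_tail us js).
- by move=> w; exact: h0.
- by move=> w; exact: prodr_ge0.
Qed.

Lemma mutually_independent_cos_sum (s : seq J) (h : J -> T -> R) (v : J -> R) :
  uniq s -> (forall j, measurable_fun setT (h j)) ->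
  (forall j a, \int[P]_w cos (h j (X j w) + a) = cos a * expR (v j)) ->
  forall a, \int[P]_w cos ((\sum_(j <- s) h j (X j w)) + a) = cos a * expR (\sum_(j <- s) v j).
Proof.
move=> + mh hv; elim: s => [_ a|j s IHs /=/andP[js us]].
  under eq_Rintegral do rewrite big_nil add0r.
  rewrite big_nil expR0 mulr1 Rintegral_cst// [X in _ * X](_ : _ = 1) ?mulr1//.
  by rewrite -[RHS]/(fine 1%E); congr fine; exact: probability_setT.
move=> a; rewrite big_cons expRD; under eq_Rintegral do rewrite big_cons.
have mp : measurable_fun (setT : set (g_sigma_algebraType (box_sets s)))
    (fun w => \sum_(k <- s) h k (X k w)).
  (* The guard makes every summand measurable for the sigma-algebra of [s], whatever the index, so
     that measurability can be checked term by term. *)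
  rewrite (_ : (fun w => _) = fun w => \sum_(k <- s) (if k \in s then h k (X k w) else 0)).
    apply: measurable_sum => k; case: (boolP (k \in s)) => ks; last exact: measurable_cst.
    by apply: measurableT_comp => //; exact: box_sets_measurable_fun.
  by apply/funext => w; apply: eq_big_seq => k ->.
apply: (@independent_cosD _ _ _ P (h j \o X j) (fun w => \sum_(k <- s) h k (X k w))) => //.
- exact: measurableT_comp.
- by apply: measurable_sum => k; exact: measurableT_comp.
- exact: (independent_tail us js).
- exact: hv.
- exact: IHs.
Qed.

End mutual_independence.

(** * Proper complex normal families *)

Section complex_parts.
Context {R : rcfType}.
Implicit Types u v : R[i].

Lemma Re_mulc u v : complex.Re (u * v) =
  complex.Re u * complex.Re v - complex.Im u * complex.Im v.
Proof. by case: u v => [a b] []. Qed.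

Lemma Im_mulc u v : complex.Im (u * v) =
  complex.Re u * complex.Im v + complex.Im u * complex.Re v.
Proof. by case: u v => [a b] []. Qed.

Lemma Re_conjc u : complex.Re (conjc u) = complex.Re u. Proof. by case: u. Qed.

Lemma Im_conjc u : complex.Im (conjc u) = - complex.Im u. Proof. by case: u. Qed.

Lemma Re_addc u v : complex.Re (u + v) = complex.Re u + complex.Re v.
Proof. by case: u v => [a b] []. Qed.

Lemma Re_sumc (I : Type) (s : seq I) (A : pred I) (F : I -> R[i]) :
  complex.Re (\sum_(i <- s | A i) F i) = \sum_(i <- s | A i) complex.Re (F i).
Proof. exact: (big_morph _ Re_addc). Qed.

Lemma normc_sqr u : Normc.normc u ^+ 2 = complex.Re u ^+ 2 + complex.Im u ^+ 2.
Proof. by case: u => a b /=; rewrite sqr_sqrtr// addr_ge0// sqr_ge0. Qed.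

Lemma complex_ext u v : complex.Re u = complex.Re v -> complex.Im u = complex.Im v -> u = v.
Proof. by case: u v => [a b] [c e] /= -> ->. Qed.

End complex_parts.

Section integral_sums.
Context d (T : measurableType d) (R : realType) (mu : {measure set T -> \bar R}).
Variables (D : set T) (mD : measurable D).

Lemma integrable_EFin_sum (I : Type) (s : seq I) (F : I -> T -> R) :
  (forall i, mu.-integrable D (EFin \o F i)) ->
  mu.-integrable D (fun x => (\sum_(i <- s) F i x)%:E).
Proof.
move=> iF; under eq_fun do rewrite -sumEFin.
by apply: integrable_sum => // i _; exact: iF.
Qed.

Lemma Rintegral_sum (I : Type) (s : seq I) (F : I -> T -> R) :
  (forall i, mu.-integrable D (EFin \o F i)) ->
  \int[mu]_(x in D) (\sum_(i <- s) F i x) = \sum_(i <- s) \int[mu]_(x in D) F i x.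
Proof.
move=> iF; elim: s => [|i s IHs].
  by rewrite big_nil; under eq_Rintegral do rewrite big_nil; rewrite /Rintegral integral0.
rewrite big_cons -IHs -RintegralD//; last exact: integrable_EFin_sum.
by under eq_Rintegral do rewrite big_cons.
Qed.

Definition integrablec (Z : T -> R[i]) :=
  mu.-integrable D (fun w => (complex.Re (Z w))%:E) /\
  mu.-integrable D (fun w => (complex.Im (Z w))%:E).

Lemma integrablecZ (a : R[i]) Z : integrablec Z ->
  mu.-integrable D (fun w => (complex.Re (a * Z w))%:E).
Proof.
move=> [iR iI]; under eq_fun do rewrite Re_mulc EFinB !EFinM.
by apply: integrableB => //; exact: integrableZl.
Qed.

Lemma Re_integralc (a : R[i]) Z : integrablec Z ->
  \int[mu]_(w in D) complex.Re (a * Z w) = complex.Re (a * integralC mu D Z).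
Proof.
move=> [iR iI]; rewrite Re_mulc /=.
under eq_Rintegral do rewrite Re_mulc.
have iR' : mu.-integrable D (fun w => (complex.Re a * complex.Re (Z w))%:E).
  by under eq_fun do rewrite EFinM; exact: integrableZl.
have iI' : mu.-integrable D (fun w => (complex.Im a * complex.Im (Z w))%:E).
  by under eq_fun do rewrite EFinM; exact: integrableZl.
by rewrite RintegralB// !RintegralZl.
Qed.

End integral_sums.

Section proper_normal_families.
Context d (Omega : measurableType d) (R : realType) (P : probability Omega R).
Context (I : Type) (X : I -> Omega -> R[i]).
Hypothesis mX : forall i, measurable_fun setT (X i).
Hypothesis nX : jointly_proper_normal P X.
Hypothesis X0 : forall i, meanC P (X i) = 0.

Let mRe i : measurable_fun setT (fun w => complex.Re (X i w)).
Proof. exact: measurableT_comp measurable_funRe (mX i). Qed.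

Let mIm i : measurable_fun setT (fun w => complex.Im (X i w)).
Proof. exact: measurableT_comp measurable_funIm (mX i). Qed.

Lemma proper_form_normal (s : seq I) (c : I -> R[i]) :
  normal_variable P (fun w => complex.Re (\sum_(i <- s) c i * X i w)).
Proof.
rewrite (_ : (fun w => _) = fun w => \sum_(j < size s)
  (complex.Re (c (tnth (in_tuple s) j)) * complex.Re (X (tnth (in_tuple s) j) w) +
   - complex.Im (c (tnth (in_tuple s) j)) * complex.Im (X (tnth (in_tuple s) j) w))).
  exact: nX.1.
apply/funext => w; rewrite Re_sumc (big_tnth _ _ s).
by apply: eq_bigr => j _; rewrite Re_mulc mulNr.
Qed.

Let nRe i : normal_variable P (fun w => complex.Re (X i w)).
Proof.
have := proper_form_normal [:: i] (fun=> 1).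
by under eq_fun do rewrite big_seq1 mul1r.
Qed.

Let nIm i : normal_variable P (fun w => complex.Im (X i w)).
Proof.
have := proper_form_normal [:: i] (fun=> Complex 0 (-1)).
by under eq_fun do rewrite big_seq1 Re_mulc /= mul0r sub0r mulN1r opprK.
Qed.

Lemma proper_integrable i : integrablec P setT (X i).
Proof. by split; exact: normal_variable_integrable. Qed.

Lemma proper_mul_integrable i j : integrablec P setT (fun w => X i w * X j w).
Proof.
split.
  under eq_fun do rewrite Re_mulc EFinB.
  by apply: integrableB => //; exact: normal_variable_mul_integrable.
under eq_fun do rewrite Im_mulc EFinD.
by apply: integrableD => //; exact: normal_variable_mul_integrable.
Qed.

Lemma proper_mul_conj_integrable i j : integrablec P setT (fun w => X i w * conjc (X j w)).
Proof.
split.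
  under eq_fun do rewrite Re_mulc Re_conjc Im_conjc mulrN opprK EFinD.
  by apply: integrableD => //; exact: normal_variable_mul_integrable.
under eq_fun do rewrite Im_mulc Re_conjc Im_conjc mulrN addrC EFinB.
by apply: integrableB => //; exact: normal_variable_mul_integrable.
Qed.

Lemma proper_form_mean (s : seq I) (c : I -> R[i]) :
  \int[P]_w complex.Re (\sum_(i <- s) c i * X i w) = 0.
Proof.
under eq_Rintegral do rewrite Re_sumc.
rewrite (Rintegral_sum measurableT) => [|i]; last by apply: integrablecZ => //; exact: proper_integrable.
by rewrite big1// => i _; rewrite (Re_integralc measurableT) -/(meanC _ _) ?X0 ?mulr0//; exact: proper_integrable.
Qed.

Let pseudo0 i j : meanC P (fun w => X i w * X j w) = 0.
Proof. by rewrite -(nX.2 i j) !X0; congr meanC; apply/funext => w; rewrite !subr0. Qed.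

(** From [Re u * Re v = (Re (u * v) + Re (u * conjc v)) / 2]: the first half integrates to a
    pseudo-covariance, which vanishes. Only the hermitian covariance remains, so the law of the form
    depends on nothing else. *)
Lemma proper_form_variance (s : seq I) (c : I -> R[i]) :
  \int[P]_w (complex.Re (\sum_(i <- s) c i * X i w) ^+ 2) =
  2^-1 * \sum_(i <- s) \sum_(j <- s)
    complex.Re (c i * conjc (c j) * meanC P (fun w => X i w * conjc (X j w))).
Proof.
have E w : complex.Re (\sum_(i <- s) c i * X i w) ^+ 2 = \sum_(i <- s) \sum_(j <- s)
    2^-1 * (complex.Re (c i * c j * (X i w * X j w)) +
            complex.Re (c i * conjc (c j) * (X i w * conjc (X j w)))).
  rewrite Re_sumc expr2 mulr_suml; apply: eq_bigr => i _.
  rewrite mulr_sumr; apply: eq_bigr => j _.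
  by case: (c i) (c j) (X i w) (X j w) => [a b] [a' b'] [x y] [x' y'] /=; field.
have i1 i j := integrablecZ measurableT (c i * c j) (proper_mul_integrable i j).
have i2 i j := integrablecZ measurableT (c i * conjc (c j)) (proper_mul_conj_integrable i j).
have i3 i j : P.-integrable setT (fun w => (complex.Re (c i * c j * (X i w * X j w)) +
            complex.Re (c i * conjc (c j) * (X i w * conjc (X j w))))%:E).
  by under eq_fun do rewrite EFinD; exact: integrableD.
have i4 i j : P.-integrable setT (fun w => (2^-1 * (complex.Re (c i * c j * (X i w * X j w)) +
            complex.Re (c i * conjc (c j) * (X i w * conjc (X j w)))))%:E).
  by under eq_fun do rewrite EFinM; exact: integrableZl.
under eq_Rintegral do rewrite E.
rewrite (Rintegral_sum measurableT) => [|i]; last by apply: (integrable_EFin_sum measurableT) => j; exact: i4.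
rewrite mulr_sumr; apply: eq_bigr => i _.
rewrite (Rintegral_sum measurableT) => [|j]; last exact: i4.
rewrite mulr_sumr; apply: eq_bigr => j _.
rewrite (RintegralZl _ measurableT (i3 i j)) (RintegralD measurableT (i1 i j) (i2 i j)).
rewrite Re_integralc//; last exact: proper_mul_integrable.
rewrite -/(meanC _ _) pseudo0 mulr0 add0r Re_integralc//; exact: proper_mul_conj_integrable.
Qed.

Lemma proper_form_measurable (s : seq I) (c : I -> R[i]) :
  measurable_fun setT (fun w => complex.Re (\sum_(i <- s) c i * X i w)).
Proof.
under eq_fun do rewrite Re_sumc.
apply: measurable_sum => i; apply: measurableT_comp measurable_funRe _.
by apply: measurable_funMc; [exact: measurable_cst|exact: mX].
Qed.

Lemma proper_form_cos (s : seq I) (c : I -> R[i]) (a : R) :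
  \int[P]_w cos (complex.Re (\sum_(i <- s) c i * X i w) + a) =
  cos a * expR (- (\sum_(i <- s) \sum_(j <- s)
    complex.Re (c i * conjc (c j) * meanC P (fun w => X i w * conjc (X j w)))) / 4).
Proof.
rewrite (normal_variable_cos (proper_form_measurable s c) (proper_form_normal s c) a (proper_form_mean s c)).
by rewrite proper_form_variance; congr (_ * expR _); field.
Qed.

(** Real and imaginary parts are forms [Re (a * z)] with [a = 1] and [a = - i]. For each pair of
    such forms the sum is normal by joint normality, so the real statement on independent normal
    variables applies to all four products. *)
Lemma proper_independent_uncorrelated (i j : I) :
  independent_pair P measurable measurable (X i) (X j) ->
  meanC P (fun w => X i w * conjc (X j w)) = 0.
Proof.
move=> ind.
have iM (f g : R[i] -> R) : measurable_fun setT f -> measurable_fun setT g ->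
    independent_pair P measurable measurable (f \o X i) (g \o X j).
  move=> mf mg B C mB mC; apply: (ind (f @^-1` B) (g @^-1` C)).
  - by rewrite -[X in measurable X]setTI; exact: mf.
  - by rewrite -[X in measurable X]setTI; exact: mg.
have lin (a b : R[i]) : normal_variable P (fun w => complex.Re (a * X i w) + complex.Re (b * X j w)).
  have := nX.1 2%N (fun k => if k == ord0 then i else j)
    (fun k => if k == ord0 then complex.Re a else complex.Re b)
    (fun k => if k == ord0 then - complex.Im a else - complex.Im b).
  under eq_fun do rewrite !big_ord_recr big_ord0 /= add0r !mulNr.
  by under [in X in _ -> X]eq_fun do rewrite !Re_mulc.
have mean0 (a : R[i]) k : \int[P]_w complex.Re (a * X k w) = 0.
  by rewrite (Re_integralc measurableT) -/(meanC _ _) ?X0 ?mulr0//; exact: proper_integrable.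
have nrm (a : R[i]) k : normal_variable P (fun w => complex.Re (a * X k w)).
  by have := proper_form_normal [:: k] (fun=> a); under eq_fun do rewrite big_seq1.
have mm (a : R[i]) : measurable_fun setT (fun z : R[i] => complex.Re (a * z)).
  apply: measurableT_comp measurable_funRe _.
  by apply: measurable_funMc => //; exact: measurable_cst.
have unc (a b : R[i]) : \int[P]_w (complex.Re (a * X i w) * complex.Re (b * X j w)) = 0.
  apply: independent_normal_uncorrelated => //.
  - exact: measurableT_comp (mm a) (mX i).
  - exact: measurableT_comp (mm b) (mX j).
  - exact: (iM _ _ (mm a) (mm b)).
have intM (a b : R[i]) : P.-integrable setT (fun w => (complex.Re (a * X i w) * complex.Re (b * X j w))%:E).
  apply: normal_variable_mul_integrable => //.
  - exact: measurableT_comp (mm a) (mX i).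
  - exact: measurableT_comp (mm b) (mX j).
have eR k w : complex.Re (X k w) = complex.Re (1 * X k w) by rewrite mul1r.
have eI k w : complex.Im (X k w) = complex.Re (Complex 0 (-1) * X k w).
  by rewrite Re_mulc /= mul0r sub0r mulN1r opprK.
apply: complex_ext => /=.
  under eq_Rintegral do rewrite Re_mulc Re_conjc Im_conjc mulrN opprK !eR !eI.
  by rewrite (RintegralD measurableT (intM _ _) (intM _ _)) !unc addr0.
under eq_Rintegral do rewrite Im_mulc Re_conjc Im_conjc mulrN addrC !eR !eI.
by rewrite (RintegralB measurableT (intM _ _) (intM _ _)) !unc subr0.
Qed.

End proper_normal_families.

(** * Laws of blocks *)

Section block_forms.
Context {R : realType} (N M : nat).
Notation block := (N.-tuple (M.-tuple R[i])).

Definition entry (y : block) (i : 'I_N) (l : 'I_M) : R[i] := tnth (tnth y i) l.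

Lemma measurable_entry i l : measurable_fun setT (fun y : block => entry y i l).
Proof. exact: measurableT_comp (measurable_tnth l) (measurable_tnth i). Qed.

Definition block_form (t : 'I_N -> 'I_M -> R[i]) (y : block) : R :=
  complex.Re (\sum_(i < N) \sum_(l < M) t i l * entry y i l).

Lemma measurable_block_form t : measurable_fun setT (block_form t).
Proof.
apply: measurableT_comp measurable_funRe _.
apply: measurable_fun_sumc => i; apply: measurable_fun_sumc => l.
by apply: measurable_funMc; [exact: measurable_cst|exact: measurable_entry].
Qed.

Lemma measurable_to_block d (T : measurableType d) (f : T -> block) :
  (forall i l, measurable_fun setT (fun x => entry (f x) i l)) ->
  measurable_fun setT f.
Proof.
move=> mf; apply/measurable_fun_tnthP => i; apply/measurable_fun_tnthP => l.
exact: mf.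
Qed.

Let L : set (block -> R) := [set fun y => block_form ta.1 y + ta.2 | ta in setT].

(** Coefficients 1 and [- i] at a single position exhibit the real and imaginary part of each entry
    as block forms, so the half-spaces generate the sigma-algebra of blocks. *)
Let gen : @measurable _ block `<=` <<s [set B | exists2 l, L l & B = [set x | 0 < l x]] >>.
Proof.
set G := [set B | _].
have pos t a : measurable ([set y | a < block_form t y] : set (g_sigma_algebraType G)).
  apply: sub_sigma_algebra; exists (fun y => block_form t y + - a).
    by exists (t, - a).
  by apply/seteqP; split=> y /=; rewrite subr_gt0.
have mform t : measurable_fun (setT : set (g_sigma_algebraType G)) (block_form t).
  apply: (measurability _ (RGenOInfty.measurableE R)) => _ [_ [a ->] <-].
  rewrite setTI (_ : _ @^-1` _ = [set y | a < block_form t y])//.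
  by apply/seteqP; split=> y /=; rewrite in_itv /= andbT.
have single c i l (y : block) :
    block_form (fun i' l' => if (i' == i) && (l' == l) then c else 0) y = complex.Re (c * entry y i l).
  rewrite /block_form (bigD1 i)//= (bigD1 l)//= !eqxx /= !big1 ?addr0//.
    by move=> i' /negbTE ->; rewrite big1// => l' _; rewrite mul0r.
  by move=> l' /negbTE ->; rewrite mul0r.
have mid : measurable_fun (setT : set (g_sigma_algebraType G)) (id : _ -> block).
  apply: measurable_to_block => i l; apply/measurable_fun_complexP; split.
    rewrite (_ : _ \o _ = block_form (fun i' l' => if (i' == i) && (l' == l) then 1 else 0)).
      exact: mform.
    by apply/funext => y; rewrite single mul1r.
  rewrite (_ : _ \o _ = block_form (fun i' l' => if (i' == i) && (l' == l) then Complex 0 (-1) else 0)).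
    exact: mform.
  by apply/funext => y; rewrite single Re_mulc /= mul0r sub0r mulN1r opprK.
by move=> A mA; have := mid measurableT A mA; rewrite setTI preimage_id.
Qed.

Lemma block_law_unique (mu nu : probability block R) :
  (forall t a, \int[mu]_y cos (block_form t y + a) = \int[nu]_y cos (block_form t y + a)) ->
  forall A, measurable A -> mu A = nu A.
Proof.
move=> E; apply: (@cos_transform_unique _ _ R mu nu L) => //.
- by move=> _ [[t a] _ <-]; apply: measurable_funD => //; exact: measurable_block_form.
- exists (fun _ _ => 0, 0) => //; apply/funext => y /=; rewrite addr0 /block_form.
  by rewrite big1// => i _; rewrite big1// => l _; rewrite mul0r.
- move=> _ _ [[t a] _ <-] [[t' a'] _ <-]; exists (fun i l => t i l + t' i l, a + a') => //=.
  apply/funext => y; rewrite addrACA; congr (_ + _); rewrite -Re_addc; congr complex.Re.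
  rewrite -big_split; apply: eq_bigr => i _ /=; rewrite -big_split; apply: eq_bigr => l _ /=.
  by rewrite mulrDl.
- move=> c b _ [[t a] _ <-]; exists (fun i l => c%:C%C * t i l, c * a + b) => //=.
  apply/funext => y; rewrite mulrDr addrA; congr (_ + _ + _).
  rewrite /block_form !Re_sumc mulr_sumr; apply: eq_bigr => i _.
  rewrite !Re_sumc mulr_sumr; apply: eq_bigr => l _.
  by rewrite -mulrA Re_mulc /= mul0r subr0.
- by move=> _ [[t a] _ <-]; exact: E.
Qed.

(** Equal cosine transforms give equal image laws, put here in the form of use: the blocks may live
    on different probability spaces, and [f] is any measurable test function. *)
Lemma block_law_eq d d' (T : measurableType d) (T' : measurableType d')
    (P : probability T R) (P' : probability T' R) (Y : T -> block) (Y' : T' -> block) :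
  measurable_fun setT Y -> measurable_fun setT Y' ->
  (forall t a, \int[P]_w cos (block_form t (Y w) + a) =
               \int[P']_w cos (block_form t (Y' w) + a)) ->
  forall f : block -> \bar R, measurable_fun setT f ->
  (\int[P]_w f (Y w) = \int[P']_w f (Y' w))%E.
Proof.
move=> mY mY' E f mf.
pose Yp : {mfun T >-> block} := HB.pack Y (isMeasurableFun.Build _ _ _ _ _ mY).
pose Yp' : {mfun T' >-> block} := HB.pack Y' (isMeasurableFun.Build _ _ _ _ _ mY').
have mc t a : measurable_fun setT (fun y : block => (cos (block_form t y + a))%:E).
  apply/measurable_EFinP; have [] // : bounded_mfun (fun y : block => cos (block_form t y + a)).
  by apply: bounded_mfun_cos; apply: measurable_funD => //; exact: measurable_block_form.
have law := @block_law_unique (distribution P Yp) (distribution P' Yp').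
rewrite -(@integral_image_law _ _ _ _ _ P (distribution P Yp) Y mY _ f mf)//.
rewrite -(@integral_image_law _ _ _ _ _ P' (distribution P' Yp') Y' mY' _ f mf)//.
apply: eq_measure_integral => A mA _; apply: law => // t a.
rewrite /Rintegral (@integral_image_law _ _ _ _ _ P (distribution P Yp) Y mY _ _ (mc t a))//.
by rewrite (@integral_image_law _ _ _ _ _ P' (distribution P' Yp') Y' mY' _ _ (mc t a))//; exact: E.
Qed.

End block_forms.

Section reindexing.
Context d (Omega : measurableType d) (R : realType) (P : probability Omega R).

Lemma jointly_proper_normal_reindex (I I' : Type) (X : I -> Omega -> R[i]) (f : I' -> I) :
  jointly_proper_normal P X -> jointly_proper_normal P (fun i => X (f i)).
Proof.
move=> [nX pX]; split=> [n i a b|i j]; last exact: pX.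
exact: (nX n (f \o i)).
Qed.

Lemma mutually_independent_reindex (J J' : eqType) (T : Type) (F : set (set T))
    (X : J -> Omega -> T) (f : J' -> J) : injective f -> F setT ->
  mutually_independent P F X -> mutually_independent P F (fun j => X (f j)).
Proof.
move=> finj FT iX s B us FB.
(* Off the range of [f] the constraint is trivial; on the range, injectivity makes the chosen
   preimage the right one. *)
pose C j := if pselect (exists i, f i = j) is left h then B (projT1 (cid h)) else setT.
have CE i : C (f i) = B i.
  rewrite /C; case: pselect => [h|[]]; last by exists i.
  by congr B; apply: finj; exact: (projT2 (cid h)).
have FC j : F (C j) by rewrite /C; case: pselect => // h; exact: FB.
have ufs : uniq (map f s) by rewrite map_inj_uniq.
have := iX _ C ufs FC; rewrite big_map.
under eq_bigr do rewrite CE.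
move=> <-; congr (P _); apply/seteqP; split=> w /= h j /=.
  by move=> /mapP[i si ->]; rewrite CE; exact: h.
by move=> js; rewrite -CE; apply: (h (f j)); exact: map_f.
Qed.

End reindexing.

(** * Covariance of the channel output *)

Section path_space.
Context {R : realType} (I : Type) d (T : measurableType d).

Notation pathT := (g_sigma_algebraType
  (\bigcup_(i in [set: I]) preimage_set_system setT (fun x : I -> T => x i) measurable)).

Lemma path_coord_measurable (i : I) : measurable_fun (setT : set pathT) (fun x : I -> T => x i).
Proof.
move=> _ B mB; apply: sub_sigma_algebra; exists i => //; exists B => //.
Qed.

Lemma path_preimage_measurable d' (T' : measurableType d') (f : (I -> T) -> T') B :
  measurable_fun (setT : set pathT) f -> measurable B -> path_measurable I T (f @^-1` B).
Proof. by move=> mf mB; have := mf measurableT B mB; rewrite setTI. Qed.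

End path_space.

Section stationary_covariance.
Context d (Omega : measurableType d) (R : realType) (P : probability Omega R).
Variable X : int -> Omega -> R[i].
Hypothesis mX : forall n, measurable_fun setT (X n).
Hypothesis sX : stationary P X.

Let cov n m := meanC P (fun w => X n w * conjc (X m w)).

Let measurable_conj : measurable_fun setT (@conjc R).
Proof.
apply/measurable_fun_complexP; split.
  by rewrite (_ : _ \o _ = @complex.Re R); [exact: measurable_funRe|apply/funext => z /=; rewrite Re_conjc].
rewrite (_ : _ \o _ = \- @complex.Im R); last by apply/funext => z /=; rewrite Im_conjc.
by apply: measurableT_comp => //; exact: measurable_funIm.
Qed.

(** A pair of coordinates is a measurable function of the path, so stationarity makes its whole law
    shift-invariant, and the covariance is an integral against that law. *)
Let cov_shift n m : cov (n + 1) (m + 1) = cov n m.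
Proof.
have mp n' m' : measurable_fun setT (fun w => (X n' w, X m' w)) by exact: measurable_fun_pair.
pose Z : {mfun Omega >-> (R[i] * R[i])%type} := HB.pack (fun w => (X n w, X m w))
  (isMeasurableFun.Build _ _ _ _ _ (mp n m)).
have law A : measurable A ->
    distribution P Z A = P ((fun w => (X (n + 1) w, X (m + 1) w)) @^-1` A).
  move=> mA.
  have hB : path_measurable int R[i] (fun x => A (x n, x m)).
    apply: (path_preimage_measurable (f := fun x : int -> R[i] => (x n, x m))) => //.
    by apply: measurable_fun_pair; exact: path_coord_measurable.
  exact: esym (sX hB).
have E (f : R[i] -> R) : measurable_fun setT f ->
    \int[P]_w f (X (n + 1) w * conjc (X (m + 1) w)) = \int[P]_w f (X n w * conjc (X m w)).
  move=> mf; rewrite /Rintegral; congr fine.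
  have mg : measurable_fun setT (fun z : R[i] * R[i] => (f (z.1 * conjc z.2))%:E).
    apply/measurable_EFinP; apply: measurableT_comp mf _.
    by apply: measurable_funMc; [exact: measurable_fst|exact: measurableT_comp measurable_conj measurable_snd].
  rewrite -(@integral_image_law _ _ _ _ _ P (distribution P Z) _ (mp _ _) law _ mg).
  by rewrite (@integral_image_law _ _ _ _ _ P (distribution P Z) _ (mp n m) _ _ mg).
by apply: complex_ext; apply: E; [exact: measurable_funRe|exact: measurable_funIm].
Qed.

Lemma stationary_covariance n (m : nat) :
  meanC P (fun w => X n w * conjc (X m%:Z w)) = autocorrelation P X (n - m%:Z).
Proof.
elim: m n => [n|m IHm n]; first by rewrite subr0.
transitivity (cov (n - 1) m%:Z).
  by rewrite -cov_shift subrK -PoszD addn1.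
by rewrite /cov IHm; congr autocorrelation; rewrite -addn1 PoszD; ring.
Qed.

End stationary_covariance.

Section channel_law.
Context d (Omega : measurableType d) (R : realType) (P : probability Omega R) (NT NR : nat).
Variables (H : 'I_NT -> 'I_NR -> int -> {RV P >-> R[i]}).
Variables (W : 'I_NR -> nat -> {RV P >-> R[i]}) (S : 'I_NT -> 'I_NR -> R -> R) (rho : R).
Hypothesis chan : mimo_channel H W S.
Hypothesis rho0 : 0 < rho.

Definition channel_cov N (z : N.-tuple (NT.-tuple R[i])) (l : 'I_NR) : 'M[R[i]]_N :=
  \matrix_(i, j) ((i == j)%:R + \sum_(k < NT)
    rho%:C%C * (entry z i k * conjc (entry z j k)) *
    autocorrelation P (H k l) (i%:Z - j%:Z)).

Definition noise_block N (w : Omega) : N.-tuple (NR.-tuple R[i]) :=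
  [tuple [tuple (W l i.+1 w : R[i]) | l < NR] | i < N].

Section block_length.
Variable N : nat.

Let HN (p : 'I_NT * 'I_NR * 'I_N) : Omega -> R[i] := H p.1.1 p.1.2 p.2.+1%:Z.
Let WN (p : 'I_N * 'I_NR) : Omega -> R[i] := W p.2 p.1.+1.

Let mHN p : measurable_fun setT (HN p). Proof. exact: measurable_funPT. Qed.
Let mWN p : measurable_fun setT (WN p). Proof. exact: measurable_funPT. Qed.

Let nHN : jointly_proper_normal P HN.
Proof.
exact: (jointly_proper_normal_reindex
  (fun p : 'I_NT * 'I_NR * 'I_N => (p.1, p.2.+1%:Z)) (fading_proper_normal chan)).
Qed.

Let HN0 p : meanC P (HN p) = 0. Proof. exact: (fading_zero_mean chan). Qed.

(** Stationarity handles a common antenna pair. For distinct pairs, independence of whole paths is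
    specialised to one coordinate of each, and independent jointly normal variables are
    uncorrelated. *)
Let covHN p q : meanC P (fun w => HN p w * conjc (HN q w)) =
  if p.1 == q.1 then autocorrelation P (H p.1.1 p.1.2) (p.2%:Z - q.2%:Z) else 0.
Proof.
case: p q => [kl i] [kl' j]; rewrite [X in _ = if X then _ else _]/=.
case: eqP => [->|/eqP pq].
  rewrite /HN /= (stationary_covariance _ (fading_stationary chan _ _)).
    by congr autocorrelation; rewrite -(addn1 i) -(addn1 j) !PoszD; ring.
  by move=> n; exact: measurable_funPT.
apply: (proper_independent_uncorrelated mHN nHN HN0) => B C mB mC.
have us : uniq [:: kl; kl'] by rewrite /= inE pq.
pose D r := if r == kl then [set x : int -> R[i] | B (x i.+1%:Z)] else [set x | C (x j.+1%:Z)].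
have mD r : path_measurable int R[i] (D r).
  rewrite /D; case: ifP => _.
    apply: (path_preimage_measurable (f := fun x : int -> R[i] => x i.+1%:Z)) => //.
    exact: path_coord_measurable.
  apply: (path_preimage_measurable (f := fun x : int -> R[i] => x j.+1%:Z)) => //.
  exact: path_coord_measurable.
have Dkl : D kl = [set x : int -> R[i] | B (x i.+1%:Z)] by rewrite /D eqxx.
have Dkl' : D kl' = [set x : int -> R[i] | C (x j.+1%:Z)] by rewrite /D eq_sym (negbTE pq).
have := fading_independent chan us mD.
rewrite big_cons big_seq1 Dkl Dkl' => <-.
congr (P _); apply/seteqP; split=> w /=.
  move=> [Bw Cw] r; rewrite /= !inE => /orP[|] /eqP ->; first by rewrite Dkl.
  by rewrite Dkl'.
move=> h; split.
  by have := h kl; rewrite /= inE eqxx Dkl => /(_ isT).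
by have := h kl'; rewrite /= !inE eqxx orbT Dkl' => /(_ isT).
Qed.

Let iWN : mutually_independent P measurable WN.
Proof.
apply: (mutually_independent_reindex (f := fun p : 'I_N * 'I_NR => (p.2, p.1.+1)) _ _ (noise_independent chan)).
  by move=> [i l] [i' l'] /= [-> /val_inj ->].
exact: measurableT.
Qed.

Lemma noise_form_cos (p : 'I_N * 'I_NR) (t : R[i]) (a : R) :
  \int[P]_w cos (complex.Re (t * WN p w) + a) = cos a * expR (- complex.Re (t * conjc t) / 4).
Proof.
have mWp (_ : unit) : measurable_fun setT (WN p) by exact: mWN.
have nWp : jointly_proper_normal P (fun _ : unit => WN p) by exact: (noise_proper_normal chan).
have Wp0 (_ : unit) : meanC P (WN p) = 0 by exact: (noise_zero_mean chan).
have := proper_form_cos mWp nWp Wp0 [:: tt] (fun=> t) a.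
under eq_Rintegral do rewrite big_seq1.
rewrite !big_seq1 => ->; congr (_ * expR (- complex.Re _ / 4)).
rewrite -[RHS]mulr1; congr (_ * _); apply: complex_ext => /=.
  have := noise_unit_variance chan p.2 p.1.+1; rewrite unlock => V.
  rewrite -[RHS]/(fine 1%E) -V; congr fine; apply: eq_integral => w _.
  by rewrite normc_sqr Re_mulc Re_conjc Im_conjc mulrN opprK !expr2.
rewrite -[RHS]/(fine 0%E); congr fine; apply: integral0_eq => w _.
by rewrite Im_mulc Re_conjc Im_conjc mulrN addrC mulrC subrr.
Qed.

Lemma noise_block_form t w : block_form t (noise_block N w) =
  \sum_(p : 'I_N * 'I_NR) complex.Re (t p.1 p.2 * WN p w).
Proof.
rewrite /block_form Re_sumc -(pair_big xpredT xpredT (fun i l => complex.Re (t i l * WN (i, l) w))) /=.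
apply: eq_bigr => i _; rewrite Re_sumc; apply: eq_bigr => l _.
by rewrite /entry !tnth_mktuple.
Qed.

Lemma measurable_noise_block : measurable_fun setT (noise_block N).
Proof.
apply: measurable_to_block => i l; under eq_fun do rewrite /entry !tnth_mktuple.
exact: measurable_funPT.
Qed.

Lemma noise_block_cos t (a : R) :
  \int[P]_w cos (block_form t (noise_block N w) + a) =
  cos a * expR (- (\sum_(i < N) \sum_(l < NR) complex.Re (t i l * conjc (t i l))) / 4).
Proof.
under eq_Rintegral do rewrite noise_block_form.
rewrite (@mutually_independent_cos_sum _ _ _ P _ _ _ WN mWN iWN _
  (fun p x => complex.Re (t p.1 p.2 * x)) (fun p => - complex.Re (t p.1 p.2 * conjc (t p.1 p.2)) / 4)).
- congr (_ * expR _); rewrite -mulr_suml sumrN; congr (- _ / _).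
  by rewrite -(pair_big xpredT xpredT (fun i l => complex.Re (t i l * conjc (t i l)))).
- exact: index_enum_uniq.
- move=> p; apply: measurableT_comp measurable_funRe _.
  by apply: measurable_funMc => //; exact: measurable_cst.
- by move=> p b; exact: noise_form_cos.
Qed.

Lemma channel_output_form t z w :
  block_form t (channel_output H W rho (z, w)) =
  complex.Re (\sum_(p : 'I_NT * 'I_NR * 'I_N)
    (t p.2 p.1.2 * ((Num.sqrt rho)%:C%C * entry z p.2 p.1.1)) * HN p w) +
  block_form t (noise_block N w).
Proof.
rewrite /block_form -Re_addc; congr complex.Re.
rewrite -(pair_big xpredT xpredT (fun q i =>
  t i q.2 * ((Num.sqrt rho)%:C%C * entry z i q.1) * HN (q, i) w)) /=.
rewrite [X in _ = X + _]exchange_big -big_split; apply: eq_bigr => i _ /=.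
rewrite -(pair_big xpredT xpredT (fun k l =>
  t i l * ((Num.sqrt rho)%:C%C * entry z i k) * HN ((k, l), i) w)) /=.
rewrite [X in _ = X + _]exchange_big -big_split; apply: eq_bigr => l _ /=.
rewrite /entry !tnth_mktuple mulrDr; congr (_ + _).
rewrite !mulr_sumr; apply: eq_bigr => k _; rewrite /HN /=; ring.
Qed.

Lemma measurable_channel_section z :
  measurable_fun setT (fun w => channel_output H W rho (z, w) : N.-tuple (NR.-tuple R[i])).
Proof.
have m1 : measurable_fun setT (fun w : Omega => (z, w)) by exact: measurable_fun_pair.
exact: measurableT_comp (measurable_channel_output H W rho (N := N)) m1.
Qed.

(** Fading and noise forms are independent, so their exponents add. The double sum over fading
    indices keeps only equal antenna pairs, and the noise supplies the identity matrix. No cross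
    term between receive antennas survives: they are independent once the input is fixed. *)
Lemma channel_output_cos t z (a : R) :
  \int[P]_w cos (block_form t (channel_output H W rho (z, w)) + a) =
  cos a * expR (- (\sum_(l < NR) \sum_(i < N) \sum_(j < N)
     complex.Re (t i l * conjc (t j l) * channel_cov z l i j)) / 4).
Proof.
pose c (p : 'I_NT * 'I_NR * 'I_N) := t p.2 p.1.2 * ((Num.sqrt rho)%:C%C * entry z p.2 p.1.1).
pose TH w := complex.Re (\sum_(p : 'I_NT * 'I_NR * 'I_N) c p * HN p w).
pose TW w := block_form t (noise_block N w).
under eq_Rintegral do rewrite channel_output_form -/c -/(TH _) -/(TW _).
have indTW : independent_pair P measurable measurable TH TW.
  pose fH (x : 'I_NT * 'I_NR * int -> R[i]) := \sum_p complex.Re (c p * x (p.1, p.2.+1%:Z)).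
  pose fW (x : 'I_NR * nat -> R[i]) := \sum_(p : 'I_N * 'I_NR) complex.Re (t p.1 p.2 * x (p.2, p.1.+1)).
  move=> B C mB mC.
  have := fading_noise_independent chan (B1 := fH @^-1` B) (B2 := fW @^-1` C).
  have -> : Defs.path (fun p : 'I_NR * nat => W p.1 p.2 : Omega -> _) @^-1` (fW @^-1` C) = TW @^-1` C.
    by apply/seteqP; split=> w /=; rewrite /TW noise_block_form.
  have -> : Defs.path (fun p : 'I_NT * 'I_NR * int => H p.1.1 p.1.2 p.2 : Omega -> _) @^-1` (fH @^-1` B) = TH @^-1` B.
    by apply/seteqP; split=> w /=; rewrite /TH Re_sumc.
  apply.
    apply: path_preimage_measurable mB.
    apply: measurable_sum => p; apply: measurableT_comp measurable_funRe _.
    by apply: measurable_funMc; [exact: measurable_cst|exact: path_coord_measurable].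
  apply: path_preimage_measurable mC.
  apply: measurable_sum => p; apply: measurableT_comp measurable_funRe _.
  by apply: measurable_funMc; [exact: measurable_cst|exact: path_coord_measurable].
have mTH : measurable_fun setT TH by exact: proper_form_measurable.
have mTW : measurable_fun setT TW.
  exact: measurableT_comp (measurable_block_form t) measurable_noise_block.
rewrite (independent_cosD mTH mTW indTW (proper_form_cos mHN nHN HN0 _ c) (noise_block_cos t)).
rewrite -expRD; congr (_ * expR _); rewrite -mulrDl -opprD; congr (- _ / _).
have -> : \sum_(p : 'I_NT * 'I_NR * 'I_N) \sum_(q : 'I_NT * 'I_NR * 'I_N)
      complex.Re (c p * conjc (c q) * meanC P (fun w => HN p w * conjc (HN q w))) =
    \sum_(l < NR) \sum_(i < N) \sum_(j < N) complex.Re (t i l * conjc (t j l) *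
      \sum_(k < NT) rho%:C%C * (entry z i k * conjc (entry z j k)) *
        autocorrelation P (H k l) (i%:Z - j%:Z)).
  transitivity (\sum_(k < NT) \sum_(l < NR) \sum_(i < N) \sum_(j < N)
      complex.Re (t i l * conjc (t j l) * (rho%:C%C * (entry z i k * conjc (entry z j k)) *
        autocorrelation P (H k l) (i%:Z - j%:Z)))).
    under eq_bigr do under eq_bigr do rewrite covHN.
    rewrite -(pair_big xpredT xpredT (fun (p : 'I_NT * 'I_NR) (i : 'I_N) =>
      \sum_(q : 'I_NT * 'I_NR * 'I_N) complex.Re (c (p, i) * conjc (c q) *
        if p == q.1 then autocorrelation P (H p.1 p.2) (i%:Z - q.2%:Z) else 0))) /=.
    rewrite -(pair_big xpredT xpredT (fun (k : 'I_NT) (l : 'I_NR) => \sum_(i < N)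
      \sum_(q : 'I_NT * 'I_NR * 'I_N) complex.Re (c ((k, l), i) * conjc (c q) *
        if (k, l) == q.1 then autocorrelation P (H k l) (i%:Z - q.2%:Z) else 0))) /=.
    apply: eq_bigr => k _; apply: eq_bigr => l _; apply: eq_bigr => i _.
    rewrite -(pair_big xpredT xpredT (fun (p : 'I_NT * 'I_NR) (j : 'I_N) =>
      complex.Re (c ((k, l), i) * conjc (c (p, j)) *
        if (k, l) == p then autocorrelation P (H k l) (i%:Z - j%:Z) else 0))) /=.
    rewrite (bigD1 (k, l))//= [X in _ + X]big1 ?addr0; last first.
      move=> p pkl; rewrite big1// => j _.
      by rewrite eq_sym (negbTE pkl) mulr0.
    apply: eq_bigr => j _; rewrite eqxx; congr complex.Re.
    have rr : (Num.sqrt rho)%:C%C * conjc (Num.sqrt rho)%:C%C = rho%:C%C :> R[i].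
      by rewrite conjc_real -rmorphM -expr2 sqr_sqrtr// ltW.
    by rewrite /c /= !rmorphM -rr; ring.
  rewrite exchange_big; apply: eq_bigr => l _.
  rewrite exchange_big; apply: eq_bigr => i _.
  rewrite exchange_big; apply: eq_bigr => j _.
  by rewrite mulr_sumr Re_sumc.
rewrite [X in _ + X]exchange_big /= -big_split; apply: eq_bigr => l _ /=.
rewrite -big_split; apply: eq_bigr => i _ /=.
rewrite addrC (bigD1 i)//= [in RHS](bigD1 i)//= addrA; congr (_ + _).
  by rewrite -Re_addc mxE eqxx; congr complex.Re; rewrite mulrDr mulr1.
by apply: eq_bigr => j ji; rewrite mxE eq_sym (negbTE ji) add0r.
Qed.

End block_length.
End channel_law.

(** * Eigenvalues of the output covariance *)

Section hermitian.
Context {R : realType}.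

(** The spectral theorem for normal matrices, with real eigenvalues because [A] is hermitian. The
    eigenvectors are the conjugated rows of [U]. Both orthonormality relations are recorded: rows
    serve to extract eigenvalues, columns serve in Parseval sums. *)
Lemma hermitian_diagonalization n (A : 'M[R[i]]_n) :
  (forall i j, A j i = conjc (A i j)) ->
  exists (U : 'M[R[i]]_n) (lam : 'I_n -> R),
  [/\ forall a b, \sum_i U a i * conjc (U b i) = (a == b)%:R,
      forall i j, \sum_a conjc (U a i) * U a j = (i == j)%:R &
      forall i j, A i j = \sum_a (lam a)%:C%C * (conjc (U a i) * U a j)].
Proof.
move=> hA.
have Ah : A \is hermsymmx.
  apply/is_hermitianmxP; rewrite expr0 scale1r; apply/matrixP => i j.
  by rewrite !mxE (hA j i).
have /hermitian_normalmx /orthomx_spectralP AE := Ah.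
have lr := hermitian_spectral_diag_real Ah.
set U := spectralmx A in AE; set D := spectral_diag A in AE lr.
have uU : U \is unitarymx by exact: spectral_unitarymx.
have UU := unitarymxP uU.
have UU' : (U ^t* )%sesqui *m U = 1%:M by rewrite -invmx_unitary// mulVmx// unitarymx_unit.
have DE a : D ord0 a = (complex.Re (D ord0 a))%:C%C.
  have /mxOverP/(_ ord0 a) := lr.
  by case: (D ord0 a) => x y; rewrite complex_real => /eqP ->.
exists U, (fun a => complex.Re (D ord0 a)); split.
- move=> a b; have /matrixP/(_ a b) := UU; rewrite !mxE => <-.
  by apply: eq_bigr => i _; rewrite !mxE.
- move=> i j; have /matrixP/(_ i j) := UU'; rewrite !mxE => <-.
  by apply: eq_bigr => a _; rewrite !mxE.
- move=> i j; rewrite {1}AE invmx_unitary// !mxE; apply: eq_bigr => a _.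
  by rewrite mul_mx_diag !mxE -DE; ring.
Qed.

Lemma conjcM (u v : R[i]) : conjc (u * v) = conjc u * conjc v.
Proof. exact: rmorphM. Qed.

Lemma normc_sqr_conj (u : R[i]) : (Normc.normc u ^+ 2)%:C%C = u * conjc u.
Proof. by rewrite normc_sqr; case: u => a b; apply: complex_ext => /=; ring. Qed.

Lemma unitary_sum_sqr n (U : 'M[R[i]]_n) (x : 'I_n -> R[i]) :
  (forall i j, \sum_a conjc (U a i) * U a j = (i == j)%:R) ->
  \sum_a Normc.normc (\sum_i U a i * x i) ^+ 2 = \sum_i Normc.normc (x i) ^+ 2.
Proof.
move=> uU; apply: (@complexI R); rewrite !rmorph_sum /=.
under eq_bigr => a _.
  rewrite normc_sqr_conj rmorph_sum mulr_suml.
  under eq_bigr => i _.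
    rewrite mulr_sumr; under eq_bigr => j _ do rewrite rmorphM mulrACA [U a i * _]mulrC.
    over.
  over.
rewrite exchange_big; apply: eq_bigr => i _ /=.
rewrite exchange_big /= (bigD1 i)//= [X in _ + X]big1 ?addr0; last first.
  move=> j ji; rewrite -mulr_suml.
  by under eq_bigr do rewrite -/(conjc _); rewrite uU (negbTE ji) mul0r.
by rewrite -mulr_suml uU eqxx mul1r normc_sqr_conj.
Qed.

End hermitian.

(** * Toeplitz quadratic forms as spectral integrals *)

Section trigonometric_forms.
Context {R : realType}.
Notation leb := (@lebesgue_measure R).
Variables (D : set R) (mD : measurable D).

Lemma expiB (x y : R) : expi x * conjc (expi y) = expi (x - y).
Proof. by rewrite /expi cosB sinB; apply: complex_ext => /=; ring. Qed.

(** The right-hand side of [spectral_autocorrelation], freed from any process: the constant density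
    1 then yields the orthogonality relations. *)
Definition fourier (S : R -> R) (n : int) : R[i] :=
  integralC leb D (fun t => (S t / (2 * pi))%:C%C * expi (n%:~R * t)).

Definition trig_sqr N (d : 'I_N -> R[i]) (t : R) : R :=
  Normc.normc (\sum_(i < N) d i * expi (i%:R * t)) ^+ 2.

Variable S : R -> R.
Hypothesis iS : leb.-integrable D (EFin \o S).

Let iS2 : leb.-integrable D (fun t => (S t / (2 * pi))%:E).
Proof. by under eq_fun do rewrite EFinM; exact: integrableZr. Qed.

Let cont_cos n : continuous (fun t : R => cos (n * t)).
Proof.
move=> t; apply: (cvg_comp _ cos); last exact: continuous_cos.
by apply: cvgMl_tmp; exact: cvg_id.
Qed.

Let cont_sin n : continuous (fun t : R => sin (n * t)).
Proof.
move=> t; apply: (cvg_comp _ sin); last exact: continuous_sin.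
by apply: cvgMl_tmp; exact: cvg_id.
Qed.

Let i_bounded (g f : R -> R) : leb.-integrable D (fun t => (g t)%:E) -> continuous f ->
  (forall t, `|f t| <= 1) -> leb.-integrable D (fun t => (g t * f t)%:E).
Proof.
move=> ig cf f1; apply: (@le_integrable _ _ _ leb D mD _ (fun t => (g t)%:E)) => //.
- apply/measurable_EFinP; apply: measurable_funM.
    by apply/measurable_EFinP; exact: measurable_int ig.
  by apply: measurable_funTS; exact: continuous_measurable_fun.
- by move=> t _; rewrite lee_fin normrM ler_piMr.
Qed.

Lemma fourier_integrable n :
  integrablec leb D (fun t => (S t / (2 * pi))%:C%C * expi (n * t)).
Proof.
split.
  under eq_fun do rewrite Re_mulc /= mul0r subr0.
  by apply: i_bounded => // t; rewrite ler_norml cos_geN1 cos_le1.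
under eq_fun do rewrite Im_mulc /= mul0r addr0.
by apply: i_bounded => // t; rewrite ler_norml sin_geN1 sin_le1.
Qed.

Lemma fourierN n : fourier S (- n) = conjc (fourier S n).
Proof.
apply: complex_ext => /=.
  congr fine; apply: eq_integral => t _.
  by rewrite !mul0r !subr0 rmorphN mulNr cosN.
rewrite -[RHS]mulN1r -RintegralZl//; last exact: (fourier_integrable _).2.
congr fine; apply: eq_integral => t _.
by rewrite !mul0r !addr0 rmorphN mulNr sinN mulN1r mulrN.
Qed.

Let trig_sqrE N (d : 'I_N -> R[i]) t : S t / (2 * pi) * trig_sqr d t =
  \sum_(i < N) \sum_(j < N) complex.Re (d i * conjc (d j) *
    ((S t / (2 * pi))%:C%C * expi ((i%:Z - j%:Z)%:~R * t))).
Proof.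
rewrite -[LHS]/(complex.Re (S t / (2 * pi) * trig_sqr d t)%:C%C) [(_ * _)%:C%C]rmorphM /trig_sqr.
rewrite [X in _ * X]normc_sqr_conj rmorph_sum mulr_suml mulr_sumr Re_sumc; apply: eq_bigr => i _.
rewrite mulr_sumr mulr_sumr Re_sumc; apply: eq_bigr => j _; congr complex.Re.
rewrite rmorphM intrB !pmulrn mulrBl -expiB -!pmulrn; ring.
Qed.

Lemma trig_sqr_integrable N (d : 'I_N -> R[i]) :
  leb.-integrable D (fun t => (S t / (2 * pi) * trig_sqr d t)%:E).
Proof.
under eq_fun do rewrite trig_sqrE.
apply: integrable_EFin_sum => // i; apply: integrable_EFin_sum => // j.
by apply: integrablecZ => //; exact: fourier_integrable.
Qed.

(** Expanding the squared modulus produces [expi ((i - j) * t)], whose integral against the density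
    is the Fourier coefficient at [i - j]. A Toeplitz quadratic form is thus a spectral average of
    [trig_sqr]. *)
Lemma integral_trig_sqr N (d : 'I_N -> R[i]) :
  \int[leb]_(t in D) (S t / (2 * pi) * trig_sqr d t) =
  \sum_(i < N) \sum_(j < N) complex.Re (d i * conjc (d j) * fourier S (i%:Z - j%:Z)).
Proof.
under eq_Rintegral do rewrite trig_sqrE.
rewrite (@Rintegral_sum _ _ R leb D mD) => [|i]; last first.
  apply: (@integrable_EFin_sum _ _ R leb D mD) => j.
  by apply: integrablecZ => //; exact: fourier_integrable.
apply: eq_bigr => i _; rewrite (@Rintegral_sum _ _ R leb D mD) => [|j]; last first.
  by apply: integrablecZ => //; exact: fourier_integrable.
by apply: eq_bigr => j _; rewrite Re_integralc//; exact: fourier_integrable.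
Qed.

End trigonometric_forms.

Section orthogonality.
Context {R : realType}.
Notation leb := (@lebesgue_measure R).
Notation D := (`[- pi, pi]%classic : set R).

Let mD : measurable D. Proof. exact: measurable_itv. Qed.

Let pi0 : (0 : R) < pi. Proof. exact: pi_gt0. Qed.

Lemma integrable_one_pi : leb.-integrable D (EFin \o (fun=> 1 : R)).
Proof.
apply: continuous_compact_integrable; first exact: segment_compact.
by apply: continuous_subspaceT; exact: cst_continuous.
Qed.

Let sin_int_pi (n : int) : sin (n%:~R * pi : R) = 0.
Proof.
have H (m : nat) : sin (m%:R * pi : R) = 0.
  elim: m => [|m IHm]; first by rewrite mul0r sin0.
  by rewrite -addn1 natrD mulrDl mul1r sinDpi IHm oppr0.
case: n => m; first exact: H.
by rewrite NegzE rmorphN mulNr sinN H oppr0.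
Qed.

Lemma fourier_one (n : int) : fourier D (fun=> 1 : R) n = (n == 0)%:R.
Proof.
have lin (n' t : R) : is_derive (t : R) (1 : R) (fun t => n' * t) n'.
  by apply: is_derive_eq; rewrite /GRing.scale /= mulr1.
have FTC (F f : R -> R) : (forall t : R, is_derive (t : R) (1 : R) F (f t)) -> continuous f ->
    \int[leb]_(t in D) f t = F pi - F (- pi).
  move=> dF cf.
  have cF : continuous F.
    by move=> t; apply: differentiable_continuous; apply/derivable1_diffP; have [] := dF t.
  rewrite /Rintegral (@continuous_FTC2 _ f F) -?EFinB//.
  - by rewrite gtrN.
  - exact: continuous_subspaceT.
  - split => [t _||]; [by have [] := dF t| |].
      by apply: cvg_at_right_filter; exact: cF.
    by apply: cvg_at_left_filter; exact: cF.
  - by move=> t _; rewrite derive1E; have [_ ->] := dF t.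
case: eqP => [->|/eqP n0].
  apply: complex_ext => /=.
    under eq_Rintegral do rewrite mulr0z !mul0r cos0 subr0 mulr1.
    rewrite (FTC (fun t => (1 / (2 * pi)) * t)) ?mulrN ?opprK//; last exact: cst_continuous.
    have p0 : pi != 0 :> R by rewrite gt_eqF.
    by move: (@pi R) p0 => p p0; field.
  under eq_Rintegral do rewrite mulr0z !mul0r sin0 mulr0 addr0.
  by rewrite /Rintegral integral0.
have n0' : n%:~R != 0 :> R by rewrite intr_eq0.
have p0 : pi != 0 :> R by rewrite gt_eqF.
apply: complex_ext => /=.
  under eq_Rintegral do rewrite mul0r subr0.
  have dF (t : R) : is_derive (t : R) (1 : R) (fun t => (1 / (2 * pi) / n%:~R) * sin (n%:~R * t)) (1 / (2 * pi) * cos (n%:~R * t)).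
    have := is_deriveZ ((1 / (2 * pi) / n%:~R))
      (@is_derive1_comp _ sin (fun t => n%:~R * t) t _ _ (is_derive_sin _) (lin _ t)).
    move=> /(@is_derive_eq _ _ _ _ _ _ _ _); apply.
    rewrite -[LHS]/(1 / (2 * pi) / n%:~R * (cos (n%:~R * t) * n%:~R)).
    by move: (@pi R) p0 => p p0; field; rewrite n0' p0.
  rewrite (FTC _ _ dF).
    by rewrite mulrN sinN sin_int_pi oppr0 mulr0 subrr.
  move=> t; apply: cvgMl_tmp; apply: (cvg_comp _ cos); last exact: continuous_cos.
  by apply: cvgMl_tmp; exact: cvg_id.
under eq_Rintegral do rewrite mul0r addr0.
have dF (t : R) : is_derive (t : R) (1 : R) (fun t => (- (1 / (2 * pi) / n%:~R)) * cos (n%:~R * t)) (1 / (2 * pi) * sin (n%:~R * t)).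
  have := is_deriveZ ((- (1 / (2 * pi) / n%:~R)))
    (@is_derive1_comp _ cos (fun t => n%:~R * t) t _ _ (is_derive_cos _) (lin _ t)).
  move=> /(@is_derive_eq _ _ _ _ _ _ _ _); apply.
  rewrite -[LHS]/(- (1 / (2 * pi) / n%:~R) * (- sin (n%:~R * t) * n%:~R)).
  by move: (@pi R) p0 => p p0; field; rewrite n0' p0.
rewrite (FTC _ _ dF).
  by rewrite mulrN cosN subrr.
move=> t; apply: cvgMl_tmp; apply: (cvg_comp _ sin); last exact: continuous_sin.
by apply: cvgMl_tmp; exact: cvg_id.
Qed.

(** Parseval, as the case of the constant density 1, whose Fourier coefficients vanish off 0. It
    computes the total mass of the spectral weights. *)
Lemma integral_trig_sqr_one N (d : 'I_N -> R[i]) :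
  \int[leb]_(t in D) (1 / (2 * pi) * trig_sqr d t) = \sum_(i < N) Normc.normc (d i) ^+ 2.
Proof.
rewrite (integral_trig_sqr mD integrable_one_pi); apply: eq_bigr => i _.
rewrite (bigD1 i)//= [X in _ + X]big1 ?addr0 => [|j ji].
  by rewrite fourier_one subrr eqxx mulr1 -normc_sqr_conj.
rewrite fourier_one subr_eq0 (_ : (_ == _) = false) ?mulr0//.
by apply/negbTE; rewrite eqz_nat; apply: contra ji => /eqP/val_inj ->.
Qed.

End orthogonality.

(** * Spectral lower bound for the log-determinant *)

Section spectral_bound.
Context {R : realType}.
Notation leb := (@lebesgue_measure R).
Notation D := (`[- pi, pi]%classic : set R).
Variables (N K : nat) (z : 'I_N -> 'I_K -> R[i]) (Rf : 'I_K -> int -> R[i]).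
Variables (S : 'I_K -> R -> R) (rho : R).
Hypothesis specS : forall k, spectral_density (Rf k) (S k).
Hypothesis rho0 : 0 < rho.

Let mD : measurable D. Proof. exact: measurable_itv. Qed.

Let pi0 : (0 : R) < pi. Proof. exact: pi_gt0. Qed.

Let iS k : leb.-integrable D (EFin \o S k). Proof. exact: spectral_integrable (specS k). Qed.

Let S0 k t : D t -> 0 <= S k t.
Proof. by move=> Dt; apply: spectral_ge0 (specS k) _ _; rewrite inE. Qed.

Let RfE k n : Rf k n = fourier D (S k) n.
Proof. exact: (spectral_autocorrelation (specS k)). Qed.

(** Convertible to [channel_cov] at one receive antenna, with input and spectral data abstracted so
    that the eigenvalue argument can be carried out apart from the channel. *)
Definition toeplitz_mix : 'M[R[i]]_N := \matrix_(i, j) ((i == j)%:R +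
  \sum_(k < K) rho%:C%C * (z i k * conjc (z j k)) * Rf k (i%:Z - j%:Z)).

Lemma toeplitz_mix_hermitian i j : toeplitz_mix j i = conjc (toeplitz_mix i j).
Proof.
rewrite !mxE rmorphD rmorph_nat eq_sym; congr (_ + _).
rewrite rmorph_sum; apply: eq_bigr => k _.
rewrite -[RHS]/(conjc _) !conjcM conjc_real conjcK [conjc _ * z j k]mulrC.
by rewrite !RfE -opprB fourierN.
Qed.

Let V (c : 'I_N -> R[i]) k := trig_sqr (fun i => c i * z i k).
Let m (c : 'I_N -> R[i]) k := \sum_(i < N) Normc.normc (c i * z i k) ^+ 2.

Lemma toeplitz_mix_form (c : 'I_N -> R[i]) :
  complex.Re (\sum_i \sum_j c i * toeplitz_mix i j * conjc (c j)) =
  \sum_i Normc.normc (c i) ^+ 2 +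
  \sum_(k < K) rho * \int[leb]_(t in D) (S k t / (2 * pi) * V c k t).
Proof.
transitivity (complex.Re (\sum_i \sum_j (c i * conjc (c j) * (i == j)%:R +
    \sum_(k < K) rho%:C%C * ((c i * z i k) * conjc (c j * z j k) * Rf k (i%:Z - j%:Z))))).
  congr complex.Re; apply: eq_bigr => i _; apply: eq_bigr => j _.
  rewrite mxE mulrDr mulrDl; congr (_ + _); first by ring.
  rewrite mulr_sumr mulr_suml; apply: eq_bigr => k _.
  by rewrite rmorphM /= -/(conjc _); ring.
under eq_bigr do rewrite big_split /=.
rewrite big_split Re_addc; congr (_ + _).
  rewrite Re_sumc; apply: eq_bigr => i _.
  rewrite (bigD1 i)//= [X in _ + X]big1 ?addr0 => [|j ji].
    by rewrite eqxx mulr1 -normc_sqr_conj.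
  by rewrite eq_sym (negbTE ji) mulr0.
under eq_bigr do rewrite exchange_big /=.
rewrite exchange_big Re_sumc; apply: eq_bigr => k _ /=.
rewrite (integral_trig_sqr mD (iS k)) mulr_sumr Re_sumc; apply: eq_bigr => i _.
rewrite mulr_sumr Re_sumc; apply: eq_bigr => j _.
by rewrite Re_mulc /= mul0r subr0 RfE.
Qed.

(** Nonnegative spectral densities make the fading part positive semidefinite. At unit eigenvectors
    this says that every eigenvalue is at least 1. *)
Lemma toeplitz_mix_form_ge (c : 'I_N -> R[i]) : \sum_i Normc.normc (c i) ^+ 2 <=
  complex.Re (\sum_i \sum_j c i * toeplitz_mix i j * conjc (c j)).
Proof.
rewrite toeplitz_mix_form lerDl; apply: sumr_ge0 => k _; rewrite mulr_ge0 ?(ltW rho0)//.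
apply: Rintegral_ge0 => t Dt; rewrite mulr_ge0 ?sqr_ge0// divr_ge0 ?S0//.
by rewrite mulr_ge0// ltW.
Qed.

Let mV c k : measurable_fun setT (V c k).
Proof.
rewrite /V /trig_sqr; apply: measurable_funX; rewrite (_ : (fun t => _) = fun t =>
  Num.sqrt (complex.Re (\sum_(i < N) c i * z i k * expi (i%:R * t)) ^+ 2 +
            complex.Im (\sum_(i < N) c i * z i k * expi (i%:R * t)) ^+ 2)); last first.
  by apply/funext => t; case: (\sum_(i < N) _).
have ml (a : R) : measurable_fun setT (fun t : R => a * t) by exact: measurable_funM.
have me (a : R) : measurable_fun setT (fun t : R => expi (a * t)).
  apply/measurable_fun_complexP; split.
    apply: measurableT_comp (ml a).
    by apply: continuous_measurable_fun; exact: continuous_cos.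
  apply: measurableT_comp (ml a).
  by apply: continuous_measurable_fun; exact: continuous_sin.
have ms : measurable_fun setT (fun t : R => \sum_(i < N) c i * z i k * expi (i%:R * t)).
  by apply: measurable_fun_sumc => i; apply: measurable_funMc => //; exact: measurable_cst.
apply: measurableT_comp; first exact: (continuous_measurable_fun (@sqrt_continuous R)).
by apply: measurable_funD; apply: measurable_funX;
  [exact: measurableT_comp measurable_funRe ms|exact: measurableT_comp measurable_funIm ms].
Qed.

Let L k t := ln (1 + rho * S k t) / (2 * pi).

Let mS k : measurable_fun D (S k).
Proof. by have /integrableP[/measurable_EFinP] := iS k. Qed.

Let mL k : measurable_fun D (L k).
Proof.
apply: measurable_funM => //; apply: measurableT_comp; first exact: measurable_ln.
by apply: measurable_funD => //; exact: measurable_funM.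
Qed.

Let L0 k t : D t -> 0 <= L k t.
Proof.
move=> Dt; rewrite divr_ge0 ?mulr_ge0 ?(ltW pi0)// ln_ge0// lerDl mulr_ge0 ?S0// ltW//.
Qed.

Let L_le k t : D t -> L k t <= rho * (S k t / (2 * pi)).
Proof.
move=> Dt; rewrite mulrA ler_wpM2r ?invr_ge0 ?mulr_ge0 ?(ltW pi0)//.
by rewrite le_ln1Dx// (lt_le_trans (ltrN10 R))// mulr_ge0 ?S0// ltW.
Qed.

Let iSV c k : leb.-integrable D (fun t => (S k t / (2 * pi) * V c k t)%:E).
Proof. exact: (trig_sqr_integrable mD (iS k)). Qed.

Let i1V c k : leb.-integrable D (fun t => (1 / (2 * pi) * V c k t)%:E).
Proof. exact: (trig_sqr_integrable mD integrable_one_pi). Qed.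

Let iLV c k : leb.-integrable D (fun t => (L k t * V c k t)%:E).
Proof.
apply: (@le_integrable _ _ _ leb D mD _ (fun t => (rho * (S k t / (2 * pi) * V c k t))%:E)).
- apply/measurable_EFinP; apply: measurable_funM; first exact: mL.
  by apply: measurable_funTS; exact: mV.
- move=> t Dt; rewrite lee_fin !ger0_norm.
  + by rewrite mulrA ler_wpM2r ?sqr_ge0// L_le.
  + rewrite mulr_ge0 ?(ltW rho0)// mulr_ge0 ?sqr_ge0// mulr_ge0 ?S0//.
    by rewrite invr_ge0 mulr_ge0 ?(ltW pi0).
  + by rewrite mulr_ge0 ?sqr_ge0 ?L0.
- rewrite (_ : (fun t => (rho * _)%:E) = fun t => (rho%:E * (S k t / (2 * pi) * V c k t)%:E)%E).
    by apply: integrableZl.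
  by apply/funext => t; rewrite EFinM.
Qed.

(* Jensen's inequality for [ln], in the tangent-line form
   [ln x <= ln y + x / y - 1] integrated against the spectral weights. *)
Lemma toeplitz_mix_log (c : 'I_N -> R[i]) :
  \sum_i Normc.normc (c i) ^+ 2 = 1 -> (forall i, \sum_k Normc.normc (z i k) ^+ 2 <= 1) ->
  \sum_(k < K) \int[leb]_(t in D) (L k t * V c k t) <=
  ln (complex.Re (\sum_i \sum_j c i * toeplitz_mix i j * conjc (c j))).
Proof.
move=> c1 z1; have lam1 := toeplitz_mix_form_ge c.
have lamE := toeplitz_mix_form c; move: lam1 lamE; rewrite c1.
set lam := complex.Re _ => lam1 lamE.
have lam0 : 0 < lam by rewrite (lt_le_trans ltr01).
have w0 : \sum_(k < K) m c k <= 1.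
  rewrite -c1 /m exchange_big /=; apply: ler_sum => i _.
  under eq_bigr do rewrite Normc.normcM exprMn.
  by rewrite -mulr_sumr ler_piMr// sqr_ge0.
have tangent k t : D t -> L k t <=
    (ln lam - 1 + lam^-1) * (1 / (2 * pi)) + lam^-1 * rho * (S k t / (2 * pi)).
  move=> Dt.
  have Sp : 0 < 1 + rho * S k t by rewrite ltr_pwDl// mulr_ge0 ?S0// ltW.
  have : ln ((1 + rho * S k t) / lam) <= (1 + rho * S k t) / lam - 1.
    have := @le_ln1Dx R ((1 + rho * S k t) / lam - 1); rewrite addrCA subrr addr0; apply.
    by rewrite ltrBrDl subrr divr_gt0.
  rewrite ln_div ?posrE// lerBlDr => h.
  apply: (@le_trans _ _ (((1 + rho * S k t) / lam - 1 + ln lam) / (2 * pi))).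
    by rewrite /L ler_wpM2r// invr_ge0 mulr_ge0// ltW.
  have p0 : pi != 0 :> R by rewrite gt_eqF.
  by rewrite le_eqVlt; apply/orP; left; apply/eqP; move: (@pi R) p0 => p p0; field; rewrite p0 gt_eqF.
have step k : \int[leb]_(t in D) (L k t * V c k t) <=
    (ln lam - 1 + lam^-1) * m c k + lam^-1 * (rho * \int[leb]_(t in D) (S k t / (2 * pi) * V c k t)).
  have -> : m c k = \int[leb]_(t in D) (1 / (2 * pi) * V c k t) by rewrite integral_trig_sqr_one.
  rewrite -[X in _ <= X + _]RintegralZl//; last exact: i1V.
  rewrite mulrA -RintegralZl//; last exact: iSV.
  have iA : leb.-integrable D (fun t => ((ln lam - 1 + lam^-1) * (1 / (2 * pi) * V c k t))%:E).
    rewrite (_ : (fun t => _) = fun t => ((ln lam - 1 + lam^-1)%:E * (1 / (2 * pi) * V c k t)%:E)%E).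
      by apply: integrableZl => //; exact: i1V.
    by apply/funext => t; rewrite EFinM.
  have iB : leb.-integrable D (fun t => (lam^-1 * rho * (S k t / (2 * pi) * V c k t))%:E).
    rewrite (_ : (fun t => _) = fun t => ((lam^-1 * rho)%:E * (S k t / (2 * pi) * V c k t)%:E)%E).
      by apply: integrableZl.
    by apply/funext => t; rewrite EFinM.
  rewrite -(@RintegralD _ _ R leb D _ _ mD iA iB); apply: le_Rintegral => //.
  - exact: iLV.
  - rewrite (_ : EFin \o _ = ((fun t => ((ln lam - 1 + lam^-1) * (1 / (2 * pi) * V c k t))%:E) \+
      (fun t => (lam^-1 * rho * (S k t / (2 * pi) * V c k t))%:E))%E); first exact: integrableD.
    by apply/funext => t; rewrite /= EFinD.
  move=> t Dt; rewrite [X in _ <= X + _]mulrA [X in _ <= _ + X]mulrA.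
  by rewrite -mulrDl ler_wpM2r ?sqr_ge0// tangent.
apply: (le_trans (ler_sum _ (fun k _ => step k))).
rewrite big_split -!mulr_sumr /=.
have -> : rho * (\sum_(k < K) \int[leb]_(t in D) (S k t / (2 * pi) * V c k t)) = lam - 1.
  by rewrite mulr_sumr lamE addrAC subrr add0r.
set w := \sum_(k < K) m c k in w0 *.
(* The tangent line of [ln] at [lam], evaluated at 1, dominates [ln 1 = 0]. Being nonnegative, this
   coefficient allows the mass [w] to be raised to 1, which is where the missing mass is filled by
   the constant 1. *)
have lnl : 0 <= ln lam - 1 + lam^-1.
  have := @le_ln1Dx R (lam^-1 - 1); rewrite addrCA subrr addr0 lnV ?posrE//.
  have i0 : 0 < lam^-1 by rewrite invr_gt0.
  by move=> /(_ _); rewrite ltrBrDl subrr => /(_ i0); lra.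
have -> : lam^-1 * (lam - 1) = 1 - lam^-1 by rewrite mulrBr mulVf ?gt_eqF// mulr1.
have : (ln lam - 1 + lam^-1) * w <= ln lam - 1 + lam^-1 by rewrite ler_piMr.
lra.
Qed.

Let iL k : leb.-integrable D (fun t => (L k t)%:E).
Proof.
apply: (@le_integrable _ _ _ leb D mD _ (fun t => ((S k t)%:E * (rho / (2 * pi))%:E)%E)).
- by apply/measurable_EFinP; exact: mL.
- move=> t Dt; rewrite -EFinM lee_fin !ger0_norm ?L0//.
    by rewrite (le_trans (L_le k Dt))// mulrCA mulrA.
  by rewrite !mulr_ge0 ?S0 ?invr_ge0 ?mulr_ge0 ?ltW.
- by apply: integrableZr => //; exact: iS.
Qed.

(** At each frequency [t], Parseval over the eigenbasis applies to the vector of entries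
    [z i k * expi (i * t)], which have the moduli of the [z i k]. The summed weights are therefore
    constant in [t], and the integral of the logarithm factors out as [info_rate]. *)
Lemma toeplitz_mix_log_det (U : 'M[R[i]]_N) (lam : 'I_N -> R) :
  (forall a b, \sum_i U a i * conjc (U b i) = (a == b)%:R) ->
  (forall i j, \sum_a conjc (U a i) * U a j = (i == j)%:R) ->
  (forall i j, toeplitz_mix i j = \sum_a (lam a)%:C%C * (conjc (U a i) * U a j)) ->
  (forall a, 1 <= lam a) /\
  ((forall i, \sum_k Normc.normc (z i k) ^+ 2 <= 1) ->
   \sum_(k < K) (\sum_i Normc.normc (z i k) ^+ 2) * info_rate rho (S k) <= \sum_a ln (lam a)).
Proof.
move=> UU U'U AE.
have lamE a : complex.Re (\sum_i \sum_j U a i * toeplitz_mix i j * conjc (U a j)) = lam a.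
  rewrite -[RHS]/(complex.Re (lam a)%:C%C); congr complex.Re.
  transitivity (\sum_b (lam b)%:C%C * ((\sum_i U a i * conjc (U b i)) *
      (\sum_j U b j * conjc (U a j)))).
    under [RHS]eq_bigr => b _.
      rewrite mulr_suml mulr_sumr; under eq_bigr do rewrite mulr_sumr mulr_sumr.
      over.
    rewrite [RHS]exchange_big; apply: eq_bigr => i _ /=.
    rewrite [RHS]exchange_big; apply: eq_bigr => j _ /=.
    rewrite AE mulr_sumr mulr_suml; apply: eq_bigr => b _; ring.
  rewrite (bigD1 a)//= [X in _ + X]big1 ?addr0 => [|b ba]; first by rewrite !UU eqxx !mulr1.
  by rewrite !UU eq_sym (negbTE ba) mul0r mulr0.
have U1 a : \sum_i Normc.normc (U a i) ^+ 2 = 1.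
  apply: (@complexI R); rewrite rmorph_sum /=.
  by under eq_bigr do rewrite normc_sqr_conj; rewrite UU eqxx.
split=> [a|z1]; first by rewrite -lamE -(U1 a) toeplitz_mix_form_ge.
have lb a := toeplitz_mix_log (U1 a) z1.
apply: (@le_trans _ _ (\sum_a \sum_(k < K) \int[leb]_(t in D) (L k t * V (U a) k t))); last first.
  by apply: ler_sum => a _; rewrite -(lamE a).
rewrite exchange_big le_eqVlt; apply/orP; left; apply/eqP; apply: eq_bigr => k _ /=.
rewrite -(@Rintegral_sum _ _ R leb D mD) => [|a]; last exact: iLV.
rewrite mulrC -RintegralZr//; last exact: iL.
apply: eq_Rintegral => t _; rewrite -mulr_sumr; congr (_ * _).
rewrite /V /trig_sqr; under [RHS]eq_bigr do under eq_bigr do rewrite -mulrA.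
rewrite (unitary_sum_sqr (fun i => z i k * expi (i%:R * t)) U'U).
apply: eq_bigr => i _; rewrite Normc.normcM.
suff -> : Normc.normc (expi (i%:R * t)) = 1 by rewrite mulr1.
by rewrite /expi /= cos2Dsin2 sqrtr1.
Qed.

End spectral_bound.

(** * Gaussian densities under scaling *)

Section density_probability.
Local Open Scope ereal_scope.
Context d (T : measurableType d) (R : realType).

(** The three proofs are arguments so that the measure and probability structures can be attached to
    the term itself. *)
Definition density_prob (mu : {measure set T -> \bar R}) (h : T -> R)
    (mh : measurable_fun setT h) (h0 : forall x, (0 <= h x)%R)
    (h1 : \int[mu]_x (h x)%:E = 1) (A : set T) : \bar R :=
  \int[mu]_(x in A) (h x)%:E.

Variables (mu : {measure set T -> \bar R}) (h : T -> R).
Hypothesis mh : measurable_fun setT h.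
Hypothesis h0 : forall x, (0 <= h x)%R.
Hypothesis h1 : \int[mu]_x (h x)%:E = 1.
Local Notation nu := (density_prob mh h0 h1).

Let nu0 : nu set0 = 0. Proof. exact: integral_set0. Qed.

Let nu_ge0 A : 0 <= nu A.
Proof. by apply: integral_ge0 => x _; rewrite lee_fin. Qed.

Let nu_sigma_additive : semi_sigma_additive nu.
Proof.
move=> /= A mA tA mUA; rewrite /density_prob integral_bigcup//=; last first.
  apply: (integrableS measurableT) => //; apply/integrableP; split; first exact/measurable_EFinP.
  by under eq_integral do rewrite /= ger0_norm//; rewrite h1 ltry.
by apply: is_cvg_ereal_nneg_natsum_cond => n _ _; apply: integral_ge0 => x _; rewrite lee_fin.
Qed.

HB.instance Definition _ := isMeasure.Build _ _ _ nu nu0 nu_ge0 nu_sigma_additive.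

Let nuT : nu setT = 1. Proof. exact: h1. Qed.

HB.instance Definition _ := @Measure_isProbability.Build _ _ R nu nuT.

End density_probability.

Section block_boxes.
Context {R : realType} (N M : nat).
Notation block := (N.-tuple (M.-tuple R[i])).

Let boxes : set (set block) := [set A | exists2 B : 'I_N -> 'I_M -> set R[i],
  (forall i l, measurable (B i l)) & A = [set y | forall i l, B i l (entry y i l)]].

Let box_measurable : boxes `<=` measurable.
Proof.
move=> _ [B mB ->].
rewrite (_ : [set y | _] = \bigcap_(p in [set: 'I_N * 'I_M]) ((fun y => entry y p.1 p.2) @^-1` B p.1 p.2)); last first.
  apply/seteqP; split=> y /=; first by move=> h [i l] _; exact: h.
  by move=> h i l; exact: (h (i, l)).
apply: fin_bigcap_measurable => // -[i l] _.
by rewrite -[X in measurable X]setTI; exact: measurable_entry.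
Qed.

Let box_setI : setI_closed boxes.
Proof.
move=> _ _ [B mB ->] [C mC ->]; exists (fun i l => B i l `&` C i l).
  by move=> i l; exact: measurableI.
apply/seteqP; split=> y /=; first by move=> [h1 h2] i l; split; [exact: h1|exact: h2].
by move=> h; split=> i l; have [] := h i l.
Qed.

Let box_gen : @measurable _ block `<=` <<s boxes >>.
Proof.
have mid : measurable_fun (setT : set (g_sigma_algebraType boxes)) (id : _ -> block).
  apply: measurable_to_block => i l _ B mB; rewrite setTI; apply: sub_sigma_algebra.
  exists (fun i' l' => if (i' == i) && (l' == l) then B else setT).
    by move=> i' l'; case: ifP.
  apply/seteqP; split=> y /=; last by move=> /(_ i l); rewrite !eqxx.
  by move=> By i' l'; case: ifP => // /andP[/eqP -> /eqP ->].
by move=> A mA; have := mid measurableT A mA; rewrite setTI preimage_id.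
Qed.

(** Boxes are stable under intersection and generate. They are the convenient test events for
    independent entries, since integrals over a box factor. *)
Lemma block_box_unique (mu nu : probability block R) :
  (forall B : 'I_N -> 'I_M -> set R[i], (forall i l, measurable (B i l)) ->
     mu [set y | forall i l, B i l (entry y i l)] = nu [set y | forall i l, B i l (entry y i l)]) ->
  forall A, measurable A -> mu A = nu A.
Proof.
move=> E A /box_gen.
apply: (@g_sigma_algebra_measure_unique _ R _ boxes box_measurable (fun=> setT)) => //.
- by move=> _; exists (fun _ _ => setT) => //; apply/seteqP; split.
- by rewrite bigcup_const.
- by move=> _ [B mB ->]; exact: E.
- by move=> _; rewrite (le_lt_trans (probability_le1 _ _)) ?ltry.
Qed.

End block_boxes.

Section normal_scaling.
Context {R : realType}.
Variables (s c : R).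
Hypothesis s0 : s != 0.
Hypothesis c0 : 0 < c.
Local Notation G := (normal_prob 0 s).

(** Both laws have cosine transform [cos a * exp (- (c * s * t) ^ 2 / 2)], with the affine functions
    as the class [L]. *)
Lemma normal_prob_scale A : measurable A ->
  normal_prob 0 (c * s) A = G ((fun x => c * x) @^-1` A).
Proof.
have cs0 : c * s != 0 by rewrite mulf_neq0// gt_eqF.
have mc : measurable_fun (setT : set (measurableTypeR R)) (fun x => c * x : measurableTypeR R).
  exact: measurable_funM.
pose Xc : {mfun measurableTypeR R >-> measurableTypeR R} := HB.pack (fun x : R => c * x) (isMeasurableFun.Build _ _ _ _ _ mc).
move=> mA; rewrite -[RHS]/(distribution G Xc A); move: A mA.
apply: (@cos_transform_unique _ _ R (normal_prob 0 (c * s)) (distribution G Xc)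
  [set fun x => ta.1 * x + ta.2 | ta in setT]).
- move=> _ [[t a] _ <-] /=; apply: measurable_funD => //; exact: measurable_funM.
- by exists (0, 0) => //; apply/funext => x /=; rewrite mul0r addr0.
- move=> _ _ [[t a] _ <-] [[t' a'] _ <-]; exists (t + t', a + a') => //.
  by apply/funext => x /=; ring.
- move=> b a' _ [[t a] _ <-]; exists (b * t, b * a + a') => //.
  by apply/funext => x /=; ring.
- move=> _ [[t a] _ <-] /=; rewrite normal_cos_scale//.
  have mcos : measurable_fun setT (fun x : R => (cos (t * x + a))%:E).
    apply/measurable_EFinP; have [] // : bounded_mfun (fun x : R => cos (t * x + a)).
    by apply: bounded_mfun_cos; apply: measurable_funD => //; exact: measurable_funM.
  rewrite /Rintegral (@integral_image_law _ _ _ _ _ G (distribution G Xc) _ mc _ _ mcos)//.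
  transitivity (\int[G]_x cos ((t * c) * x + a)); last first.
    by rewrite /Rintegral; congr fine; apply: eq_integral => x _; rewrite /= mulrA.
  by rewrite normal_cos_scale//; congr (_ * expR (- _)); ring.
- move=> A mA; rewrite -[A](_ : [set x | A (1 * x + 0)] = _); last first.
    by apply/seteqP; split=> x /=; rewrite mul1r addr0.
  set C := [set B | _].
  have mid : measurable_fun (setT : set (g_sigma_algebraType C)) (fun x : R => 1 * x + 0).
    apply: (measurability _ (RGenOInfty.measurableE R)) => _ [_ [a ->] <-].
    rewrite setTI; apply: sub_sigma_algebra; exists (fun x => 1 * x + - a).
      by exists (1, - a).
    by apply/seteqP; split=> x /=; rewrite in_itv /= andbT !mul1r addr0 subr_gt0.
  by have := mid measurableT A mA; rewrite setTI.
Qed.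

(** The quotient of [normal_pdf 0 (c * s)] by [normal_pdf 0 s]. *)
Definition scale_ratio (x : R) : R := c^-1 * expR (x ^+ 2 / (s ^+ 2 *+ 2) * (1 - (c ^+ 2)^-1)).

Lemma scale_ratio_ge0 x : 0 <= scale_ratio x.
Proof. by rewrite mulr_ge0 ?expR_ge0// invr_ge0 ltW. Qed.

Lemma measurable_scale_ratio : measurable_fun setT scale_ratio.
Proof.
apply: measurable_funM => //; apply: measurableT_comp => //.
by apply: measurable_funM => //; apply: measurable_funM => //; exact: measurable_funX.
Qed.

Let scale_exponent (x : R) : - x ^+ 2 / ((c * s) ^+ 2 *+ 2) =
  x ^+ 2 / (s ^+ 2 *+ 2) * (1 - c ^- 2) + - x ^+ 2 / (s ^+ 2 *+ 2).
Proof.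
have c0' : c != 0 by rewrite gt_eqF.
by rewrite -(mulr_natr (_ ^+ 2)) -(mulr_natr (s ^+ 2)); field; rewrite s0.
Qed.

Lemma normal_scale_density (f : R -> \bar R) : measurable_fun setT f ->
  (\int[G]_x f (c * x)%R = \int[G]_x (f x * (scale_ratio x)%:E))%E.
Proof.
move=> mf.
have cs0 : c * s != 0 by rewrite mulf_neq0// gt_eqF.
have mc : measurable_fun setT (fun x : R => c * x) by exact: measurable_funM.
rewrite -(@integral_image_law _ _ _ _ _ G (normal_prob 0 (c * s)) _ mc normal_prob_scale f mf).
rewrite (@integral_density _ _ _ (@lebesgue_measure R) (normal_prob 0 (c * s)) (normal_pdf 0 (c * s)))//; last 2 first.
- exact: measurable_normal_pdf.
- exact: normal_pdf_ge0.
rewrite (@integral_density _ _ _ (@lebesgue_measure R) G (normal_pdf 0 s)); last 4 first.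
- exact: measurable_normal_pdf.
- exact: normal_pdf_ge0.
- by [].
- by apply: emeasurable_funM => //; apply/measurable_EFinP; exact: measurable_scale_ratio.
apply: eq_integral => x _; rewrite -muleA -EFinM; congr (_ * _%:E)%E.
rewrite !normal_pdfE// /scale_ratio /normal_peak /normal_fun subr0.
rewrite [RHS]mulrACA -expRD [RHS]mulrC [LHS]mulrC; congr (expR _ * _).
  exact: scale_exponent.
rewrite (_ : (c * s) ^+ 2 * pi *+ 2 = c ^+ 2 * (s ^+ 2 * pi *+ 2)); last by rewrite exprMn -mulrA mulrnAr.
by rewrite sqrtrM ?sqr_ge0// sqrtr_sqr gtr0_norm// invfM.
Qed.

End normal_scaling.

(** * The proper complex normal law of unit variance *)

Section standard_complex_normal.
Context {R : realType}.

(** Deviation of the real part and of the imaginary part, which share a unit variance equally. *)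
Definition half_dev : R := Num.sqrt 2^-1.

Lemma half_dev_sqr : half_dev ^+ 2 = 2^-1.
Proof. by rewrite sqr_sqrtr// invr_ge0. Qed.

Lemma half_dev_neq0 : half_dev != 0.
Proof. by rewrite gt_eqF// sqrtr_gt0 invr_gt0. Qed.

Local Notation G := (normal_prob 0 half_dev).
Local Notation RT := (measurableTypeR R).

Let mfst : measurable_fun setT (fst : RT * RT -> RT). Proof. exact: measurable_fst. Qed.
Let msnd : measurable_fun setT (snd : RT * RT -> RT). Proof. exact: measurable_snd. Qed.

Lemma measurable_Complex : measurable_fun setT (fun x : RT * RT => Complex x.1 x.2 : R[i]).
Proof. by apply/measurable_fun_complexP; split; [exact: mfst|exact: msnd]. Qed.

Let mlin (u a : R) : measurable_fun setT (fun x : RT => (cos (u * x + a))%:E).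
Proof.
apply/measurable_EFinP; have [] // : bounded_mfun (fun x : RT => cos (u * x + a)).
by apply: bounded_mfun_cos; apply: measurable_funD => //; exact: measurable_funM.
Qed.

Let GGE (A B : set RT) : measurable A -> measurable B -> (G \x G)%E (A `*` B) = (G A * G B)%E.
Proof. exact: product_measure1E. Qed.

Let pairE1 (f : RT -> \bar R) : measurable_fun setT f ->
  (\int[(G \x G)%E]_x f x.1 = \int[G]_x f x)%E.
Proof.
move=> mf; rewrite -(@integral_image_law _ _ _ _ _ (G \x G)%E G fst mfst _ f mf)// => A mA.
rewrite (_ : fst @^-1` A = A `*` setT); last by apply/seteqP; split=> x //= [].
by have := GGE mA measurableT; rewrite [X in (_ * X)%E]probability_setT mule1; exact: esym.
Qed.

Let pairE2 (f : RT -> \bar R) : measurable_fun setT f ->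
  (\int[(G \x G)%E]_x f x.2 = \int[G]_x f x)%E.
Proof.
move=> mf; rewrite -(@integral_image_law _ _ _ _ _ (G \x G)%E G snd msnd _ f mf)// => A mA.
rewrite (_ : snd @^-1` A = setT `*` A); last by apply/seteqP; split=> x //= [].
by have := GGE measurableT mA; rewrite [X in (X * _)%E]probability_setT mul1e; exact: esym.
Qed.

Lemma normal_pair_cos (u v a : R) :
  \int[(G \x G)%E]_x cos (u * x.1 + v * x.2 + a) =
  cos a * expR (- (u ^+ 2 + v ^+ 2) / 4).
Proof.
have m1 : measurable_fun setT (fun x : RT * RT => u * x.1) by apply: measurable_funM.
have m2 : measurable_fun setT (fun x : RT * RT => v * x.2) by apply: measurable_funM.
have ind : independent_pair (G \x G)%E measurable measurable
    (fun x : RT * RT => u * x.1) (fun x : RT * RT => v * x.2).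
  move=> B1 B2 mB1 mB2.
  have mu (t : R) : measurable_fun (setT : set RT) (fun x => t * x : RT) by exact: measurable_funM.
  have mC (t : R) B : measurable B -> measurable ((fun x : RT => t * x : RT) @^-1` B).
    by move=> mB; rewrite -[X in measurable X]setTI; exact: mu.
  rewrite (_ : _ @^-1` B1 = ((fun x : RT => u * x) @^-1` B1) `*` setT); last by apply/seteqP; split=> x //= [].
  rewrite (_ : _ @^-1` B2 = setT `*` ((fun x : RT => v * x) @^-1` B2)); last by apply/seteqP; split=> x //= [].
  rewrite -setXI setIT setTI.
  have e1 := GGE (mC u _ mB1) measurableT; have e2 := GGE measurableT (mC v _ mB2).
  apply: (etrans (GGE (mC u _ mB1) (mC v _ mB2))); apply/esym; congr (_ * _)%E.
    by apply: (etrans e1); rewrite [X in (_ * X)%E](_ : _ = 1%E) ?mule1//; exact: probability_setT.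
  by apply: (etrans e2); rewrite [X in (X * _)%E](_ : _ = 1%E) ?mul1e//; exact: probability_setT.
have E1 b : \int[(G \x G)%E]_x cos (u * x.1 + b) = cos b * expR (- (u ^+ 2 / 4)).
  rewrite /Rintegral (@pairE1 (fun x => (cos (u * x + b))%:E))//.
  rewrite -[LHS]/(\int[G]_x cos (u * x + b)) normal_cos_scale ?half_dev_neq0//.
  by rewrite half_dev_sqr; congr (_ * expR (- _)); field.
have E2 b : \int[(G \x G)%E]_x cos (v * x.2 + b) = cos b * expR (- (v ^+ 2 / 4)).
  rewrite /Rintegral (@pairE2 (fun x => (cos (v * x + b))%:E))//.
  rewrite -[LHS]/(\int[G]_x cos (v * x + b)) normal_cos_scale ?half_dev_neq0//.
  by rewrite half_dev_sqr; congr (_ * expR (- _)); field.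
rewrite (independent_cosD m1 m2 ind E1 E2) -expRD; congr (_ * expR _); by field.
Qed.

Context d (Omega : measurableType d) (P : probability Omega R) (X : Omega -> R[i]).
Hypothesis mX : measurable_fun setT X.
Hypothesis X_cos : forall t a,
  \int[P]_w cos (complex.Re (t * X w) + a) = cos a * expR (- complex.Re (t * conjc t) / 4).

(** The cosine transform of [X] is that of two independent real normal variables, so the complex law
    becomes a product measure, open to Tonelli's theorem. A complex number is viewed as a one-by-one
    block to reuse the uniqueness theorem for blocks. *)
Lemma standard_complex_normal_integral (f : R[i] -> \bar R) : measurable_fun setT f ->
  (\int[P]_w f (X w) = \int[(G \x G)%E]_x f (Complex x.1 x.2))%E.
Proof.
move=> mf; pose one (z : R[i]) : 1.-tuple (1.-tuple R[i]) := [tuple [tuple z | l < 1] | i < 1].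
have oneE z i l : entry (one z) i l = z by rewrite /entry !tnth_mktuple.
have := @block_law_eq R 1 1 _ _ _ _ P (G \x G)%E (fun w => one (X w))
  (fun x : RT * RT => one (Complex x.1 x.2)) _ _ _ (fun y => f (entry y ord0 ord0)).
under eq_integral do rewrite oneE.
rewrite (_ : (fun w : RT * RT => f (entry (one _) _ _)) = fun w : RT * RT => f (Complex w.1 w.2)).
  apply.
- by apply: measurable_to_block => i l; under eq_fun do rewrite oneE.
- by apply: measurable_to_block => i l; under eq_fun do rewrite oneE; exact: measurable_Complex.
- move=> t a; rewrite /block_form.
  have form z : complex.Re (\sum_(i < 1) \sum_(l < 1) t i l * entry (one z) i l) =
      complex.Re (t ord0 ord0 * z) by rewrite !big_ord1 oneE.
  under eq_Rintegral do rewrite form; under [RHS]eq_Rintegral do rewrite form.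
  rewrite X_cos; have := normal_pair_cos (complex.Re (t ord0 ord0)) (- complex.Im (t ord0 ord0)) a.
  rewrite sqrrN -[_ + complex.Im _ ^+ 2](_ : complex.Re (t ord0 ord0 * conjc (t ord0 ord0)) = _); last first.
    by case: (t _ _) => x y /=; ring.
  by move=> <-; apply: eq_Rintegral => x _; rewrite Re_mulc /= mulNr.
- by apply: measurableT_comp => //; exact: measurable_entry.
by apply/funext => w; rewrite oneE.
Qed.

Variable c : R.
Hypothesis c0 : 0 < c.

(** Likelihood ratio of [c * X] to [X] for [X] proper complex normal of unit variance; it is the
    product of the two real ratios. *)
Definition scale_density (z : R[i]) : R :=
  (c ^+ 2)^-1 * expR (Normc.normc z ^+ 2 * (1 - (c ^+ 2)^-1)).

Lemma scale_density_ge0 z : 0 <= scale_density z.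
Proof. by rewrite mulr_ge0 ?expR_ge0// invr_ge0 sqr_ge0. Qed.

Lemma measurable_normc_sqr : measurable_fun setT (fun z : R[i] => Normc.normc z ^+ 2).
Proof.
under eq_fun do rewrite normc_sqr.
by apply: measurable_funD; apply: measurable_funX; [exact: measurable_funRe|exact: measurable_funIm].
Qed.

Lemma measurable_scale_density : measurable_fun setT scale_density.
Proof.
apply: measurable_funM => //; apply: measurableT_comp => //.
by apply: measurable_funM => //; exact: measurable_normc_sqr.
Qed.

Let scale_densityE (x y : R) :
  scale_density (Complex x y) = scale_ratio half_dev c x * scale_ratio half_dev c y.
Proof.
rewrite /scale_density normc_sqr /= /scale_ratio half_dev_sqr -mulr_natr mulVf ?pnatr_eq0//.
by rewrite mulrACA -expRD !divr1 -mulrDl -invfM -expr2.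
Qed.

Lemma complex_normal_scale (f : R[i] -> \bar R) : measurable_fun setT f -> (forall z, 0 <= f z)%E ->
  (\int[P]_w f (c%:C%C * X w)%R = \int[P]_w (f (X w) * (scale_density (X w))%:E))%E.
Proof.
move=> mf f0.
have mcf : measurable_fun setT (fun z : R[i] => f (c%:C%C * z)).
  by apply: measurableT_comp => //; apply: measurable_funMc.
rewrite (standard_complex_normal_integral mcf).
rewrite (@standard_complex_normal_integral (fun z => f z * (scale_density z)%:E)%E); last first.
  by apply: emeasurable_funM => //; apply/measurable_EFinP; exact: measurable_scale_density.
have mCf : measurable_fun setT (fun x : RT * RT => f (Complex x.1 x.2)).
  by apply: measurableT_comp => //; exact: measurable_Complex.
have mr : measurable_fun (setT : set RT) (fun x => (scale_ratio half_dev c x)%:E).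
  by apply/measurable_EFinP; exact: measurable_scale_ratio.
have r0 x : (0 <= (scale_ratio half_dev c x)%:E)%E by rewrite lee_fin scale_ratio_ge0.
have cE (x : RT * RT) : c%:C%C * Complex x.1 x.2 = Complex (c * x.1) (c * x.2).
  by apply: complex_ext => /=; ring.
under eq_integral do rewrite cE.
under [RHS]eq_integral do rewrite scale_densityE EFinM.
have mc1 : measurable_fun setT (fun x : RT * RT => (c * x.1, c * x.2) : RT * RT).
  by apply: measurable_fun_pair; apply: measurable_funM.
rewrite (@fubini_tonelli1 _ _ _ _ _ G G (fun x => f (Complex (c * x.1) (c * x.2))))//; last first.
  exact: measurableT_comp mCf mc1.
rewrite (@fubini_tonelli1 _ _ _ _ _ G G
    (fun x => f (Complex x.1 x.2) * ((scale_ratio half_dev c x.1)%:E * (scale_ratio half_dev c x.2)%:E))%E)//; last 2 first.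
- apply: emeasurable_funM => //; apply: emeasurable_funM.
    exact: measurableT_comp mr mfst.
  exact: measurableT_comp mr msnd.
- by move=> x; rewrite mule_ge0// mule_ge0.
rewrite /fubini_F /=.
have mCx (x : RT) : measurable_fun setT (fun y : RT => f (Complex x y)).
  have mp : measurable_fun setT (fun y : RT => (x, y)) by exact: measurable_fun_pair.
  exact: measurableT_comp mCf mp.
transitivity (\int[G]_x \int[G]_y (f (Complex (c * x)%R y) * (scale_ratio half_dev c y)%:E))%E.
  by apply: eq_integral => x _; exact: (normal_scale_density half_dev_neq0 c0 (mCx (c * x))).
pose g x := (\int[G]_y (f (Complex x y) * (scale_ratio half_dev c y)%:E))%E.
have mg : measurable_fun (setT : set RT) g.
  apply: (@measurable_fun_fubini_tonelli_F _ _ RT RT R G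
    (fun x => f (Complex x.1 x.2) * (scale_ratio half_dev c x.2)%:E)%E) => [|x].
    by apply: emeasurable_funM => //; exact: measurableT_comp mr msnd.
  by rewrite mule_ge0.
apply: (etrans (normal_scale_density half_dev_neq0 c0 mg)).
apply: eq_integral => x _; rewrite /g muleC -ge0_integralZl//; last 2 first.
- by apply: emeasurable_funM.
- by move=> y _; rewrite mule_ge0.
by apply: eq_integral => y _; rewrite muleCA.
Qed.

End standard_complex_normal.

(** * Density of the output given the input *)

Section noise_scaling.
Context d (Omega : measurableType d) (R : realType) (P : probability Omega R) (NT NR : nat).
Variables (H : 'I_NT -> 'I_NR -> int -> {RV P >-> R[i]}).
Variables (W : 'I_NR -> nat -> {RV P >-> R[i]}) (S : 'I_NT -> 'I_NR -> R -> R).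
Hypothesis chan : mimo_channel H W S.
Variable N : nat.
Local Notation block := (N.-tuple (NR.-tuple R[i])).

Definition scale_block (c : 'I_N -> 'I_NR -> R) (y : block) : block :=
  [tuple [tuple (c i l)%:C%C * entry y i l | l < NR] | i < N].

Lemma scale_blockE c y i l : entry (scale_block c y) i l = (c i l)%:C%C * entry y i l.
Proof. by rewrite /entry !tnth_mktuple. Qed.

Lemma measurable_scale_block c : measurable_fun setT (scale_block c).
Proof.
apply: measurable_to_block => i l; under eq_fun do rewrite scale_blockE.
by apply: measurable_funMc; [exact: measurable_cst|exact: measurable_entry].
Qed.

Definition scale_block_density (c : 'I_N -> 'I_NR -> R) (y : block) : R :=
  \prod_(p : 'I_N * 'I_NR) scale_density (c p.1 p.2) (entry y p.1 p.2).

Lemma scale_block_density_ge0 c y : 0 <= scale_block_density c y.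
Proof. by apply: prodr_ge0 => p _; exact: scale_density_ge0. Qed.

Lemma measurable_scale_block_density c : measurable_fun setT (scale_block_density c).
Proof.
apply: measurable_prod => p _; apply: measurableT_comp (measurable_scale_density _) _.
exact: measurable_entry.
Qed.

Let noise (p : 'I_N * 'I_NR) : Omega -> R[i] := W p.2 p.1.+1.

Let noiseE w i l : entry (noise_block W N w) i l = noise (i, l) w.
Proof. by rewrite /entry !tnth_mktuple. Qed.

Let mnoise p : measurable_fun setT (noise p). Proof. exact: measurable_funPT. Qed.

Let inoise : mutually_independent P measurable noise.
Proof.
apply: (mutually_independent_reindex (f := fun p : 'I_N * 'I_NR => (p.2, p.1.+1)) _ _ (noise_independent chan)).
  by move=> [i l] [i' l'] /= [-> /val_inj ->].
exact: measurableT.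
Qed.

Let prodE (h : 'I_N * 'I_NR -> R[i] -> R) :
  (forall p, measurable_fun setT (h p)) -> (forall p x, 0 <= h p x) ->
  (\int[P]_w (\prod_p h p (noise p w))%:E = \prod_p \int[P]_w (h p (noise p w))%:E)%E.
Proof.
by move=> mh h0; apply: mutually_independent_integral_prod => //; exact: index_enum_uniq.
Qed.

Variable c : 'I_N -> 'I_NR -> R.
Hypothesis c0 : forall i l, 0 < c i l.

Let scale1 p (f : R[i] -> R) : measurable_fun setT f -> (forall x, 0 <= f x) ->
  (\int[P]_w (f ((c p.1 p.2)%:C%C * noise p w))%:E =
   \int[P]_w (f (noise p w) * scale_density (c p.1 p.2) (noise p w))%:E)%E.
Proof.
move=> mf f0.
have := @complex_normal_scale R _ _ P (noise p) (mnoise p) (noise_form_cos chan p)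
  (c p.1 p.2) (c0 _ _) (EFin \o f).
by move=> E; apply: E => [|z]; [exact/measurable_EFinP|rewrite lee_fin].
Qed.

Let h w := scale_block_density c (noise_block W N w).

Let hE w : h w = \prod_p scale_density (c p.1 p.2) (noise p w).
Proof. by apply: eq_bigr => p _; rewrite noiseE -surjective_pairing. Qed.

Let mh : measurable_fun setT h.
Proof.
exact: measurableT_comp (measurable_scale_block_density c) (measurable_noise_block W (N := N)).
Qed.

Let h1 : (\int[P]_w (h w)%:E = 1)%E.
Proof.
under eq_integral do rewrite hE.
rewrite (prodE (h := fun p => scale_density (c p.1 p.2))) => [|p|p x]; [|exact: measurable_scale_density|exact: scale_density_ge0].
rewrite big1// => p _; have := @scale1 p (fun=> 1) _ _.
under [in X in _ -> _ -> _ = X]eq_integral do rewrite mul1r.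
by move=> <- //; rewrite integral_cst// mul1e; exact: probability_setT.
Qed.

(** Scalar ratios multiply because the noise entries are independent. The comparison is made on
    boxes, where indicator and density both split over the entries, and the scalar identity settles
    each factor. *)
Lemma noise_block_scale (f : block -> \bar R) :
  measurable_fun setT f -> 
  (\int[P]_w f (scale_block c (noise_block W N w)) =
   \int[P]_w (f (noise_block W N w) * (scale_block_density c (noise_block W N w))%:E))%E.
Proof.
move=> mf.
have mn := measurable_noise_block W (N := N).
have msn := measurableT_comp (measurable_scale_block c) mn.
(* Reweighting [Omega] turns the right-hand side into an integral against the law of the noise block
   under [nu], so that uniqueness of probability laws can be invoked. *)
pose nu : probability Omega R := density_prob mh (fun w => scale_block_density_ge0 c _) h1.
rewrite -(@integral_density _ _ _ P nu h mh (fun w => scale_block_density_ge0 c _) _ (fun w => f (noise_block W N w)))//; last first.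
  exact: measurableT_comp mf mn.
pose Y : {mfun Omega >-> block} := HB.pack (noise_block W N) (isMeasurableFun.Build _ _ _ _ _ mn).
pose Y' : {mfun Omega >-> block} := HB.pack (scale_block c \o noise_block W N)
  (isMeasurableFun.Build _ _ _ _ _ msn).
rewrite -(@integral_image_law _ _ _ _ _ P (distribution P Y') _ msn _ f mf)//.
rewrite -(@integral_image_law _ _ _ _ _ nu (distribution nu Y) _ mn _ f mf)//.
apply: eq_measure_integral => A mA _; move: A mA.
apply: block_box_unique => B mB.
have mI p : measurable_fun setT (\1_(B p.1 p.2) : R[i] -> R) by exact: measurable_indic.
have mc (p : 'I_N * 'I_NR) : measurable_fun setT (fun z : R[i] => (c p.1 p.2)%:C%C * z).
  by apply: measurable_funMc.
have box (g : 'I_N * 'I_NR -> Omega -> R[i]) :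
    \1_[set w | forall i l, B i l (g (i, l) w)] =
    (fun w => \prod_p \1_(B p.1 p.2) (g p w) : R).
  apply/funext => w; rewrite indicE; case: (boolP (w \in _)) => [/set_mem/= Bw|Bw].
    rewrite big1// => -[i l] _; rewrite indicE mem_set//; exact: Bw.
  apply/esym/eqP; rewrite prodf_seq_eq0; apply: contraR Bw => /hasPn Bw.
  apply: mem_set => /= i l; have := Bw (i, l) (mem_index_enum _).
  by rewrite indicE /=; case: (boolP (_ \in _)) => [/set_mem//|]; rewrite eqxx.
have mbox (g : 'I_N * 'I_NR -> Omega -> R[i]) : (forall p, measurable_fun setT (g p)) ->
    measurable [set w | forall i l, B i l (g (i, l) w)].
  move=> mg; rewrite (_ : [set w | _] = \bigcap_(p in [set: 'I_N * 'I_NR]) (g p @^-1` B p.1 p.2)).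
    apply: fin_bigcap_measurable => // -[i l] _.
    by rewrite -[X in measurable X]setTI; exact: mg.
  apply/seteqP; split=> w /=; first by move=> b [i l] _; exact: b.
  by move=> b i l; exact: (b (i, l)).
transitivity (P [set w | forall i l, B i l ((c i l)%:C%C * noise (i, l) w)]).
  congr (P _); apply/seteqP; split=> w /= b i l; have := b i l; by rewrite scale_blockE noiseE.
transitivity (nu [set w | forall i l, B i l (noise (i, l) w)]); last first.
  congr (nu _); apply/seteqP; split=> w /= b i l; have := b i l; by rewrite noiseE.
have mb1 := mbox (fun p w => (c p.1 p.2)%:C%C * noise p w) (fun p => measurableT_comp (mc p) (mnoise p)).
have mb2 := mbox noise mnoise.
rewrite -[LHS](_ : \int[P]_w (\1_[set w | forall i l, B i l ((c i l)%:C%C * noise (i, l) w)] w)%:E = _)%E; last first.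
  by rewrite integral_indic// setIT.
rewrite -[RHS](_ : \int[nu]_w (\1_[set w | forall i l, B i l (noise (i, l) w)] w)%:E = _)%E; last first.
  by rewrite integral_indic// setIT.
rewrite (@integral_density _ _ _ P nu h mh (fun w => scale_block_density_ge0 c _) _ (fun w => (\1_[set w | forall i l, B i l (noise (i, l) w)] w)%:E))//; last first.
  by apply/measurable_EFinP; exact: measurable_indic.
transitivity (\int[P]_w (\prod_p \1_(B p.1 p.2) ((c p.1 p.2)%:C%C * noise p w))%:E)%E.
  apply: eq_integral => w _; congr (_%:E).
  exact: (congr1 (@^~ w) (box (fun p w => (c p.1 p.2)%:C%C * noise p w))).
transitivity (\int[P]_w (\prod_p (\1_(B p.1 p.2) (noise p w) * scale_density (c p.1 p.2) (noise p w)))%:E)%E; last first.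
  apply: eq_integral => w _; rewrite -EFinM big_split /= hE; congr (_ * _)%:E.
  exact: (congr1 (@^~ w) (esym (box noise))).
rewrite (prodE (h := fun p z => \1_(B p.1 p.2) ((c p.1 p.2)%:C%C * z))); last 2 first.
- by move=> p; exact: measurableT_comp (mI p) (mc p).
- by move=> p x; rewrite indicE.
rewrite (prodE (h := fun p z => \1_(B p.1 p.2) z * scale_density (c p.1 p.2) z)); last 2 first.
- by move=> p; apply: measurable_funM; [exact: mI|exact: measurable_scale_density].
- by move=> p x; rewrite mulr_ge0 ?scale_density_ge0// indicE.
apply: eq_bigr => p _; have := @scale1 p (\1_(B p.1 p.2)) (mI p).
by move=> E; apply: E => x; rewrite indicE.
Qed.

End noise_scaling.

Section hermitian_inverse.
Context {R : realType} (n : nat).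
Variables (A U : 'M[R[i]]_n) (lam : 'I_n -> R).
Hypothesis UU : forall a b, \sum_i U a i * conjc (U b i) = (a == b)%:R.
Hypothesis U'U : forall i j, \sum_a conjc (U a i) * U a j = (i == j)%:R.
Hypothesis AE : forall i j, A i j = \sum_a (lam a)%:C%C * (conjc (U a i) * U a j).
Hypothesis lam0 : forall a, 0 < lam a.

Let Us : 'M[R[i]]_n := \matrix_(i, a) conjc (U a i).
Let D (f : 'I_n -> R) : 'M[R[i]]_n := diag_mx (\row_a (f a)%:C%C).

Let UUs : U *m Us = 1%:M.
Proof. by apply/matrixP => a b; rewrite !mxE -UU; apply: eq_bigr => i _; rewrite mxE. Qed.

Let UsU : Us *m U = 1%:M.
Proof. by apply/matrixP => a b; rewrite !mxE -U'U; apply: eq_bigr => i _; rewrite mxE. Qed.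

Let UDU f i j : (Us *m D f *m U) i j = \sum_a (f a)%:C%C * (conjc (U a i) * U a j).
Proof.
rewrite mxE; apply: eq_bigr => a _.
by rewrite mul_mx_diag !mxE [conjc _ * _]mulrC mulrA.
Qed.

Let AUDU : A = Us *m D lam *m U.
Proof. by apply/matrixP => i j; rewrite UDU AE. Qed.

Lemma hermitian_det : \det A = (\prod_a lam a)%:C%C.
Proof.
rewrite AUDU !det_mulmx mulrAC -det_mulmx UsU det1 mul1r det_diag rmorph_prod.
by apply: eq_bigr => a _; rewrite mxE.
Qed.

Let det_gt0 : 0 < \prod_a lam a. Proof. by apply: prodr_gt0 => a _. Qed.

(** The adjugate is the determinant times the inverse, and the inverse has the same eigenvectors
    with inverted eigenvalues. *)
Lemma hermitian_adj i j : (\adj A) i j =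
  (\prod_a lam a)%:C%C * \sum_a ((lam a)^-1)%:C%C * (conjc (U a i) * U a j).
Proof.
have AB : A *m (Us *m D (fun a => (lam a)^-1) *m U) = 1%:M.
  rewrite AUDU -!mulmxA (mulmxA U) UUs mul1mx (mulmxA (D lam)) mulmx_diag.
  rewrite (_ : diag_mx _ = 1%:M) ?mul1mx//.
  apply/matrixP => a b; rewrite !mxE -rmorphM divff; last by rewrite gt_eqF.
  by rewrite rmorph1.
have : \adj A *m A *m (Us *m D (fun a => (lam a)^-1) *m U) = \adj A by rewrite -mulmxA AB mulmx1.
by rewrite mul_adj_mx mul_scalar_mx => <-; rewrite mxE UDU hermitian_det.
Qed.

(** The eigen-coordinates [w] are recovered by applying [U] to [y]; they diagonalise the form, and
    the determinant in the adjugate cancels the denominator. *)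
Lemma hermitian_inverse_form (w : 'I_n -> R[i]) (y : 'I_n -> R[i]) :
  (forall i, y i = \sum_a conjc (U a i) * w a) ->
  complex.Re (\sum_i \sum_j conjc (y i) * (\adj A) i j * y j) / complex.Re (\det A) =
  \sum_a Normc.normc (w a) ^+ 2 / lam a.
Proof.
move=> yE.
have wE a : w a = \sum_i U a i * y i.
  under eq_bigr do rewrite yE mulr_sumr.
  rewrite exchange_big (bigD1 a)//= [X in _ + X]big1 => [|b ba].
    under eq_bigr do rewrite mulrA.
    by rewrite -mulr_suml UU eqxx mul1r addr0.
  under eq_bigr do rewrite mulrA.
  by rewrite -mulr_suml UU eq_sym (negbTE ba) mul0r.
rewrite hermitian_det /= (_ : \sum_i _ = (\prod_a lam a * \sum_a Normc.normc (w a) ^+ 2 / lam a)%:C%C).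
  by rewrite /= mulrAC divff ?mul1r// gt_eqF.
rewrite rmorphM rmorph_sum /= mulr_sumr.
under eq_bigr => i _.
  under eq_bigr => j _.
    rewrite hermitian_adj mulrCA -!mulrA mulrCA mulr_suml mulr_sumr.
    rewrite mulr_sumr.
    over.
  rewrite exchange_big.
  over.
rewrite exchange_big; apply: eq_bigr => a _.
transitivity (\sum_i \sum_j (\prod_a lam a)%:C%C * ((lam a)^-1)%:C%C *
    (conjc (U a i * y i) * (U a j * y j))).
  by apply: eq_bigr => i _; apply: eq_bigr => j _; rewrite conjcM; ring.
have dl (s : R[i]) (F : 'I_n -> R[i]) : \sum_i s * F i = s * \sum_i F i by rewrite mulr_sumr.
under [LHS]eq_bigr => i _ do rewrite !dl.
rewrite dl -mulr_suml -wE.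
have -> : \sum_i conjc (U a i * y i) = conjc (w a) by rewrite wE rmorph_sum.
by rewrite [in RHS]rmorphM /= normc_sqr_conj; ring.
Qed.

End hermitian_inverse.

Section measurable_matrices.
Context d (T : measurableType d) (R : realType).

Lemma measurable_fun_bigsumc (I : Type) (s : seq I) (f : I -> T -> R[i]) :
  (forall i, measurable_fun setT (f i)) ->
  measurable_fun setT (fun x => \sum_(i <- s) f i x).
Proof.
move=> mf; elim: s => [|i s IHs]; first by under eq_fun do rewrite big_nil; exact: measurable_cst.
by under eq_fun do rewrite big_cons; apply: measurable_funDc.
Qed.

Lemma measurable_fun_bigprodc (I : Type) (s : seq I) (f : I -> T -> R[i]) :
  (forall i, measurable_fun setT (f i)) ->
  measurable_fun setT (fun x => \prod_(i <- s) f i x).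
Proof.
move=> mf; elim: s => [|i s IHs]; first by under eq_fun do rewrite big_nil; exact: measurable_cst.
by under eq_fun do rewrite big_cons; apply: measurable_funMc.
Qed.

Lemma measurable_conjc (f : T -> R[i]) : measurable_fun setT f ->
  measurable_fun setT (fun x => conjc (f x)).
Proof.
move=> /measurable_fun_complexP[mr mi]; apply/measurable_fun_complexP; split.
  by rewrite (_ : _ \o _ = @complex.Re R \o f)//; apply/funext => x; rewrite /= Re_conjc.
rewrite (_ : _ \o _ = \- (@complex.Im R \o f)); first exact: measurableT_comp.
by apply/funext => x; rewrite /= Im_conjc.
Qed.

Lemma measurable_det n (A : T -> 'M[R[i]]_n) :
  (forall i j, measurable_fun setT (fun x => A x i j)) ->
  measurable_fun setT (fun x => \det (A x)).
Proof.
move=> mA; apply: measurable_fun_bigsumc => s.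
by apply: measurable_funMc; [exact: measurable_cst|exact: measurable_fun_bigprodc].
Qed.

Lemma measurable_adj n (A : T -> 'M[R[i]]_n) i j :
  (forall i j, measurable_fun setT (fun x => A x i j)) ->
  measurable_fun setT (fun x => (\adj (A x)) i j).
Proof.
move=> mA; under eq_fun do rewrite mxE.
apply: measurable_funMc; first exact: measurable_cst.
by apply: measurable_det => i' j'; under eq_fun do rewrite !mxE; exact: mA.
Qed.

End measurable_matrices.

Section channel_density.
Context d (Omega : measurableType d) (R : realType) (P : probability Omega R) (NT NR : nat).
Variables (H : 'I_NT -> 'I_NR -> int -> {RV P >-> R[i]}).
Variables (W : 'I_NR -> nat -> {RV P >-> R[i]}) (S : 'I_NT -> 'I_NR -> R -> R) (rho : R).
Hypothesis chan : mimo_channel H W S.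
Hypothesis rho0 : 0 < rho.
Variable N : nat.
Local Notation block := (N.-tuple (NR.-tuple R[i])).
Local Notation input := (N.-tuple (NT.-tuple R[i])).

Definition rotate_block (U : 'I_NR -> 'M[R[i]]_N) (y : block) : block :=
  [tuple [tuple \sum_a conjc (U l a i) * entry y a l | l < NR] | i < N].

Lemma rotate_blockE U y i l :
  entry (rotate_block U y) i l = \sum_a conjc (U l a i) * entry y a l.
Proof. by rewrite /entry !tnth_mktuple. Qed.

Lemma measurable_rotate_block U : measurable_fun setT (rotate_block U).
Proof.
apply: measurable_to_block => i l; under eq_fun do rewrite rotate_blockE.
apply: measurable_fun_sumc => a.
by apply: measurable_funMc; [exact: measurable_cst|exact: measurable_entry].
Qed.

Lemma block_form_rotate t U y : block_form t (rotate_block U y) =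
  block_form (fun a l => \sum_i t i l * conjc (U l a i)) y.
Proof.
rewrite /block_form; congr complex.Re; rewrite exchange_big [RHS]exchange_big.
apply: eq_bigr => l _ /=.
under eq_bigr do rewrite rotate_blockE mulr_sumr.
rewrite exchange_big; apply: eq_bigr => a _ /=; rewrite mulr_suml.
by apply: eq_bigr => i _; rewrite mulrA.
Qed.

Lemma block_form_scale t c (y : block) : block_form t (scale_block c y) =
  block_form (fun a l => t a l * (c a l)%:C%C) y.
Proof.
rewrite /block_form; congr complex.Re; apply: eq_bigr => i _; apply: eq_bigr => l _.
by rewrite scale_blockE mulrA.
Qed.

Definition log_det (z : input) (l : 'I_NR) : R := ln (complex.Re (\det (channel_cov H rho z l))).

(* For a positive determinant, [y^* A^-1 y] with the inverse written through the
   adjugate, so that measurability in [z] is visible. *)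
Definition inverse_form (z : input) (l : 'I_NR) (y : block) : R :=
  complex.Re (\sum_i \sum_j conjc (entry y i l) * (\adj (channel_cov H rho z l)) i j * entry y j l) *
  expR (- log_det z l).

(** Logarithm of a quotient of complex normal densities, with covariance [channel_cov] at each
    antenna over identity covariance. The squared norms come from dividing by the noise density, and
    the powers of [pi] cancel. *)
Definition log_output_density (z : input) (y : block) : R :=
  \sum_(l < NR) (\sum_(i < N) Normc.normc (entry y i l) ^+ 2 - log_det z l - inverse_form z l y).

Section measurability.
Context d' (T : measurableType d') (Z : T -> input) (Y : T -> block).
Hypothesis mZ : measurable_fun setT Z.
Hypothesis mY : measurable_fun setT Y.

Let mY' i l : measurable_fun setT (fun x => entry (Y x) i l).
Proof. exact: measurableT_comp (measurable_entry i l) mY. Qed.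

Lemma measurable_channel_cov l i j : measurable_fun setT (fun x => channel_cov H rho (Z x) l i j).
Proof.
under eq_fun do rewrite mxE; apply: measurable_funDc; first exact: measurable_cst.
have mZ' i' k : measurable_fun setT (fun x => entry (Z x) i' k).
  exact: measurableT_comp (measurable_entry i' k) mZ.
apply: measurable_fun_sumc => k; apply: measurable_funMc; last exact: measurable_cst.
apply: measurable_funMc; first exact: measurable_cst.
by apply: measurable_funMc => //; exact: measurable_conjc.
Qed.

Let mRe (f : T -> R[i]) : measurable_fun setT f -> measurable_fun setT (fun x => complex.Re (f x)).
Proof. exact: measurableT_comp measurable_funRe. Qed.

Let mdet l : measurable_fun setT (fun x => complex.Re (\det (channel_cov H rho (Z x) l))).
Proof. by apply: mRe; apply: measurable_det => i j; exact: measurable_channel_cov. Qed.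

Lemma measurable_log_det l : measurable_fun setT (fun x => log_det (Z x) l).
Proof. exact: measurableT_comp (@measurable_ln R) (mdet l). Qed.

Lemma measurable_inverse_form l : measurable_fun setT (fun x => inverse_form (Z x) l (Y x)).
Proof.
apply: measurable_funM; last first.
  by apply: measurableT_comp => //; apply: measurableT_comp => //; exact: measurable_log_det.
apply: mRe; apply: measurable_fun_sumc => i; apply: measurable_fun_sumc => j.
apply: measurable_funMc => //; apply: measurable_funMc; first exact: measurable_conjc.
by apply: measurable_adj => i' j'; exact: measurable_channel_cov.
Qed.

Lemma measurable_log_output_density :
  measurable_fun setT (fun x => log_output_density (Z x) (Y x)).
Proof.
apply: measurable_sum => l; apply: measurable_funB; last exact: measurable_inverse_form.
apply: measurable_funB; last exact: measurable_log_det.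
by apply: measurable_sum => i; exact: measurableT_comp measurable_normc_sqr (mY' i l).
Qed.

End measurability.

Section one_input.
Variables (z : input) (U : 'I_NR -> 'M[R[i]]_N) (lam : 'I_NR -> 'I_N -> R).
Hypothesis UU : forall l a b, \sum_i U l a i * conjc (U l b i) = (a == b)%:R.
Hypothesis U'U : forall l i j, \sum_a conjc (U l a i) * U l a j = (i == j)%:R.
Hypothesis AE : forall l i j,
  channel_cov H rho z l i j = \sum_a (lam l a)%:C%C * (conjc (U l a i) * U l a j).
Hypothesis lam1 : forall l a, 1 <= lam l a.

Let c a l := Num.sqrt (lam l a).

Let lam0 l a : 0 < lam l a. Proof. exact: lt_le_trans (lam1 l a). Qed.

Let c0 a l : 0 < c a l. Proof. by rewrite sqrtr_gt0. Qed.

Let csqr a l : c a l ^+ 2 = lam l a. Proof. by rewrite sqr_sqrtr// ltW. Qed.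

(** Noise scaled by the square roots of [lam] and then rotated has the covariance given by [AE],
    that is [channel_cov]. Equal covariances give equal cosine transforms, hence equal laws. *)
Lemma channel_output_rotate (f : block -> \bar R) : measurable_fun setT f ->
  (\int[P]_w f (channel_output H W rho (z, w)) =
   \int[P]_w f (rotate_block U (scale_block c (noise_block W N w))))%E.
Proof.
apply: block_law_eq => [||t a].
- exact: measurable_channel_section.
- apply: measurableT_comp (measurable_rotate_block U) _.
  exact: measurableT_comp (measurable_scale_block c) (measurable_noise_block W (N := N)).
- rewrite (channel_output_cos chan rho0).
  under [RHS]eq_Rintegral do rewrite block_form_rotate block_form_scale.
  apply: etrans; last exact: esym (noise_block_cos chan _ a).
  apply: (congr1 (fun u => cos a * expR (- u / 4))).
  rewrite [RHS]exchange_big; apply: eq_bigr => l _ /=.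
  under eq_bigr do rewrite -Re_sumc.
  rewrite -!Re_sumc; congr complex.Re.
  transitivity (\sum_i \sum_j \sum_b (lam l b)%:C%C * ((t i l * conjc (U l b i)) * conjc (t j l * conjc (U l b j)))).
    apply: eq_bigr => i _; apply: eq_bigr => j _; rewrite AE mulr_sumr.
    by apply: eq_bigr => b _; rewrite conjcM conjcK; ring.
  under eq_bigr do rewrite exchange_big /=.
  rewrite exchange_big; apply: eq_bigr => b _ /=.
  have dl (s : R[i]) (F : 'I_N -> R[i]) : \sum_i s * F i = s * \sum_i F i by rewrite mulr_sumr.
  under eq_bigr => i _ do rewrite !dl.
  rewrite dl -mulr_suml conjcM conjc_real -csqr rmorphXn /=.
  rewrite [X in _ * (_ * X)](_ : _ = conjc (\sum_i t i l * conjc (U l b i))); last by rewrite rmorph_sum.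
  by ring.
Qed.

(** Unitary matrices preserve the squared norm of the coefficients, on which alone the exponent of
    the noise transform depends. *)
Lemma noise_block_rotate (f : block -> \bar R) : measurable_fun setT f ->
  (\int[P]_w f (rotate_block U (noise_block W N w)) =
   \int[P]_w f (noise_block W N w))%E.
Proof.
apply: block_law_eq => [||t a].
- exact: measurableT_comp (measurable_rotate_block U) (measurable_noise_block W (N := N)).
- exact: measurable_noise_block.
- under eq_Rintegral do rewrite block_form_rotate.
  apply: (etrans (noise_block_cos chan _ a)).
  apply: etrans; last exact: esym (noise_block_cos chan _ a).
  apply: (congr1 (fun u => cos a * expR (- u / 4))).
  rewrite exchange_big [RHS]exchange_big; apply: eq_bigr => l _ /=.
  rewrite -!Re_sumc; congr complex.Re.
  have E (x : R[i]) : x * conjc x = (Normc.normc x ^+ 2)%:C%C by rewrite normc_sqr_conj.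
  under eq_bigr do rewrite E; under [RHS]eq_bigr do rewrite E.
  rewrite -!rmorph_sum; congr (_%:C%C).
  rewrite -(unitary_sum_sqr (U := \matrix_(a, i) conjc (U l a i)) (fun i => t i l)).
    by apply: eq_bigr => b _; congr (Normc.normc _ ^+ 2); apply: eq_bigr => i _; rewrite mxE mulrC.
  move=> i j; rewrite -[RHS](rmorph_nat (@conjc R)) -(U'U l) rmorph_sum.
  by apply: eq_bigr => b _; rewrite -[RHS]/(conjc _) conjcM !mxE.
Qed.

Let detE l : \det (channel_cov H rho z l) = (\prod_a lam l a)%:C%C.
Proof. exact: hermitian_det (U'U l) (AE l). Qed.

Lemma log_detE l : log_det z l = \sum_a ln (lam l a).
Proof.
rewrite /log_det detE /=.
have : \prod_a lam l a = expR (\sum_a ln (lam l a)).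
  by rewrite expR_sum; apply: eq_bigr => a _; rewrite lnK ?posrE.
by move=> ->; rewrite expRK.
Qed.

Lemma det_channel_cov_gt0 l : 0 < complex.Re (\det (channel_cov H rho z l)).
Proof. by rewrite detE; apply: prodr_gt0 => a _. Qed.

Lemma inverse_form_rotate l (w : block) :
  inverse_form z l (rotate_block U w) = \sum_a Normc.normc (entry w a l) ^+ 2 / lam l a.
Proof.
rewrite /inverse_form expRN lnK ?posrE; last exact: det_channel_cov_gt0.
apply: (hermitian_inverse_form (UU l) (U'U l) (AE l) (lam0 l)) => i.
by rewrite rotate_blockE.
Qed.

Lemma norm_sqr_rotate l (w : block) :
  \sum_i Normc.normc (entry (rotate_block U w) i l) ^+ 2 = \sum_a Normc.normc (entry w a l) ^+ 2.
Proof.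
rewrite -(unitary_sum_sqr (U := \matrix_(i, a) conjc (U l a i)) (fun a => entry w a l)).
  apply: eq_bigr => i _; rewrite rotate_blockE; congr (Normc.normc _ ^+ 2).
  by apply: eq_bigr => a _; rewrite mxE.
move=> a b; rewrite -(UU l); apply: eq_bigr => i _; rewrite !mxE; congr (_ * _); exact: conjcK.
Qed.

(** In eigen-coordinates the squared norm is unchanged, the determinant is the product of the [lam],
    and the inverse form is diagonal, so the exponential splits into the scalar ratios of the
    scaling. *)
Lemma log_output_density_rotate (w : block) :
  expR (log_output_density z (rotate_block U w)) = scale_block_density c w.
Proof.
rewrite /scale_block_density expR_sum.
rewrite -(pair_big xpredT xpredT (fun a l => scale_density (c a l) (entry w a l))) /=.
rewrite exchange_big; apply: eq_bigr => l _ /=.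
rewrite norm_sqr_rotate inverse_form_rotate big_split /= -expR_sum addrAC expRD mulrC.
congr (_ * expR _).
  rewrite expRN lnK ?posrE; last exact: det_channel_cov_gt0.
  by rewrite detE /= -prodfV; apply: eq_bigr => a _; rewrite csqr.
by rewrite -sumrB; apply: eq_bigr => a _; rewrite csqr; ring.
Qed.

(** The scaling is traded for its density, that density is expressed through the rotated noise, and
    the rotation is then dropped by invariance of the noise law. *)
Lemma channel_output_density (f : block -> \bar R) : measurable_fun setT f ->
  measurable_fun setT (log_output_density z) ->
  (\int[P]_w f (channel_output H W rho (z, w)) =
   \int[P]_w (f (noise_block W N w) * (expR (log_output_density z (noise_block W N w)))%:E))%E.
Proof.
move=> mf mg; rewrite channel_output_rotate//.
have mr := measurable_rotate_block U.
rewrite (noise_block_scale chan c0 (f := f \o rotate_block U)); last exact: measurableT_comp mf mr.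
under eq_integral do rewrite -log_output_density_rotate.
apply: (noise_block_rotate (f := fun y => (f y * (expR (log_output_density z y))%:E)%E)).
by apply: emeasurable_funM => //; apply/measurable_EFinP; exact: measurableT_comp.
Qed.

(** The eigenvalues cancel against the scaling, leaving [N] squared noise moduli of mean 1. *)
Lemma integral_inverse_form l : measurable_fun setT (inverse_form z l) ->
  (\int[P]_w (inverse_form z l (channel_output H W rho (z, w)))%:E = N%:R%:E)%E.
Proof.
move=> mi; rewrite (channel_output_rotate (f := EFin \o inverse_form z l)); last exact/measurable_EFinP.
transitivity (\int[P]_w (\sum_(a < N) (Normc.normc (W l a.+1 w) ^+ 2)%:E))%E.
  apply: eq_integral => w _; rewrite /= inverse_form_rotate sumEFin; congr EFin.
  apply: eq_bigr => a _; rewrite scale_blockE Normc.normcM exprMn.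
  rewrite (_ : Normc.normc _ = c a l); last by rewrite /= expr0n addr0 sqrtr_sqr ger0_norm// ltW.
  by rewrite csqr mulrAC divff ?mul1r ?gt_eqF// /entry !tnth_mktuple.
rewrite ge0_integral_sum//; last 2 first.
- move=> a; apply/measurable_EFinP; apply: measurableT_comp measurable_normc_sqr _.
  exact: measurable_funPT.
- by move=> a w _; rewrite lee_fin sqr_ge0.
transitivity (\sum_(a < N) (1%:E : \bar R))%E.
  by apply: eq_bigr => a _; have := noise_unit_variance chan l a.+1; rewrite unlock.
by rewrite sumEFin sumr_const card_ord.
Qed.

End one_input.
End channel_density.

(** * Moments and bounds for a fixed input *)

Section per_input.
Context d (Omega : measurableType d) (R : realType) (P : probability Omega R) (NT NR : nat).
Variables (H : 'I_NT -> 'I_NR -> int -> {RV P >-> R[i]}).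
Variables (W : 'I_NR -> nat -> {RV P >-> R[i]}) (S : 'I_NT -> 'I_NR -> R -> R) (rho : R).
Hypothesis chan : mimo_channel H W S.
Hypothesis rho0 : 0 < rho.
Variable N : nat.
Local Notation block := (N.-tuple (NR.-tuple R[i])).
Local Notation input := (N.-tuple (NT.-tuple R[i])).
Local Notation Y z w := (channel_output H W rho (z, w) : block).

Definition fading_power k l : R := complex.Re (autocorrelation P (H k l) 0).

Definition symbol_power (z : input) (i : 'I_N) (k : 'I_NT) : R := Normc.normc (entry z i k) ^+ 2.

Definition output_power (z : input) (i : 'I_N) (l : 'I_NR) : R :=
  1 + rho * \sum_k fading_power k l * symbol_power z i k.

Let spec l (k : 'I_NT) := fading_spectral_density chan k l.

Lemma fading_power_ge0 k l : 0 <= fading_power k l.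
Proof.
rewrite /fading_power (spectral_autocorrelation (spec l k)) /=.
apply: Rintegral_ge0 => t Dt; rewrite mulr0z !mul0r cos0 mulr1 subr0.
by rewrite divr_ge0 ?mulr_ge0 ?pi_ge0//; apply: spectral_ge0 (spec l k) _ _; rewrite inE.
Qed.

Lemma output_power_ge1 z i l : 1 <= output_power z i l.
Proof.
rewrite lerDl mulr_ge0 ?(ltW rho0)//; apply: sumr_ge0 => k _.
by rewrite mulr_ge0 ?fading_power_ge0// sqr_ge0.
Qed.

Lemma channel_diagonalization (z : input) :
  exists (U : 'I_NR -> 'M[R[i]]_N) (lam : 'I_NR -> 'I_N -> R),
  [/\ forall l a b, \sum_i U l a i * conjc (U l b i) = (a == b)%:R,
      forall l i j, \sum_a conjc (U l a i) * U l a j = (i == j)%:R,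
      forall l i j, channel_cov H rho z l i j =
        \sum_a (lam l a)%:C%C * (conjc (U l a i) * U l a j) &
      forall l a, 1 <= lam l a].
Proof.
have h l : exists Ulam : 'M[R[i]]_N * ('I_N -> R),
  [/\ forall a b, \sum_i Ulam.1 a i * conjc (Ulam.1 b i) = (a == b)%:R,
      forall i j, \sum_a conjc (Ulam.1 a i) * Ulam.1 a j = (i == j)%:R,
      forall i j, channel_cov H rho z l i j =
        \sum_a (Ulam.2 a)%:C%C * (conjc (Ulam.1 a i) * Ulam.1 a j) &
      forall a, 1 <= Ulam.2 a].
  have [U [lam [UU U'U AE]]] := hermitian_diagonalization
    (toeplitz_mix_hermitian (fun i k => entry z i k) rho (spec l)).
  exists (U, lam); split=> //.
  by have [] := toeplitz_mix_log_det (spec l) rho0 UU U'U AE.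
have [f fE] := choice h.
by exists (fun l => (f l).1), (fun l => (f l).2); split=> l; have [] := fE l.
Qed.

Lemma channel_cov_diag (z : input) i l :
  channel_cov H rho z l i i = (output_power z i l)%:C%C.
Proof.
apply: complex_ext.
  rewrite mxE eqxx subrr Re_addc Re_sumc /= /output_power mulr_sumr; congr (_ + _).
  apply: eq_bigr => k _; rewrite /symbol_power -normc_sqr_conj -rmorphM Re_mulc [complex.Re _%:C%C]/= [complex.Im _%:C%C]/= mul0r subr0.
  by rewrite /fading_power; ring.
have := toeplitz_mix_hermitian (fun i k => entry z i k) rho (spec l) i i.
rewrite -[toeplitz_mix _ _ _]/(channel_cov H rho z l) => /(congr1 (@complex.Im R)).
rewrite Im_conjc /=; set x := complex.Im _ => x0.
by lra.
Qed.

Lemma log_det_ge0 (z : input) l : 0 <= log_det H rho z l.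
Proof.
have [U [lam [UU U'U AE lam1]]] := channel_diagonalization z.
by rewrite (log_detE U'U AE lam1); apply: sumr_ge0 => a _; rewrite ln_ge0.
Qed.

(** From [ln lam <= lam - 1] and the trace. Its purpose is integrability: the log-determinant is
    dominated by a function linear in the symbol powers. *)
Lemma log_det_le (z : input) l : log_det H rho z l <= \sum_i (output_power z i l - 1).
Proof.
have [U [lam [UU U'U AE lam1]]] := channel_diagonalization z.
rewrite (log_detE U'U AE lam1).
have -> : \sum_i (output_power z i l - 1) = \sum_a (lam l a - 1).
  rewrite !sumrB; congr (_ - _).
  apply: (@complexI R); rewrite !rmorph_sum /=.
  under eq_bigr do rewrite -channel_cov_diag AE.
  rewrite exchange_big; apply: eq_bigr => a _; rewrite -mulr_sumr.
  under eq_bigr do rewrite mulrC.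
  by rewrite UU eqxx mulr1.
apply: ler_sum => a _; have := @le_ln1Dx R (lam l a - 1); rewrite addrCA subrr addr0; apply.
by have := lam1 l a; lra.
Qed.

Lemma log_det_info_rate (z : input) l : (forall i, sqnorm (tnth z i) <= 1) ->
  \sum_k (\sum_i symbol_power z i k) * info_rate rho (S k l) <= log_det H rho z l.
Proof.
move=> z1; have [U [lam [UU U'U AE lam1]]] := channel_diagonalization z.
rewrite (log_detE U'U AE lam1).
by have [_] := toeplitz_mix_log_det (spec l) rho0 (UU l) (U'U l) (AE l); apply.
Qed.

(** The rotation is onto, so the diagonal formula for rotated blocks reaches every [y]. *)
Lemma inverse_form_ge0 (z : input) l y : 0 <= inverse_form H rho z l y.
Proof.
have [U [lam [UU U'U AE lam1]]] := channel_diagonalization z.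
pose w : block := [tuple [tuple \sum_i U l a i * entry y i l | l < NR] | a < N].
have -> : y = rotate_block U w.
  apply: eq_from_tnth => i; apply: eq_from_tnth => k.
  rewrite -[LHS]/(entry y i k) -[RHS]/(entry _ i k) rotate_blockE.
  under eq_bigr do rewrite /entry !tnth_mktuple mulr_sumr.
  rewrite exchange_big (bigD1 i)//= [X in _ + X]big1 => [|j ji].
    under eq_bigr do rewrite mulrA.
    by rewrite -mulr_suml U'U eqxx mul1r addr0.
  under eq_bigr do rewrite mulrA.
  by rewrite -mulr_suml U'U eq_sym (negbTE ji) mul0r.
rewrite (inverse_form_rotate UU U'U AE lam1); apply: sumr_ge0 => a _.
by rewrite divr_ge0 ?sqr_ge0// (le_trans ler01).
Qed.

Lemma output_law_density (z : input) (f : block -> \bar R) : measurable_fun setT f ->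
  (\int[P]_w f (Y z w) = \int[P]_w (f (noise_block W N w) *
     (expR (log_output_density H rho z (noise_block W N w)))%:E))%E.
Proof.
move=> mf; have [U [lam [UU U'U AE lam1]]] := channel_diagonalization z.
apply: (channel_output_density chan rho0 UU U'U AE lam1) => //.
exact: (measurable_log_output_density H rho (measurable_cst z) (@measurable_id _ _ _)).
Qed.

Lemma integral_output_inverse_form (z : input) l :
  (\int[P]_w (inverse_form H rho z l (Y z w))%:E = N%:R%:E)%E.
Proof.
have [U [lam [UU U'U AE lam1]]] := channel_diagonalization z.
apply: (integral_inverse_form chan rho0 UU U'U AE lam1).
exact: (measurable_inverse_form H rho (measurable_cst z) (@measurable_id _ _ _)).
Qed.

(** Divided by its deviation [s], an output entry has the cosine transform of a unit noise entry, so
    the second moment of the quotient is that of the noise, namely 1. *)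
Lemma integral_output_power (z : input) i l :
  (\int[P]_w (Normc.normc (entry (Y z w) i l) ^+ 2)%:E = (output_power z i l)%:E)%E.
Proof.
pose s := Num.sqrt (output_power z i l).
have op0 : 0 < output_power z i l by rewrite (lt_le_trans ltr01)// output_power_ge1.
have s0 : 0 < s by rewrite sqrtr_gt0.
pose X w : R[i] := (s^-1)%:C%C * entry (Y z w) i l.
have mYil : measurable_fun setT (fun w => entry (Y z w) i l).
  exact: measurableT_comp (measurable_entry i l) (measurable_channel_section H W rho z).
have mX : measurable_fun setT X by apply: measurable_funMc.
have Xcos (t : R[i]) a : \int[P]_w cos (complex.Re (t * X w) + a) =
    cos a * expR (- complex.Re (t * conjc t) / 4).
  (* Coefficients supported at one position extract the marginal law of an entry from the transform
     of the whole block. *)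
  pose t' i' l' : R[i] := if (i' == i) && (l' == l) then t * (s^-1)%:C%C else 0.
  have := channel_output_cos chan rho0 t' z a.
  have formE w : block_form t' (Y z w) = complex.Re (t * X w).
    congr complex.Re; rewrite (bigD1 i)//= (bigD1 l)//= /t' !eqxx /= !big1 ?addr0 ?mulrA//.
      by move=> j /negbTE ->; rewrite big1// => l' _; rewrite mul0r.
    by move=> l' /negbTE ->; rewrite mul0r.
  under eq_Rintegral do rewrite formE.
  move=> ->; apply: (congr1 (fun u => cos a * expR (- u / 4))).
  have tl i' l' : l' != l -> t' i' l' = 0 by rewrite /t' => /negbTE ->; rewrite andbF.
  have ti i' : i' != i -> t' i' l = 0 by rewrite /t' => /negbTE ->.
  have til : t' i l = t * (s^-1)%:C%C by rewrite /t' !eqxx.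
  have tc j' : j' != i -> conjc (t' j' l) = 0.
    by move=> h; rewrite ti//; apply: complex_ext; rewrite /= ?oppr0.
  rewrite (bigD1 l)//= [X in _ + X]big1 ?addr0 => [|l' ll']; last first.
    by rewrite big1// => i' _; rewrite big1// => j' _; rewrite tl// !mul0r.
  rewrite (bigD1 i)//= [X in _ + X]big1 ?addr0 => [|i' ii']; last first.
    by rewrite big1// => j' _; rewrite ti// !mul0r.
  rewrite (bigD1 i)//= [X in _ + X]big1 ?addr0 => [|j' ij']; last first.
    by rewrite tc// mulr0 mul0r.
  rewrite til.
  have ss : (s^-1)%:C%C * (s^-1)%:C%C * (output_power z i l)%:C%C = 1 :> R[i].
    rewrite -!rmorphM /= -expr2 exprVn sqr_sqrtr ?(ltW op0)// mulVf ?rmorph1//.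
    by rewrite gt_eqF.
  rewrite channel_cov_diag conjcM conjc_real -[in RHS](mulr1 (t * _)) -ss; congr complex.Re.
  by ring.
have E := standard_complex_normal_integral mX Xcos.
have E' := standard_complex_normal_integral (measurable_funPT (W l i.+1)) (noise_form_cos chan (i, l)).
have mn : measurable_fun setT (fun x : R[i] => (Normc.normc x ^+ 2)%:E).
  by apply/measurable_EFinP; exact: measurable_normc_sqr.
have X1 : (\int[P]_w (Normc.normc (X w) ^+ 2)%:E = 1)%E.
  by rewrite (E _ mn) -(E' _ mn); have := noise_unit_variance chan l i.+1; rewrite unlock.
transitivity (\int[P]_w ((output_power z i l)%:E * (Normc.normc (X w) ^+ 2)%:E))%E.
  apply: eq_integral => w _; rewrite -EFinM Normc.normcM exprMn; congr EFin.
  rewrite [Normc.normc _%:C%C ^+ 2]normc_sqr [complex.Re _%:C%C]/= [complex.Im _%:C%C]/=.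
  by rewrite expr0n addr0 exprVn sqr_sqrtr ?(ltW op0)// mulrA divff ?mul1r// gt_eqF.
rewrite ge0_integralZl//; last 3 first.
- exact: measurableT_comp mn mX.
- by move=> w _; rewrite lee_fin sqr_ge0.
- by rewrite lee_fin ltW.
by rewrite X1 mule1.
Qed.

End per_input.

(** * Mutual information and relative densities *)

Section divergence.
Local Open Scope ereal_scope.
Local Open Scope charge_scope.
Context d (T : measurableType d) (R : realType) (J M : probability T R).
Variable h : T -> R.
Hypothesis mh : measurable_fun setT h.
Hypothesis JE : forall A, measurable A -> J A = \int[M]_(x in A) (h x)%:E.

Let JM : J `<< M.
Proof.
apply/null_content_dominatesP => A mA MA; rewrite JE// null_set_integral//.
by apply: measurable_funTS; exact/measurable_EFinP.
Qed.

(** The Radon-Nikodym derivative agrees with [h] outside an [M]-null set; domination makes that set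
    null for [J], the measure of integration. *)
Lemma KL_density : KL J M = \int[J]_x (ln (h x))%:E.
Proof.
rewrite /KL asboolT//.
have e : ae_eq M setT ('d (charge_of_finite_measure J) '/d M) (EFin \o h).
  apply: integral_ae_eq => //; [exact: Radon_Nikodym_integrable|exact/measurable_EFinP|].
  by move=> E _ mE; rewrite -Radon_Nikodym_integral//; exact: JE.
apply: ae_eq_integral => //.
- apply/measurable_EFinP; apply: measurableT_comp; first exact: measurable_ln.
  by apply: measurableT_comp => //; apply: measurable_int; exact: Radon_Nikodym_integrable.
- by apply/measurable_EFinP; apply: measurableT_comp => //; exact: measurable_ln.
- have := null_dominates_ae_eq measurableT JM e.
  by apply: filterS => x /= /(_ I) ->.
Qed.

(** Meant for [f] the log-density of the joint law, of which no integrability is known beforehand;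
    positive and negative parts are compared separately. *)
Lemma integral_le_integrable (f g : T -> \bar R) : measurable_fun setT f ->
  J.-integrable setT g -> (forall x, f x <= g x) -> \int[J]_x f x <= \int[J]_x g x.
Proof.
move=> mf ig fg; have mg := measurable_int _ ig.
rewrite integralE [leRHS]integralE; apply: leeB; apply: ge0_le_integral => //.
- exact: measurable_funepos.
- exact: measurable_funepos.
- by move=> x _; rewrite !funeposE ge_max !le_max fg lexx orbT.
- exact: measurable_funeneg.
- exact: measurable_funeneg.
- by move=> x _; rewrite !funenegE ge_max !le_max leeN2 fg lexx orbT.
Qed.

Lemma KL_le (L e : T -> R) : J.-integrable setT (EFin \o L) ->
  J.-integrable setT (EFin \o e) -> \int[J]_x (e x)%:E <= 0 ->
  (forall x, ln (h x) <= L x + e x)%R -> KL J M <= \int[J]_x (L x)%:E.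
Proof.
move=> iL ie e0 hLe; rewrite KL_density.
apply: (@le_trans _ _ (\int[J]_x ((L x)%:E + (e x)%:E))).
  apply: integral_le_integrable => [||x].
  - by apply/measurable_EFinP; apply: measurableT_comp => //; exact: measurable_ln.
  - exact: integrableD.
  - by rewrite -EFinD lee_fin.
by rewrite (integralD measurableT iL ie) geeDl.
Qed.

End divergence.

(** * Mutual information against a reference output law *)

Section mutual_information_bound.
Local Open Scope ereal_scope.
Context d1 (T1 : measurableType d1) d2 (T2 : measurableType d2) d (Omega : measurableType d).
Context (R : realType) (mu : probability T1 R) (P : probability Omega R).
Variables (X : {RV (mu \x P) >-> T1}) (Y : {RV (mu \x P) >-> T2}) (V : Omega -> T2).
Hypothesis XE : forall zw, X zw = zw.1.
Hypothesis mV : measurable_fun setT V.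
Variable lg : T1 * T2 -> R.
Hypothesis mlg : measurable_fun setT lg.
Let g x := expR (lg x).
Hypothesis YE : forall z (f : T2 -> \bar R), measurable_fun setT f -> (forall y, 0 <= f y) ->
  \int[P]_w f (Y (z, w)) = \int[P]_w (f (V w) * (g (z, V w))%:E).
Hypothesis g_bounded : forall y, exists B : R, forall z, (lg (z, y) <= B)%R.
Variable p : T2 -> R.
Hypothesis mp : measurable_fun setT p.
Hypothesis p0 : forall y, (0 < p y)%R.
Hypothesis p1 : \int[P]_w (p (V w))%:E = 1.

Let Vp : {mfun Omega >-> T2} := HB.pack V (isMeasurableFun.Build _ _ _ _ _ mV).
Let Q0 : probability T2 R := distribution P Vp.
Let J := distribution (mu \x P) (pairing X Y).
Let M := (distribution (mu \x P) X \x distribution (mu \x P) Y).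

Let mg : measurable_fun setT g. Proof. exact: measurableT_comp. Qed.
Let g0 x : (0 < g x)%R. Proof. exact: expR_gt0. Qed.

Let mgz y : measurable_fun setT (fun z => (g (z, y))%:E).
Proof.
apply/measurable_EFinP; apply: measurableT_comp mg _.
exact: measurable_fun_pair.
Qed.

Let qe y := \int[mu]_z (g (z, y))%:E.
Let q y : R := fine (qe y).

(** The bound on [lg] uniform in [z] makes the mixture density finite at every [y], so that it can
    be handled as a real number. *)
Let qE y : (q y)%:E = qe y.
Proof.
have [B lgB] := g_bounded y; rewrite fineK// ge0_fin_numE.
  apply: (@le_lt_trans _ _ (\int[mu]_z (expR B)%:E)); last first.
    by rewrite integral_cst// [X in _ * X](_ : _ = 1) ?mule1 ?ltry//; exact: probability_setT.
  by apply: ge0_le_integral => //= z _; rewrite lee_fin ?expR_ge0// ler_expR.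
by apply: integral_ge0 => z _; rewrite lee_fin ltW.
Qed.

Let q0 y : (0 < q y)%R.
Proof.
rewrite -lte_fin qE lt_neqAle integral_ge0 ?andbT; last by move=> z _; rewrite lee_fin ltW.
apply/eqP => /esym e.
have : ae_eq mu setT (fun z => (g (z, y))%:E) (cst 0).
  apply/ae_eq_integral_abs => //; under eq_integral do rewrite gee0_abs ?lee_fin ?ltW//.
  by [].
move=> [N [mN N0 hN]]; have : mu N = 1.
  rewrite -(@probability_setT _ _ _ mu); congr (mu _); apply/seteqP; split=> // z _.
  by apply: hN => /(_ I) /eqP; rewrite eqe gt_eqF.
by rewrite N0 => /esym/eqP; rewrite onee_eq0.
Qed.

Let mq : measurable_fun setT q.
Proof.
apply/measurable_EFinP; rewrite (_ : EFin \o q = qe); last by apply/funext => y /=; rewrite qE.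
apply: (@measurable_fun_fubini_tonelli_G _ _ _ _ R mu (EFin \o g)).
- exact/measurable_EFinP.
- by move=> x; rewrite lee_fin ltW.
Qed.

Let integral_Q0 (f : T2 -> \bar R) : measurable_fun setT f ->
  \int[Q0]_y f y = \int[P]_w f (V w).
Proof. by move=> mf; apply: integral_image_law. Qed.

Let msec z (f : T1 * T2 -> \bar R) : measurable_fun setT f -> measurable_fun setT (fun y => f (z, y)).
Proof.
move=> mf; have m1 : measurable_fun setT (fun y : T2 => (z, y)) by exact: measurable_fun_pair.
exact: measurableT_comp mf m1.
Qed.

Let integral_J (f : T1 * T2 -> \bar R) : measurable_fun setT f -> (forall x, 0 <= f x) ->
  \int[J]_x f x = \int[mu]_z \int[Q0]_y (f (z, y) * (g (z, y))%:E).
Proof.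
move=> mf f0; have mXY := measurable_funPT (pairing X Y).
rewrite (@integral_image_law _ _ _ _ _ (mu \x P) J _ mXY _ f mf)//.
rewrite (@fubini_tonelli1 _ _ _ _ _ mu P (f \o pairing X Y)); last 2 first; [exact: measurableT_comp mf mXY|by move=> x /=|].
apply: eq_integral => z _; rewrite /fubini_F /=.
have E w : pairing X Y (z, w) = (z, Y (z, w)) by rewrite /pairing XE.
under eq_integral do rewrite E.
rewrite (YE z (msec z mf) (fun y => f0 (z, y))) integral_Q0//.
by apply: emeasurable_funM; [exact: msec|apply: (msec z (f := fun x => (g x)%:E)); exact/measurable_EFinP].
Qed.

Let integral_muX (f : T1 -> \bar R) : measurable_fun setT f -> (forall x, 0 <= f x) ->
  \int[distribution (mu \x P) X]_z f z = \int[mu]_z f z.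
Proof.
move=> mf f0; have mX := measurable_funPT X.
rewrite (@integral_image_law _ _ _ _ _ (mu \x P) (distribution (mu \x P) X) _ mX _ f mf)//.
rewrite (@fubini_tonelli1 _ _ _ _ _ mu P (f \o X)); last 2 first; [exact: measurableT_comp mf mX|by move=> x /=|].
apply: eq_integral => z _; rewrite /fubini_F /=.
under eq_integral do rewrite XE /=.
by rewrite integral_cst// [X in _ * X](_ : _ = 1) ?mule1//; exact: probability_setT.
Qed.

Let integral_nuY (f : T2 -> \bar R) : measurable_fun setT f -> (forall x, 0 <= f x) ->
  \int[distribution (mu \x P) Y]_y f y = \int[Q0]_y (f y * (q y)%:E).
Proof.
move=> mf f0; have mY := measurable_funPT Y.
rewrite (@integral_image_law _ _ _ _ _ (mu \x P) (distribution (mu \x P) Y) _ mY _ f mf)//.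
rewrite (@fubini_tonelli1 _ _ _ _ _ mu P (f \o Y)); last 2 first; [exact: measurableT_comp mf mY|by move=> x /=|].
transitivity (\int[mu]_z \int[Q0]_y (f y * (g (z, y))%:E)).
  apply: eq_integral => z _; rewrite /fubini_F /= (YE z mf f0) integral_Q0//.
  by apply: emeasurable_funM => //; apply: (msec z (f := fun x => (g x)%:E)); exact/measurable_EFinP.
rewrite (@fubini_tonelli _ _ _ _ _ mu Q0 (fun x => f x.2 * (g x)%:E))//; last 2 first.
- apply: emeasurable_funM; [exact: measurableT_comp mf measurable_snd|exact/measurable_EFinP].
- by move=> x; rewrite mule_ge0// lee_fin ltW.
apply: eq_integral => y _ /=; rewrite ge0_integralZl//.
- by rewrite qE.
- by move=> z _; rewrite lee_fin ltW.
Qed.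

Let integral_M (f : T1 * T2 -> \bar R) : measurable_fun setT f -> (forall x, 0 <= f x) ->
  \int[M]_x f x = \int[mu]_z \int[Q0]_y (f (z, y) * (q y)%:E).
Proof.
move=> mf f0; rewrite (@fubini_tonelli1 _ _ _ _ _ _ _ f)//.
rewrite integral_muX; last 2 first.
- exact: measurable_fun_fubini_tonelli_F.
- by move=> z; apply: integral_ge0.
by apply: eq_integral => z _; rewrite /fubini_F integral_nuY//; exact: msec.
Qed.

Let h x := (g x / q x.2)%R.

Let mqV : measurable_fun setT (fun y => (q y)^-1%R).
Proof.
rewrite (_ : (fun y => _) = fun y => expR (- ln (q y))).
  apply: measurableT_comp => //; apply: measurableT_comp => //.
  by apply: measurableT_comp => //; exact: measurable_ln.
by apply/funext => y; rewrite expRN lnK// posrE.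
Qed.

Let mh : measurable_fun setT h.
Proof. by apply: measurable_funM => //; exact: measurableT_comp mqV measurable_snd. Qed.

Let h0 x : (0 < h x)%R. Proof. by rewrite divr_gt0. Qed.

(** Relative to the law of [V], the conditional output density is [g] and the marginal one is [q];
    under the product of marginals the factor [q] cancels the denominator of [h]. *)
Let JE A : measurable A -> J A = \int[M]_(x in A) (h x)%:E.
Proof.
move=> mA.
have mI : measurable_fun setT (fun x : T1 * T2 => (\1_A x)%:E : \bar R).
  by apply/measurable_EFinP; exact: measurable_indic.
rewrite -[LHS](_ : \int[J]_x (\1_A x)%:E = _); last by rewrite integral_indic// setIT.
rewrite integral_J//.
have mhA : measurable_fun setT ((fun x => (h x)%:E) \_ A).
  by apply/(measurable_restrictT _ mA); apply: measurable_funTS; exact/measurable_EFinP.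
have hA0 x : 0 <= ((fun x => (h x)%:E) \_ A) x.
  by rewrite patchE; case: ifP => // _; rewrite lee_fin ltW.
rewrite [RHS]integral_mkcond; apply: (etrans _ (esym (integral_M mhA hA0))).
apply: eq_integral => z _; apply: eq_integral => y _.
rewrite patchE indicE /=; case: ifP => _; last by rewrite !mul0e.
by rewrite mul1e -EFinM /h /= divfK// gt_eqF.
Qed.

(** The log-density is [L + ln (p / q)], bounded by [L + e] since [ln x <= x - 1]. The mean of [e]
    under the joint law is 0: integrating out [z] replaces [g] by [q], which cancels and leaves the
    total mass of [p]. *)
Lemma mutual_information_le :
  (mu \x P).-integrable setT (fun x => (lg (x.1, Y x) - ln (p (Y x)))%:E) ->
  mutual_information X Y <= \int[mu \x P]_x (lg (x.1, Y x) - ln (p (Y x)))%:E.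
Proof.
move=> iL; have mXY := measurable_funPT (pairing X Y).
pose L (x : T1 * T2) := (lg x - ln (p x.2))%R.
pose e (x : T1 * T2) := (p x.2 / q x.2 - 1)%R.
have mpq : measurable_fun setT (fun x : T1 * T2 => (p x.2 / q x.2)%R).
  apply: measurable_funM; last exact: measurableT_comp mqV measurable_snd.
  exact: measurableT_comp mp measurable_snd.
have mL : measurable_fun setT L.
  apply: measurable_funB => //; apply: measurableT_comp; first exact: measurable_ln.
  exact: measurableT_comp mp measurable_snd.
have LE : (fun x => (lg (x.1, Y x) - ln (p (Y x)))%:E) = (fun x => (L (pairing X Y x))%:E).
  by apply/funext => x; rewrite /L /pairing XE.
have pq1 : \int[J]_x (p x.2 / q x.2)%:E = 1.
  rewrite integral_J; last 2 first.
  - exact/measurable_EFinP.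
  - by move=> x; rewrite lee_fin divr_ge0 ?ltW.
  rewrite /= (@fubini_tonelli _ _ _ _ _ mu Q0 (fun x => (p x.2 / q x.2)%:E * (g x)%:E)); last 2 first.
  - by apply: emeasurable_funM; exact/measurable_EFinP.
  - by move=> x; rewrite mule_ge0 ?lee_fin ?divr_ge0 ?ltW.
  rewrite -p1 -(integral_Q0 (f := EFin \o p)); last exact/measurable_EFinP.
  apply: eq_integral => y _ /=; rewrite ge0_integralZl//.
  - by rewrite -/(qe y) -qE -EFinM divfK// gt_eqF.
  - by move=> z _; rewrite lee_fin ltW.
  - by rewrite lee_fin divr_ge0 ?ltW.
have iJL : J.-integrable setT (EFin \o L).
  apply/integrableP; split; first exact/measurable_EFinP.
  rewrite (@integral_image_law _ _ _ _ _ (mu \x P) J _ mXY _ (fun x => `|(EFin \o L) x|))//; last first.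
    by apply: measurableT_comp => //; exact/measurable_EFinP.
  by move: iL; rewrite LE => /integrableP[].
have ipq : J.-integrable setT (fun x => (p x.2 / q x.2)%:E).
  apply/integrableP; split; first exact/measurable_EFinP.
  under eq_integral do rewrite gee0_abs ?lee_fin ?divr_ge0 ?ltW//.
  by rewrite pq1 ltry.
have i1 : J.-integrable setT (fun=> 1%:E) by exact: finite_measure_integrable_cst.
have ie : J.-integrable setT (EFin \o e).
  by rewrite (_ : EFin \o e = (fun x => (p x.2 / q x.2)%:E) \- (fun=> 1%:E)); [exact: integrableB|].
have e0 : \int[J]_x (e x)%:E <= 0.
  under eq_integral do rewrite EFinB.
  rewrite integralB// pq1 integral_cst// mul1e.
  by rewrite [X in _ - X](_ : _ = 1) ?subee//; exact: probability_setT.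
have hLe x : (ln (h x) <= L x + e x)%R.
  have hx : (h x / expR (L x) = p x.2 / q x.2)%R.
    rewrite /L expRB lnK ?posrE// /h invf_div.
    by rewrite -/(g x) [LHS]mulrC mulrA divfK// gt_eqF.
  have := @le_ln1Dx R (p x.2 / q x.2 - 1).
  rewrite addrCA subrr addr0 -[in X in ln X]hx ln_div ?posrE ?expR_gt0// expRK lerBlDl.
  by apply; rewrite ltrBrDl subrr divr_gt0.
have := KL_le mh JE iJL ie e0 hLe.
rewrite (@integral_image_law _ _ _ _ _ (mu \x P) J _ mXY _ (EFin \o L))//; last exact/measurable_EFinP.
by rewrite LE; exact: le_trans.
Qed.

End mutual_information_bound.

(** * The bound for one block length *)

Section finite_integrals.
Context d (T : measurableType d) (R : realType) (mu : {measure set T -> \bar R}).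

Lemma integral_Rintegral (f : T -> R) : mu.-integrable setT (EFin \o f) ->
  (\int[mu]_x (f x)%:E = (\int[mu]_x f x)%:E)%E.
Proof. by move=> fi; rewrite fineK//; apply: integrable_fin_num fi. Qed.

Lemma integrable_EFinZ k (f : T -> R) : mu.-integrable setT (EFin \o f) ->
  mu.-integrable setT (fun x => (k * f x)%:E).
Proof. by move=> fi; under eq_fun do rewrite EFinM; exact: integrableZl. Qed.

End finite_integrals.

Section block_bound.
Context d (Omega : measurableType d) (R : realType) (P : probability Omega R) (NT NR : nat).
Variables (H : 'I_NT -> 'I_NR -> int -> {RV P >-> R[i]}).
Variables (W : 'I_NR -> nat -> {RV P >-> R[i]}) (S : 'I_NT -> 'I_NR -> R -> R) (rho beta : R).
Hypothesis chan : mimo_channel H W S.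
Hypothesis rho0 : 0 < rho.
Variable N : nat.
Local Notation block := (N.-tuple (NR.-tuple R[i])).
Local Notation input := (N.-tuple (NT.-tuple R[i])).
Local Notation Y zw := (channel_output H W rho zw : block).

Lemma info_rate_ge0 k l : 0 <= info_rate rho (S k l).
Proof.
apply: Rintegral_ge0 => t Dt; rewrite divr_ge0 ?mulr_ge0 ?pi_ge0// ln_ge0// lerDl.
rewrite mulr_ge0 ?(ltW rho0)//.
by apply: (spectral_ge0 (fading_spectral_density chan k l)); rewrite inE.
Qed.

Variable mu : probability input R.
Hypothesis mu_power : sum_power_constraint beta mu.

Lemma measurable_symbol_power i k : measurable_fun setT (fun z : input => symbol_power z i k).
Proof. exact: measurableT_comp measurable_normc_sqr (measurable_entry i k). Qed.

Let mean_sqnorm i : (\int[mu]_z (\sum_k symbol_power z i k)%:E <= (beta^-1)%:E)%E.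
Proof. by have := mu_power.2 i; rewrite unlock. Qed.

Let isymbol i k : mu.-integrable setT (fun z => (symbol_power z i k)%:E).
Proof.
apply/integrableP; split; first by apply/measurable_EFinP; exact: measurable_symbol_power.
apply: le_lt_trans (ltry (beta^-1)); apply: le_trans (mean_sqnorm i).
apply: ge0_le_integral => //.
- by apply: measurableT_comp => //; apply/measurable_EFinP; exact: measurable_symbol_power.
- by apply/measurable_EFinP; apply: measurable_sum => k'; exact: measurable_symbol_power.
- move=> z _; rewrite lee_fin ger0_norm ?sqr_ge0// (bigD1 k)//= lerDl.
  by apply: sumr_ge0 => k' _; rewrite sqr_ge0.
Qed.

Definition mean_power (i : 'I_N) : 'rV[R]_NT := \row_k \int[mu]_z symbol_power z i k.

Lemma mean_power_region i : power_region beta (mean_power i).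
Proof.
split=> [k|]; first by rewrite mxE; apply: Rintegral_ge0 => z _; rewrite sqr_ge0.
under eq_bigr do rewrite mxE.
rewrite -(Rintegral_sum measurableT) => [|k]; last exact: isymbol.
rewrite -lee_fin -integral_Rintegral; first exact: mean_sqnorm.
by apply: (integrable_EFin_sum measurableT) => k; exact: isymbol.
Qed.

(** Mean received power over the random input. Chosen as reference variance, it makes the
    logarithmic term that of the objective at [mean_power]. *)
Let var i l : R := 1 + rho * \sum_k fading_power H k l * mean_power i ord0 k.

Let var_ge1 i l : 1 <= var i l.
Proof.
rewrite lerDl mulr_ge0 ?(ltW rho0)//; apply: sumr_ge0 => k _.
by rewrite mulr_ge0 ?(fading_power_ge0 chan)//; have [] := mean_power_region i.
Qed.

Let var0 i l : 0 < var i l. Proof. exact: lt_le_trans (var_ge1 i l). Qed.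

Let ioutput i l : mu.-integrable setT (fun z => (output_power H rho z i l)%:E).
Proof.
under eq_fun do rewrite EFinD EFinM.
apply: integrableD => //; first exact: finite_measure_integrable_cst.
apply: integrableZl => //; apply: (integrable_EFin_sum measurableT) => k.
by apply: integrable_EFinZ; exact: isymbol.
Qed.

Let mean_output i l : (\int[mu]_z (output_power H rho z i l)%:E = (var i l)%:E)%E.
Proof.
rewrite (integral_Rintegral (ioutput i l)); congr EFin.
have ifs k : mu.-integrable setT (fun z => (fading_power H k l * symbol_power z i k)%:E).
  by apply: integrable_EFinZ; exact: isymbol.
have isf : mu.-integrable setT (fun z => (\sum_k fading_power H k l * symbol_power z i k)%:E).
  by apply: (integrable_EFin_sum measurableT) => k; exact: ifs.
rewrite RintegralD//; last 2 first.
- exact: finite_measure_integrable_cst.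
- exact: integrable_EFinZ.
rewrite Rintegral_cst// [X in 1 * X](_ : _ = 1) ?mulr1; last first.
  by rewrite -[RHS]/(fine 1%E); congr fine; exact: probability_setT.
rewrite RintegralZl// (Rintegral_sum measurableT)//; congr (_ + _ * _).
by apply: eq_bigr => k _; rewrite (RintegralZl _ measurableT (isymbol i k)) /mean_power mxE.
Qed.

Let mY : measurable_fun setT (fun zw : input * Omega => Y zw).
Proof. exact: measurable_channel_output. Qed.

Let m1 : measurable_fun setT (fst : input * Omega -> input).
Proof. exact: measurable_fst. Qed.

Let sq i l (zw : input * Omega) : R := Normc.normc (entry (Y zw) i l) ^+ 2.
Let inv l (zw : input * Omega) : R := inverse_form H rho zw.1 l (Y zw).
Let ld l (zw : input * Omega) : R := log_det H rho zw.1 l.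

Let sq_int i l : (\int[(mu \x P)%E]_zw (sq i l zw)%:E = (var i l)%:E)%E.
Proof.
rewrite fubini_tonelli1; last 2 first.
- apply/measurable_EFinP; apply: measurableT_comp measurable_normc_sqr _.
  exact: measurableT_comp (measurable_entry i l) mY.
- by move=> zw; rewrite lee_fin sqr_ge0.
rewrite -mean_output; apply: eq_integral => z _.
exact: (integral_output_power chan rho0).
Qed.

Let inv_int l : (\int[(mu \x P)%E]_zw (inv l zw)%:E = N%:R%:E)%E.
Proof.
rewrite fubini_tonelli1; last 2 first.
- by apply/measurable_EFinP; exact: measurable_inverse_form m1 mY l.
- by move=> zw; rewrite lee_fin (inverse_form_ge0 chan rho0).
transitivity (\int[mu]_z (N%:R%:E : \bar R))%E.
  by apply: eq_integral => z _; exact: (integral_output_inverse_form chan rho0).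
by rewrite integral_cst// [X in (_ * X)%E](_ : _ = 1%E) ?mule1//; exact: probability_setT.
Qed.

Let mld l : measurable_fun setT (fun z : input => log_det H rho z l).
Proof. exact: (measurable_log_det H rho (@measurable_id _ _ _)). Qed.

Let ild l : mu.-integrable setT (fun z => (log_det H rho z l)%:E).
Proof.
apply: (@le_integrable _ _ _ mu setT measurableT _ (fun z => (\sum_i (output_power H rho z i l))%:E)).
- exact/measurable_EFinP.
- move=> z _; rewrite lee_fin !ger0_norm ?(log_det_ge0 chan rho0)//.
    apply: (le_trans (log_det_le chan rho0 z l)); apply: ler_sum => i _.
    by rewrite gerBl.
  by apply: sumr_ge0 => i _; apply: le_trans (output_power_ge1 chan rho0 z i l).
- by apply: (integrable_EFin_sum measurableT) => i; exact: ioutput.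
Qed.

Let ld_int l : (\int[(mu \x P)%E]_zw (ld l zw)%:E = \int[mu]_z (log_det H rho z l)%:E)%E.
Proof.
rewrite fubini_tonelli1; last 2 first.
- by apply/measurable_EFinP; exact: measurableT_comp (mld l) m1.
- by move=> zw; rewrite lee_fin (log_det_ge0 chan rho0).
apply: eq_integral => z _; rewrite /fubini_F /ld /= integral_cst//.
by rewrite [X in (_ * X)%E](_ : _ = 1%E) ?mule1//; exact: probability_setT.
Qed.

Let icst (a : R) : (mu \x P)%E.-integrable setT (fun=> a%:E).
Proof.
apply/integrableP; split; first exact: measurable_cst.
rewrite integral_cst// [X in (_ * X)%E](_ : _ = 1%E) ?mule1 ?ltry//; exact: probability_setT.
Qed.

Let ge0_integrable (f : input * Omega -> R) (c : R) : measurable_fun setT f ->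
  (forall x, 0 <= f x) -> (\int[(mu \x P)%E]_x (f x)%:E = c%:E)%E ->
  (mu \x P)%E.-integrable setT (EFin \o f).
Proof.
move=> mf f0 fc; apply/integrableP; split; first exact/measurable_EFinP.
under eq_integral do rewrite /= ger0_norm//.
by rewrite fc ltry.
Qed.

(** The pointwise bound holds where the peak constraint does, that is [mu]-almost everywhere, and it
    is linear in the symbol powers, so integration turns these into [mean_power]. *)
Lemma mean_log_det_ge l :
  \sum_k (\sum_i mean_power i ord0 k) * info_rate rho (S k l) <= \int[mu]_z log_det H rho z l.
Proof.
pose f (z : input) := \sum_k (\sum_i symbol_power z i k) * info_rate rho (S k l).
have iik k : mu.-integrable setT (fun z => (\sum_i symbol_power z i k)%:E).
  by apply: (integrable_EFin_sum measurableT) => i; exact: isymbol.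
have ifk k : mu.-integrable setT (fun z => ((\sum_i symbol_power z i k) * info_rate rho (S k l))%:E).
  by under eq_fun do rewrite EFinM; exact: integrableZr.
have if_ : mu.-integrable setT (EFin \o f).
  by apply: (integrable_EFin_sum measurableT) => k; exact: ifk.
have -> : \sum_k (\sum_i mean_power i ord0 k) * info_rate rho (S k l) = \int[mu]_z f z.
  rewrite (Rintegral_sum measurableT)//; apply: eq_bigr => k _.
  rewrite (RintegralZr _ measurableT (iik k)); congr (_ * _).
  rewrite (Rintegral_sum measurableT) => [|i]; last exact: isymbol.
  by apply: eq_bigr => i _; rewrite mxE.
rewrite -lee_fin -!integral_Rintegral//.
apply: ae_ge0_le_integral => //.
- move=> z _; rewrite lee_fin; apply: sumr_ge0 => k _; rewrite mulr_ge0 ?info_rate_ge0//.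
  by apply: sumr_ge0 => i _; rewrite sqr_ge0.
- exact: measurable_int if_.
- by move=> z _; rewrite lee_fin (log_det_ge0 chan rho0).
- exact/measurable_EFinP.
- have := mu_power.1; apply: filterS => z z1 _; rewrite lee_fin.
  exact: (log_det_info_rate chan rho0 l z1).
exact: ild.
Qed.

Let c i l := Num.sqrt (var i l).

Let c0 i l : 0 < c i l. Proof. by rewrite sqrtr_gt0. Qed.

Let csqr i l : c i l ^+ 2 = var i l. Proof. by rewrite sqr_sqrtr// ltW. Qed.

(** Density, relative to the noise, of independent centred complex normal entries with variances
    [var]. *)
Let p := scale_block_density c.

Let p0 (y : block) : 0 < p y.
Proof. by apply: prodr_gt0 => q _; rewrite mulr_gt0 ?expR_gt0// invr_gt0 exprn_gt0. Qed.

Let ln_p (y : block) : ln (p y) = \sum_(l < NR) \sum_(i < N)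
  (Normc.normc (entry y i l) ^+ 2 * (1 - (var i l)^-1) - ln (var i l)).
Proof.
have -> : p y = expR (\sum_(l < NR) \sum_(i < N)
    (Normc.normc (entry y i l) ^+ 2 * (1 - (var i l)^-1) - ln (var i l))).
  rewrite exchange_big pair_big expR_sum; apply: eq_bigr => -[i l] _ /=.
  by rewrite /scale_density csqr expRB lnK ?posrE// mulrC.
by rewrite expRK.
Qed.

Let L (zw : input * Omega) : R := \sum_(l < NR)
  (\sum_(i < N) (ln (var i l) + (var i l)^-1 * sq i l zw) - (ld l zw + inv l zw)).

Let LE zw : log_output_density H rho zw.1 (Y zw) - ln (p (Y zw)) = L zw.
Proof.
rewrite ln_p /log_output_density -sumrB; apply: eq_bigr => l _.
have -> : \sum_(i < N) (ln (var i l) + (var i l)^-1 * sq i l zw) =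
    \sum_(i < N) sq i l zw - \sum_(i < N) (sq i l zw * (1 - (var i l)^-1) - ln (var i l)).
  by rewrite -sumrB; apply: eq_bigr => i _; ring.
rewrite /ld /inv /sq; ring.
Qed.

Let isq i l : (mu \x P)%E.-integrable setT (EFin \o sq i l).
Proof.
apply: (ge0_integrable _ _ (sq_int i l)); last by move=> zw; rewrite sqr_ge0.
apply: measurableT_comp measurable_normc_sqr _.
exact: measurableT_comp (measurable_entry i l) mY.
Qed.

Let iinv l : (mu \x P)%E.-integrable setT (EFin \o inv l).
Proof.
apply: (ge0_integrable _ _ (inv_int l)); last by move=> zw; rewrite (inverse_form_ge0 chan rho0).
exact: measurable_inverse_form m1 mY l.
Qed.

Let ild2 l : (mu \x P)%E.-integrable setT (EFin \o ld l).
Proof.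
apply: (@ge0_integrable _ (\int[mu]_z log_det H rho z l)).
- exact: measurableT_comp (mld l) m1.
- by move=> zw; rewrite (log_det_ge0 chan rho0).
- by rewrite ld_int (integral_Rintegral (ild l)).
Qed.

Let ivar i l : (mu \x P)%E.-integrable setT (fun zw => (ln (var i l) + (var i l)^-1 * sq i l zw)%:E).
Proof.
under eq_fun do rewrite EFinD EFinM.
apply: integrableD => //; do ?exact: icst.
by apply: integrableZl => //; exact: isq.
Qed.

Let isum l : (mu \x P)%E.-integrable setT
  (fun zw => (\sum_(i < N) (ln (var i l) + (var i l)^-1 * sq i l zw))%:E).
Proof. by apply: (integrable_EFin_sum measurableT) => i; exact: ivar. Qed.

Let irest l : (mu \x P)%E.-integrable setT (fun zw => (ld l zw + inv l zw)%:E).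
Proof. by under eq_fun do rewrite EFinD; apply: integrableD; [|exact: ild2|exact: iinv]. Qed.

Let iLl l : (mu \x P)%E.-integrable setT (fun zw =>
  (\sum_(i < N) (ln (var i l) + (var i l)^-1 * sq i l zw) - (ld l zw + inv l zw))%:E).
Proof. by under eq_fun do rewrite EFinB; apply: integrableB. Qed.

Let iL : (mu \x P)%E.-integrable setT (EFin \o L).
Proof. by apply: (integrable_EFin_sum measurableT) => l; exact: iLl. Qed.

(** Each [sq] divided by its mean [var] contributes 1, so the [N] entries of an antenna cancel the
    mean [N] of the inverse form, and only logarithms survive. *)
Let integral_L : \int[(mu \x P)%E]_zw L zw =
  \sum_(l < NR) (\sum_(i < N) ln (var i l) - \int[mu]_z log_det H rho z l).
Proof.
rewrite (Rintegral_sum measurableT) => [|l]; last exact: iLl.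
apply: eq_bigr => l _; rewrite (RintegralB measurableT (isum l) (irest l)).
rewrite (RintegralD measurableT (ild2 l) (iinv l)).
have -> : \int[(mu \x P)%E]_zw ld l zw = \int[mu]_z log_det H rho z l.
  by rewrite /Rintegral ld_int.
have -> : \int[(mu \x P)%E]_zw inv l zw = N%:R by rewrite /Rintegral inv_int.
rewrite (Rintegral_sum measurableT) => [|i]; last exact: ivar.
transitivity (\sum_(i < N) (ln (var i l) + 1) - (\int[mu]_z log_det H rho z l + N%:R)).
  congr (_ - _); apply: eq_bigr => i _.
  have ic : (mu \x P)%E.-integrable setT (fun=> (ln (var i l))%:E).
    exact: icst.
  rewrite (RintegralD measurableT ic (integrable_EFinZ _ (isq i l))).
  rewrite (RintegralZl _ measurableT (isq i l)).
  rewrite [X in _ * X](_ : _ = var i l); last by rewrite /Rintegral sq_int.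
  rewrite mulVf ?gt_eqF// Rintegral_cst// [X in _ * X](_ : _ = 1) ?mulr1//.
  by rewrite -[RHS]/(fine 1%E); congr fine; exact: probability_setT.
by rewrite big_split /= sumr_const card_ord; ring.
Qed.

Lemma channel_information_le : (channel_information H W rho mu <=
  (\sum_(i < N) bound_objective H S rho (mean_power i))%:E)%E.
Proof.
have mlg : measurable_fun setT (fun x : input * block => log_output_density H rho x.1 x.2).
  exact: (measurable_log_output_density H rho measurable_fst measurable_snd).
(* The scaling identity applied to the constant function 1. *)
have p1 : (\int[P]_w (p (noise_block W N w))%:E = 1)%E.
  have := noise_block_scale chan c0 (measurable_cst 1%E).
  under [in X in _ = X -> _]eq_integral do rewrite mul1e.
  move=> <-; rewrite -[LHS]/(\int[P]_w (cst 1%E w))%E integral_cst// mul1e; exact: probability_setT.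
have bd (y : block) : exists B : R, forall z, log_output_density H rho z y <= B.
  (* Both subtracted terms, [log_det] and [inverse_form], are nonnegative, so the squared norms
     alone bound the log-density uniformly in the input. *)
  exists (\sum_(l < NR) \sum_(i < N) Normc.normc (entry y i l) ^+ 2) => z.
  apply: ler_sum => l _; rewrite -addrA gerDl -opprD oppr_le0 addr_ge0//.
    exact: (log_det_ge0 chan rho0).
  exact: (inverse_form_ge0 chan rho0).
have YE (z : input) (f : block -> \bar R) : measurable_fun setT f -> (forall y, 0 <= f y)%E ->
    (\int[P]_w f (Y (z, w)) = \int[P]_w (f (noise_block W N w) *
       (expR (log_output_density H rho z (noise_block W N w)))%:E))%E.
  by move=> mf _; exact: (output_law_density chan rho0).
have := @mutual_information_le _ _ _ _ _ _ R mu P (channel_input (N := N)) (channel_output H W rho (N := N))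
  (noise_block W N) (fun=> erefl) (measurable_noise_block W (N := N)) _ mlg YE bd p
  (measurable_scale_block_density c) p0 p1.
have LE' : (fun zw => (log_output_density H rho zw.1 (Y zw) - ln (p (Y zw)))%:E) = EFin \o L.
  by apply/funext => zw; rewrite /= LE.
rewrite LE' => /(_ iL) h; apply: (le_trans h).
rewrite integral_Rintegral// lee_fin integral_L.
rewrite /bound_objective exchange_big; apply: ler_sum => l _ /=.
rewrite sumrB; apply: lerB => //.
apply: le_trans (mean_log_det_ge l); rewrite exchange_big.
rewrite le_eqVlt; apply/orP; left; apply/eqP; apply: eq_bigr => k _.
by rewrite mulr_suml.
Qed.

End block_bound.

(** * Maximum and limit *)

(* Row vectors are abstracted as a topological space [T] with coordinates [u],
   because their neighbourhood filter is too transparent for the filter instances. *)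
Section continuous_objective.
Context {R : realType} (T : topologicalType) (n : nat) (u : 'I_n -> T -> R).
Hypothesis uc : forall k, continuous (u k).

Lemma continuous_linear_form (c : 'I_n -> R) : continuous (fun a => \sum_k c k * u k a).
Proof.
apply: continuous_big => [|k _ a]; first exact: add_continuous.
by apply: cvgMl_tmp; exact: uc.
Qed.

Lemma continuous_log_objective m (rho : R) (r I : 'I_n -> 'I_m -> R) (a : T) :
  (forall l, 0 < 1 + rho * \sum_k r k l * u k a) ->
  {for a, continuous (fun a => \sum_(l < m)
    (ln (1 + rho * \sum_k r k l * u k a) - \sum_k u k a * I k l))}.
Proof.
move=> pos; apply: cvg_big => [|l _]; first exact: add_continuous.
apply: cvgB.
  apply: (@continuous_comp _ _ _ (fun a => 1 + rho * \sum_k r k l * u k a) (@ln R) a).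
    by apply: cvgD; [exact: cvg_cst|apply: cvgMl_tmp; exact: continuous_linear_form].
  exact: continuous_ln.
apply: cvg_big => [|k _]; first exact: add_continuous.
by apply: cvgMr_tmp; exact: uc.
Qed.

End continuous_objective.

Section maximum.
Context d (Omega : measurableType d) (R : realType) (P : probability Omega R) (NT NR : nat).
Variables (H : 'I_NT -> 'I_NR -> int -> {RV P >-> R[i]}).
Variables (W : 'I_NR -> nat -> {RV P >-> R[i]}) (S : 'I_NT -> 'I_NR -> R -> R) (rho beta : R).
Hypothesis chan : mimo_channel H W S.
Hypothesis rho0 : 0 < rho.
Hypothesis beta0 : 0 < beta.

Let coord k : continuous (fun a : 'rV[R]_NT => a ord0 k).
Proof. exact: coord_continuous. Qed.

Lemma power_region_compact : compact (power_region beta : set 'rV[R]_NT).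
Proof.
have box : compact [set a : 'rV[R]_NT | forall k, `[0, beta^-1]%classic (a ord0 k)].
  by apply: (@rV_compact R NT (fun=> `[0, beta^-1]%classic)) => k; exact: segment_compact.
apply: subclosed_compact box _ => [|a [a0 a1] k]; last first.
  rewrite /= in_itv /= a0; apply: le_trans a1; rewrite (bigD1 k)//= lerDl.
  by apply: sumr_ge0 => j _.
(* The coefficient 1 puts the sum in the shape of [continuous_linear_form]. *)
rewrite (_ : power_region beta = (\bigcap_k [set a : 'rV[R]_NT | 0 <= a ord0 k]) `&`
    [set a | \sum_k 1 * a ord0 k <= beta^-1]); last first.
  have E (a : 'rV[R]_NT) : \sum_k 1 * a ord0 k = \sum_k a ord0 k.
    by apply: eq_bigr => k _; rewrite mul1r.
  apply/seteqP; split=> a [a0]; rewrite /= E => a1; first by split=> // k _; exact: a0.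
  by split=> // k; exact: a0.
apply: closedI; first apply: closed_bigI => k _.
  by apply: (preimage_closed (f := fun a : 'rV[R]_NT => a ord0 k)) (@closed_ge R 0) => a _; exact: coord.
apply: (preimage_closed (f := fun a : 'rV[R]_NT => \sum_k 1 * a ord0 k)) (@closed_le R beta^-1) => a _.
exact: (continuous_linear_form coord).
Qed.

(** On the region the arguments of the logarithms are at least 1, hence in the domain where [ln] is
    continuous. *)
Lemma bound_objective_continuous :
  {within power_region beta, continuous (bound_objective H S rho)}.
Proof.
apply: continuous_in_subspaceT => a /set_mem[a0 _].
apply: (continuous_log_objective coord (r := fading_power H)) => l.
rewrite ltr_pwDl// mulr_ge0 ?(ltW rho0)//.
by apply: sumr_ge0 => k _; rewrite mulr_ge0// (fading_power_ge0 chan).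
Qed.

Let region0 : power_region beta (0 : 'rV[R]_NT).
Proof.
split=> [k|]; first by rewrite mxE.
by rewrite big1 ?invr_ge0 ?(ltW beta0)// => k _; rewrite mxE.
Qed.

(** Since 0 lies in the region, every upper bound of the objective is nonnegative, which settles the
    degenerate cases of [capacity_le]. *)
Lemma bound_objective0 : bound_objective H S rho 0 = 0.
Proof.
rewrite /bound_objective big1// => l _.
rewrite big1 => [|k _]; last by rewrite mxE mulr0.
by rewrite mulr0 addr0 ln1 big1 ?subr0// => k _; rewrite mxE mul0r.
Qed.

Lemma bound_objective_maximum :
  exists U : R, is_maximum [set bound_objective H S rho a | a in power_region beta] U.
Proof.
have [a aA amax] := EVT_max_rV (ex_intro _ _ region0) power_region_compact bound_objective_continuous.
exists (bound_objective H S rho a); split; first by exists a => //; exact/set_mem.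
by move=> _ [b bA <-]; apply: amax; exact/mem_set.
Qed.

Lemma capacity_le (U : R) : ubound [set bound_objective H S rho a | a in power_region beta] U ->
  (capacity_mimo_s H W rho beta <= U%:E)%E.
Proof.
move=> ubU.
have U0 : 0 <= U by rewrite -bound_objective0; apply: ubU; exists 0.
have bound N : ((N%:R^-1)%:E * ereal_sup
    [set channel_information H W rho mu | mu in @sum_power_constraint R NT beta N] <= U%:E)%E.
  have supN : (ereal_sup [set channel_information H W rho mu |
      mu in @sum_power_constraint R NT beta N] <= (N%:R * U)%:E)%E.
    apply: ge_ereal_sup => _ [mu mu_power <-].
    apply: le_trans (channel_information_le chan rho0 mu_power) _; rewrite lee_fin.
    rewrite mulr_natl -[X in _ *+ X]card_ord -sumr_const; apply: ler_sum => i _.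
    by apply: ubU; exists (mean_power mu i) => //; exact: mean_power_region.
  apply: (@le_trans _ _ ((N%:R^-1)%:E * (N%:R * U)%:E)%E).
    by apply: lee_wpmul2l => //; rewrite lee_fin invr_ge0.
  (* At block length 0 the inverse is 0 by convention, and the bound reduces to [0 <= U]. *)
  rewrite -EFinM lee_fin mulrA; have [->|N0] := eqVneq N 0%N; first by rewrite mulr0 mul0r.
  by rewrite mulVf ?mul1r// pnatr_eq0.
rewrite /capacity_mimo_s.
have [cv|ncv] := pselect (cvgn (fun N => ((N%:R^-1)%:E * ereal_sup
    [set channel_information H W rho mu | mu in @sum_power_constraint R NT beta N])%E)).
  by apply: lime_le => //; exact: nearW.
(* For a sequence without limit, [limn] is the default point 0 of the extended reals, so [0 <= U]
   suffices again. *)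
by rewrite (dvgP ncv) lee_fin.
Qed.

End maximum.

Theorem mainTheorem1 (R : realType) (d : measure_display)
    (Omega : measurableType d) (P : probability Omega R) (NT NR : nat)
    (H : 'I_NT -> 'I_NR -> int -> {RV P >-> R[i]})
    (W : 'I_NR -> nat -> {RV P >-> R[i]})
    (S : 'I_NT -> 'I_NR -> R -> R) (rho beta : R) :
  mimo_channel H W S -> 0 < rho -> 1 <= beta ->
  exists2 U : R,
    is_maximum [set bound_objective H S rho a | a in power_region beta] U &
    (capacity_mimo_s H W rho beta <= U%:E)%E.
Proof.
move=> chan rho0 beta1; have beta0 : 0 < beta by exact: lt_le_trans beta1.
have [U Umax] := bound_objective_maximum chan rho0 beta0.
by exists U => //; apply: (capacity_le chan rho0 beta0); case: Umax.
Qed.
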